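(* Every knot with bridge number $b$ has a checkerboard diagram of type $(2b,2nb)$ for a suitable positive integer $n$.
   Context: $B_s$ denotes the braid group on $s$ strings with standard generators $\sigma_1,\dots,\sigma_{s-1}$. For $s,n\ge 1$, a rosette braid of type $(s,n)$ is a braid (given by the word) in $B_s$ of the form $$\prod_{i=1}^n \Bigl[\prod_{j \text{ odd},\ 1\le j < s} \sigma_j^{\varepsilon_{i,j}} \prod_{j \text{ even},\ 1\le j < s} \sigma_j^{\varepsilon_{i,j}}\Bigr],\qquad \varepsilon_{i,j} \in \{+1,-1\},$$ with signs $\varepsilon_{i,j}$ chosen independently. The set of rosette braids of type $(s,n)$ is denoted $\mathcal{R}(s,n)$. The plat closure of a braid on $2b$ strings is obtained by joining, both at the top and at the bottom, the endpoints in positions $2k-1$ and $2k$ by a simple arc, for $k=1,\dots,b$. A knot diagram is called a checkerboard diagram of type $(2b,n)$ if it is the plat closure of a braid $$\sigma_2^{\varepsilon_2}\sigma_4^{\varepsilon_4}\cdots\sigma_{2b-2}^{\varepsilon_{2b-2}}\cdot \alpha$$ with $\alpha \in \mathcal{R}(2b,n)$ and $\varepsilon_2,\varepsilon_4,\ldots,\varepsilon_{2b-2}\in \{+1,-1\}$ (for $b=1$ the product preceding $\alpha$ is empty). A knot has such a diagram if the diagram represents it up to ambient isotopy. The bridge number is the usual one (the bridge number of the unknot being $1$), i.e. the least $b$ such that the knot is a plat closure of a braid on $2b$ strings. *)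

(* Defs.v *)
From mathcomp Require Import all_boot all_order all_algebra.
From mathcomp Require Import all_classical all_reals all_analysis.

Set Implicit Arguments.
Unset Strict Implicit.
Unset Printing Implicit Defensive.

Import Order.TTheory GRing.Theory Num.Theory.
Import numFieldNormedType.Exports.

Local Open Scope classical_set_scope.
Local Open Scope ring_scope.

(* The pair (j, e) is the generator sigma_j^{+1} if e = true and sigma_j^{-1}
   if e = false, with j counted from 1.  A word represents the product of its
   letters, and every element of the braid group B_s is represented by a word
   on the letters sigma_1^{+1}, sigma_1^{-1}, ..., sigma_{s-1}^{-1}. *)
Definition letter : Type := (nat * bool)%type.

Definition braid_word (s : nat) (w : seq letter) : Prop :=
  forall l, l \in w -> (0 < l.1 < s)%N.

(* [index_iota 1 s] lists the j with 1 <= j < s. *)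
Definition rosette_row (s : nat) (eps : nat -> bool) : seq letter :=
  [seq (j, eps j) | j <- index_iota 1 s & odd j] ++
  [seq (j, eps j) | j <- index_iota 1 s & ~~ odd j].

Definition rosette_word (s n : nat) (eps : nat -> nat -> bool) : seq letter :=
  flatten [seq rosette_row s (eps i) | i <- index_iota 1 n.+1].

Definition rosette_braid (s n : nat) (w : seq letter) : Prop :=
  exists eps : nat -> nat -> bool, w = rosette_word s n eps.

Definition checkerboard_word (b n : nat) (w : seq letter) : Prop :=
  exists (eps : nat -> bool) (alpha : seq letter),
    rosette_braid (2 * b)%N n alpha /\
    w = [seq (j, eps j) | j <- index_iota 1 (2 * b)%N & ~~ odd j] ++ alpha.

Notation space3 R := (R * R * R)%type.

Section Space.
Variable R : realType.

Local Notation E3 := (space3 R).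

Definition homeomorphism (f : E3 -> E3) : Prop :=
  continuous f /\
  exists g : E3 -> E3, [/\ continuous g, cancel f g & cancel g f].

Definition ambient_isotopic (K L : set E3) : Prop :=
  exists H : R -> E3 -> E3,
    [/\ {within `[0, 1] `*` [set: E3],
          continuous (fun p : R * E3 => H p.1 p.2)},
        (forall t : R, t \in `[0, 1] -> homeomorphism (H t)),
        (forall p : E3, H 0 p = p) &
        H 1 @` K = L].

(* An embedded circle, written as a simple closed curve.  Tameness is not
   imposed here: a set with a bridge number (below) is ambient isotopic to a
   polygon, hence is tame. *)
Definition knot (K : set E3) : Prop :=
  exists gamma : R -> E3,
    [/\ {within `[0, 1], continuous gamma},
        gamma 0 = gamma 1,
        {in `[0, 1[ &, injective gamma} &
        K = gamma @` `[0, 1]].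

(* Plat closures are drawn as polygonal curves.  The third coordinate is the
   height, the plane y = 0 is the plane of the diagram, and projecting along
   the y axis gives the diagram with its crossing information.  The k-th letter
   of a word (k = 0, 1, ...) occupies the heights k to k + 1, and string
   positions are the points (j, 0) with 1 <= j <= s. *)
Definition tent (t : R) : R := Num.min t (1 - t).

Definition sgn_of (e : bool) : R := if e then 1 else -1.

(* In sigma_j^{+-1} the strings in positions j and j + 1 are exchanged, passing
   the height k + 1/2 on opposite sides of the plane y = 0; the sign decides
   which of the two is in front. *)
Definition letter_strands (s : nat) (l : letter) (k : nat) : set E3 :=
  [set p : E3 | exists2 t : R, t \in `[0, 1] &
     [\/ p = (l.1%:R + t, sgn_of l.2 * tent t, k%:R + t),
         p = (l.1.+1%:R - t, - (sgn_of l.2 * tent t), k%:R + t) |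
         exists j : nat, [/\ (1 <= j <= s)%N, j != l.1, j != l.1.+1 &
           p = (j%:R, 0, k%:R + t)] ] ].

Definition braid_strands (s : nat) (w : seq letter) : set E3 :=
  \bigcup_(k in `I_(size w)) letter_strands s (nth (0%N, true) w k) k.

Definition bottom_caps (b : nat) : set E3 :=
  [set p : E3 | exists2 k : nat, (1 <= k <= b)%N & exists2 t : R, t \in `[0, 1] &
     p = ((2 * k - 1)%N%:R + t, 0, - tent t)].

Definition top_caps (b h : nat) : set E3 :=
  [set p : E3 | exists2 k : nat, (1 <= k <= b)%N & exists2 t : R, t \in `[0, 1] &
     p = ((2 * k - 1)%N%:R + t, 0, h%:R + tent t)].

Definition plat_closure (b : nat) (w : seq letter) : set E3 :=
  bottom_caps b `|` braid_strands (2 * b)%N w `|` top_caps b (size w).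

Definition has_plat_presentation (K : set E3) (b : nat) : Prop :=
  exists2 w : seq letter, braid_word (2 * b)%N w &
    ambient_isotopic K (plat_closure b w).

Definition has_bridge_number (K : set E3) (b : nat) : Prop :=
  [/\ (0 < b)%N, has_plat_presentation K b &
      forall c : nat, (0 < c)%N -> has_plat_presentation K c -> (b <= c)%N].

(* K has a checkerboard diagram of type (2b, n). *)
Definition has_checkerboard_diagram (K : set E3) (b n : nat) : Prop :=
  exists2 w : seq letter, checkerboard_word b n w &
    ambient_isotopic K (plat_closure b w).

End Space.

(* Main.v *)
Require Import Defs.
From mathcomp Require Import all_boot all_order all_algebra.
From mathcomp Require Import all_classical all_reals all_analysis.
From mathcomp Require Import ring lra zify.

Set Implicit Arguments.
Unset Strict Implicit.
Unset Printing Implicit Defensive.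

Import Order.TTheory GRing.Theory Num.Theory.
Import numFieldNormedType.Exports.

(** A plat closure is drawn as a union of graphs over the height axis: each half of a cap
    belongs to the strand that runs into it. A word is called layered when its strands can
    be given depths such that at each crossing the strand of greater depth is in front.
    Its strands can then be pulled apart into parallel planes, one for each depth
    ([lift_layers]), and horizontal shears move the strands of each plane at will. Hence a
    layered word with trivial permutation can be deleted ([delete_pure_word]), and a
    layered word that permutes the caps, the legs of each cap having consecutive depths,
    can be slid off over the top caps ([slide_over_caps]). Turning the picture upside down
    gives the same for the bottom caps. The first move contains all braid relations, the
    second one provides all permutations of the caps.

    It follows that layered words with the same permutation and the same depths represent
    the same braid ([layered_word_perm]). In a rosette with [2b] strings and [b] rows the
    order of the strands is reversed, so after [2b] rows the permutation is trivial and
    all pairs of strands have crossed; if layered, such a rosette is the trivial braid,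
    whatever the depths. Reversing one of its crossings turns it into a full twist of two
    strands [a] and [c]. When [a] and [c] have consecutive depths, no strand runs between
    them, and this full twist is exactly the effect of exchanging the depths of [a] and
    [c] in any layered word in which they cross ([swap_depths]). So depths can be
    changed at the cost of a rosette on the left. Reading a word from left to right,
    it can therefore be kept in the form of a rosette followed by a layered word: before
    each letter, the depths are adapted to its sign ([word_rosette]). If the
    permutation is trivial then the layered word disappears, so every pure braid is a
    rosette of type [(2b, 2bn)] ([pure_rosette]).

    It remains to make the permutation right. As a knot is connected, the strands and
    the caps of its plat closure form a single cycle ([connected_strands]). The same is true
    for the word [sigma_2 sigma_4 ... sigma_(2b-2)]. Matching the two cycles ([match_walks])
    tells how to permute the bottom caps and the top caps so that the braid gets the
    permutation of that word ([plat_equiv_evens]); what remains on its right is a pure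
    braid, hence a rosette. *)

(** * Words and permutations *)

Definition transp (j i : nat) : nat :=
  if i == j then j.+1 else if i == j.+1 then j else i.

Definition pos (js : seq nat) (i : nat) : nat := foldl (fun i j => transp j i) i js.

Definition valid (s : nat) (js : seq nat) : bool := all (fun j => 0 < j < s) js.

Definition idx (w : seq letter) : seq nat := map fst w.

Lemma transpK j : involutive (transp j).
Proof. move=> i; rewrite /transp; repeat (case: eqP => //=); lia. Qed.

Lemma transp_inj j : injective (transp j).
Proof. exact: inv_inj (transpK j). Qed.

Lemma transp_range s j i : 0 < j < s -> (1 <= transp j i <= s) = (1 <= i <= s).
Proof. by rewrite /transp; repeat (case: eqP => ? //=); lia. Qed.

Lemma pos_cons j js i : pos (j :: js) i = pos js (transp j i).
Proof. by []. Qed.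

Lemma pos_cat js ks i : pos (js ++ ks) i = pos ks (pos js i).
Proof. by rewrite /pos foldl_cat. Qed.

Lemma pos_rcons js j i : pos (rcons js j) i = transp j (pos js i).
Proof. by rewrite -cats1 pos_cat. Qed.

Lemma posK js : cancel (pos js) (pos (rev js)).
Proof.
elim: js => [//|j js IH] i.
by rewrite rev_cons pos_rcons pos_cons IH transpK.
Qed.

Lemma pos_revK js : cancel (pos (rev js)) (pos js).
Proof. by move=> i; rewrite -{1}(revK js) posK. Qed.

Lemma pos_inj js : injective (pos js).
Proof. exact: can_inj (posK js). Qed.

Lemma pos_range s js i : valid s js -> (1 <= pos js i <= s) = (1 <= i <= s).
Proof.
elim: js i => [|j js IH] i //= /andP[jj vj].
by rewrite IH // transp_range.
Qed.

Lemma valid_cat s js ks : valid s (js ++ ks) = valid s js && valid s ks.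
Proof. exact: all_cat. Qed.

Lemma valid_rev s js : valid s (rev js) = valid s js.
Proof. exact: all_rev. Qed.

Lemma idx_cat v w : idx (v ++ w) = idx v ++ idx w.
Proof. exact: map_cat. Qed.

Lemma size_idx w : size (idx w) = size w.
Proof. exact: size_map. Qed.

Lemma braid_wordP s w : braid_word s w <-> valid s (idx w).
Proof.
split=> [H|/allP H l lv]; last exact: H (map_f _ lv).
by apply/allP => _ /mapP[l lv ->]; exact: H.
Qed.

(** The position joined to [i] by a cap. *)
Definition mate (i : nat) : nat := if odd i then i.+1 else i.-1.

Lemma mateK i : 0 < i -> mate (mate i) = i.
Proof.
case: i => // i _; rewrite /mate /=; case: (boolP (odd i)) => [h|/negbTE h] /=; last by rewrite h.
by case: i h => //= i ->.
Qed.

Lemma mate_neq i : 0 < i -> mate i != i.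
Proof. by rewrite /mate; case: ifP => ? ?; apply/eqP; lia. Qed.

Lemma mate_consecutive i : 0 < i -> mate i = i.+1 \/ i = (mate i).+1.
Proof. by rewrite /mate; case: ifP; [left|right; rewrite prednK]. Qed.

Lemma mate_range b i : 1 <= i <= 2 * b -> 1 <= mate i <= 2 * b.
Proof.
move=> ib; have := odd_double_half i; rewrite /mate; case: odd => /=; lia.
Qed.

(** Depths are attached to the positions before the word, so each letter transports them:
    [d \o transp j] are the depths after a crossing of the positions [j] and [j.+1]. *)
Fixpoint layered (d : nat -> nat) (w : seq letter) : bool :=
  if w is l :: w' then (l.2 == (d l.1.+1 < d l.1)) && layered (d \o transp l.1) w' else true.

Local Open Scope classical_set_scope.
Local Open Scope ring_scope.

(** * Continuous real functions *)

Section ContinuousFunctions.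
Context {R : realType} {T : topologicalType}.
Implicit Types f g : T -> R.

Lemma cont_cst (c : R) : continuous (fun _ : T => c).
Proof. exact: cst_continuous. Qed.

Lemma cont_add f g : continuous f -> continuous g ->
  continuous (fun x => f x + g x).
Proof. by move=> cf cg x; apply: cvgD; [exact: cf|exact: cg]. Qed.

Lemma cont_opp f : continuous f -> continuous (fun x => - f x).
Proof. by move=> cf x; apply: cvgN; exact: cf. Qed.

Lemma cont_mul f g : continuous f -> continuous g ->
  continuous (fun x => f x * g x).
Proof. by move=> cf cg x; apply: cvgM; [exact: cf|exact: cg]. Qed.

Lemma cont_max f g : continuous f -> continuous g ->
  continuous (fun x => Num.max (f x) (g x)).
Proof. by move=> cf cg x; apply: (@continuous_max R T f g x); [exact: cf|exact: cg]. Qed.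

Lemma cont_min f g : continuous f -> continuous g ->
  continuous (fun x => Num.min (f x) (g x)).
Proof. by move=> cf cg x; apply: (@continuous_min R T f g x); [exact: cf|exact: cg]. Qed.

Lemma cont_norm f : continuous f -> continuous (fun x => `|f x|).
Proof. by move=> cf x; apply: cvg_norm; exact: cf. Qed.

Lemma cont_sum (I : Type) (r : seq I) (F : I -> T -> R) :
  (forall i, continuous (F i)) -> continuous (fun x => \sum_(i <- r) F i x).
Proof.
move=> cF; elim: r => [|i r IH].
  have -> : (fun x => \sum_(i <- [::]) F i x) = (fun _ : T => 0).
    by apply/funext => x; rewrite big_nil.
  exact: cont_cst.
have -> : (fun x => \sum_(j <- i :: r) F j x) =
          (fun x => F i x + \sum_(j <- r) F j x).
  by apply/funext => x; rewrite big_cons.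
exact: cont_add.
Qed.

Lemma cont_comp (U : topologicalType) (g : U -> R) (f : T -> U) :
  continuous g -> continuous f -> continuous (fun x => g (f x)).
Proof. by move=> cg cf x; apply: continuous_comp; [exact: cf|exact: cg]. Qed.

Lemma cont_pair (U V : topologicalType) (f : T -> U) (g : T -> V) :
  continuous f -> continuous g -> continuous (fun x => (f x, g x)).
Proof. by move=> cf cg x; apply: cvg_pair; [exact: cf|exact: cg]. Qed.

Lemma cont_fst (U V : topologicalType) (f : T -> U * V) :
  continuous f -> continuous (fun x => (f x).1).
Proof.
move=> cf x; apply: (@continuous_comp _ _ _ f fst); first exact: cf.
exact: cvg_fst.
Qed.

Lemma cont_snd (U V : topologicalType) (f : T -> U * V) :
  continuous f -> continuous (fun x => (f x).2).
Proof.
move=> cf x; apply: (@continuous_comp _ _ _ f snd); first exact: cf.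
exact: cvg_snd.
Qed.

End ContinuousFunctions.

Lemma cont_compT (T U V : topologicalType) (g : U -> V) (f : T -> U) :
  continuous g -> continuous f -> continuous (fun x => g (f x)).
Proof. by move=> cg cf x; apply: continuous_comp; [exact: cf|exact: cg]. Qed.

Lemma cont_id (T : topologicalType) : continuous (fun x : T => x).
Proof. by move=> x; exact: cvg_id. Qed.

Create HintDb cont.

Ltac cont1 :=
  lazymatch goal with
  | |- forall x, continuous_at x (fun _ => ?c) => exact: cst_continuous
  | |- forall x, continuous_at x (fun x => x) => exact: cont_id
  | |- forall x, continuous_at x (fun x => @?f x + @?g x) =>
      refine (cont_add (f := f) (g := g) _ _)
  | |- forall x, continuous_at x (fun x => - @?f x) =>
      refine (cont_opp (f := f) _)
  | |- forall x, continuous_at x (fun x => @?f x * @?g x) =>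
      refine (cont_mul (f := f) (g := g) _ _)
  | |- forall x, continuous_at x (fun x => Num.max (@?f x) (@?g x)) =>
      refine (cont_max (f := f) (g := g) _ _)
  | |- forall x, continuous_at x (fun x => Num.min (@?f x) (@?g x)) =>
      refine (cont_min (f := f) (g := g) _ _)
  | |- forall x, continuous_at x (fun x => Num.norm (@?f x)) =>
      refine (cont_norm (f := f) _)
  | |- forall x, continuous_at x (fun x => (@?f x, @?g x)) =>
      refine (cont_pair (f := f) (g := g) _ _)
  | |- forall x, continuous_at x (fun x => (@?f x).1) =>
      refine (cont_fst (f := f) _)
  | |- forall x, continuous_at x (fun x => (@?f x).2) =>
      refine (cont_snd (f := f) _)
  | |- forall x, continuous_at x (fun x => \sum_(i <- _) _) =>
      apply: cont_sum => ?
  | |- forall x, continuous_at x (fun x => ?F (@?g x)) =>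
      refine (cont_compT (g := F) (f := g) _ _); [solve [auto with cont]|]
  end.

Ltac cont_leaf :=
  first [ exact: (cont_snd (f := id) (@cont_id _))
        | exact: (cont_fst (f := id) (@cont_id _)) ].

Ltac cont := cbv beta; repeat first [assumption | cont1; cbv beta | cont_leaf].

Ltac simple_arg a :=
  lazymatch a with
  | context [Num.max] => fail
  | context [Num.min] => fail
  | context [Num.norm] => fail
  | _ => idtac
  end.

(* Eliminates minima, maxima and absolute values from the goal, innermost
   first, and leaves linear arithmetic. *)
Ltac mml :=
  rewrite /=; repeat match goal with
  | |- context [Num.max ?a ?b] => simple_arg a; simple_arg b; case: (leP a b) => ?
  | |- context [Num.min ?a ?b] => simple_arg a; simple_arg b; case: (leP a b) => ?
  | |- context [Num.norm ?a] => simple_arg a; case: (ger0P a) => ?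
  end; intros; try lra;
  try (match goal with
       | |- _ = _ => apply/eqP; rewrite eq_le; apply/andP; split; lra
       end).

(** * Ambient isotopies *)

Section Isotopy.
Variable R : realType.
Local Notation E3 := (space3 R).
Implicit Types K L M : set E3.

Lemma homeo_id : homeomorphism (@id E3).
Proof. by split; [exact: cont_id|exists id; split => //; exact: cont_id]. Qed.

Lemma homeo_comp (f g : E3 -> E3) :
  homeomorphism f -> homeomorphism g -> homeomorphism (f \o g).
Proof.
move=> [cf [f' [cf' ff' f'f]]] [cg [g' [cg' gg' g'g]]]; split.
  by move=> x; apply: continuous_comp; [exact: cg|exact: cf].
exists (g' \o f'); split.
- by move=> x; apply: continuous_comp; [exact: cf'|exact: cg'].
- exact: can_comp.
- exact: can_comp.
Qed.


Definition clamp (t : R) : R := Num.max 0 (Num.min t 1).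

Lemma clamp_itv t : clamp t \in `[0, 1].
Proof. by rewrite /clamp in_itv /=; apply/andP; split; mml. Qed.

Lemma clamp_id t : t \in `[0, 1] -> clamp t = t.
Proof. by rewrite /clamp in_itv /= => /andP[? ?]; mml. Qed.

Lemma cont_clamp : continuous clamp.
Proof. rewrite /clamp; cont. Qed.
#[local] Hint Resolve cont_clamp : cont.

Lemma continuous_within_comp (T U V : topologicalType) (A : set U)
    (f : U -> V) (g : T -> U) :
  {within A, continuous f} -> continuous g -> (forall x, A (g x)) ->
  continuous (f \o g).
Proof.
move=> /subspace_continuousP cf cg Ag x.
apply: (cvg_comp _ _ _ (cf _ (Ag x))).
move=> B; rewrite /within /= /nbhs /= => nB.
have := cg x _ nB; rewrite /nbhs /=; apply: filterS => y /=; exact.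
Qed.

(** Isotopies that are continuous for all times compose without restrictions to
    subspaces, and freezing an isotopy outside the unit interval extends it. *)
Lemma isotopicP K L : ambient_isotopic K L <->
  exists H : R -> E3 -> E3,
    [/\ continuous (fun p : R * E3 => H p.1 p.2),
        (forall t : R, homeomorphism (H t)),
        (forall p : E3, H 0 p = p) & H 1 @` K = L].
Proof.
split=> [[H [cH hH H0 HK]]|[H [cH hH H0 HK]]]; last first.
  by exists H; split=> //; exact: continuous_subspaceT.
exists (fun t => H (clamp t)); split.
- apply: (continuous_within_comp (g := fun p : R * E3 => (clamp p.1, p.2)) cH).
    by cont.
  by move=> p; split => //=; exact: clamp_itv.
- by move=> t; apply: hH; exact: clamp_itv.
- by move=> p; rewrite clamp_id ?H0// in_itv/= lexx ler01.
- by rewrite clamp_id// in_itv/= lexx ler01.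
Qed.

Lemma isotopic_refl K : ambient_isotopic K K.
Proof.
apply/isotopicP; exists (fun _ => id); split => //.
- by apply: cont_snd; exact: cont_id.
- by move=> _; exact: homeo_id.
- by rewrite image_id.
Qed.

(** Composing the two motions at each time avoids gluing them one after the other. *)
Lemma isotopic_trans K L M :
  ambient_isotopic K L -> ambient_isotopic L M -> ambient_isotopic K M.
Proof.
move=> /isotopicP[H [cH hH H0 HK]] /isotopicP[G [cG hG G0 GL]].
apply/isotopicP; exists (fun t => G t \o H t); split.
- apply: (cont_compT (g := fun p : R * E3 => G p.1 p.2)
    (f := fun p : R * E3 => (p.1, H p.1 p.2))) => //.
  by cont.
- by move=> t; exact: homeo_comp.
- by move=> p /=; rewrite H0 G0.
- by rewrite -image_comp HK GL.
Qed.

(** The reversed motion [H (1 - t)] starts at [H 1] rather than at the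
    identity; precomposing it with the inverse of [H 1] corrects this without
    requiring the inverses of the [H t] to be jointly continuous. *)
Lemma isotopic_sym K L : ambient_isotopic K L -> ambient_isotopic L K.
Proof.
move=> /isotopicP[H [cH hH H0 HK]].
have [cH1 [g [cg gK Kg]]] := hH 1.
apply/isotopicP; exists (fun t => H (1 - t) \o g); split.
- apply: (cont_compT (g := fun p : R * E3 => H p.1 p.2)
    (f := fun p : R * E3 => (1 - p.1, g p.2))) => //.
  by cont; apply: cont_compT => //; cont.
- move=> t; apply: homeo_comp; first exact: hH.
  by split=> //; exists (H 1).
- by move=> p /=; rewrite subr0 Kg.
- rewrite subrr -HK image_comp -[RHS]image_id; congr (_ @` K).
  by apply/funext => p /=; rewrite gK H0.
Qed.

(** Conjugation by homeomorphisms transports isotopies even when [h] reverses the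
    orientation; this is used for exchanges of coordinates and for reflections. *)
Lemma isotopic_conj (h h' : E3 -> E3) K L :
  continuous h -> continuous h' -> cancel h h' -> cancel h' h ->
  ambient_isotopic K L -> ambient_isotopic (h @` K) (h @` L).
Proof.
move=> ch ch' hK Kh /isotopicP[H [cH hH H0 HK]].
apply/isotopicP; exists (fun t => h \o (H t \o h')); split.
- apply: (cont_compT (g := h)) => //.
  apply: (cont_compT (g := fun p : R * E3 => H p.1 p.2)
    (f := fun p : R * E3 => (p.1, h' p.2))) => //.
  by cont; apply: cont_compT => //; cont.
- move=> t; apply: homeo_comp; first by split=> //; exists h'.
  by apply: homeo_comp; [exact: hH|split=> //; exists h].
- by move=> p /=; rewrite H0 Kh.
- rewrite -HK !image_comp; congr (_ @` K).
  by apply/funext => p /=; rewrite hK.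
Qed.

(** A continuous family of increasing bijections of the line has a continuous
    family of inverses: if [y] is strictly between [phi q (x - e)] and
    [phi q (x + e)], it stays so for neighbouring parameters. *)
Lemma fiberwise_homeo (Q : topologicalType) (phi : Q -> R -> R) :
  continuous (fun p : Q * R => phi p.1 p.2) ->
  (forall q, {mono phi q : x y / x < y}) ->
  (forall q, exists C, forall x, `|phi q x - x| <= C) ->
  exists psi : Q -> R -> R,
    [/\ continuous (fun p : Q * R => psi p.1 p.2),
        (forall q, cancel (phi q) (psi q)) & (forall q, cancel (psi q) (phi q))].
Proof.
move=> cphi mono bnd.
have surj q y : exists x, phi q x = y.
  have [C HC] := bnd q.
  have C0 : 0 <= C by apply: le_trans (HC 0).
  have yy : y - C <= y + C by lra.
  have cq : {within `[y - C, y + C], continuous (phi q)}.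
    apply: continuous_subspaceT.
    apply: (cont_comp (g := fun p : Q * R => phi p.1 p.2) (f := fun x => (q, x))) => //.
    by cont.
  have [|c _ <-] := IVT (v := y) yy cq; last by exists c.
  have := HC (y - C); have := HC (y + C); rewrite !ler_norml => /andP[? ?] /andP[? ?].
  by rewrite ge_min le_max; apply/andP; split; apply/orP; [left|right]; lra.
pose psi q y := xget 0 [set x | phi q x = y].
have psiK q y : phi q (psi q y) = y.
  by rewrite /psi; case: xgetP => [x _ //|] /(_ (projT1 (cid (surj q y)))); case: cid.
have inj q : injective (phi q).
  move=> x y /eqP; rewrite eq_le => /andP[]; rewrite !leNgt !mono -!leNgt => *.
  by apply/eqP; rewrite eq_le; apply/andP.
exists psi; split=> //; last first.
  by move=> q x; apply: (inj q); exact: psiK.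
move=> [q0 y0] /=; apply/cvgrPdist_lt => e e0.
set x0 := psi q0 y0.
have cphi' (x : R) : continuous (fun p : Q * R => p.2 - phi p.1 x).
  apply: cont_add; first by cont.
  apply: cont_opp.
  apply: (cont_comp (g := fun p : Q * R => phi p.1 p.2) (f := fun p => (p.1, x))) => //.
  by cont.
have H1 : \forall p \near (q0, y0), 0 < p.2 - phi p.1 (x0 - e).
  have := cphi' (x0 - e) (q0, y0) => /cvgr_gt; apply => /=.
  by rewrite subr_gt0 -[ltRHS](psiK q0 y0) mono -/x0; lra.
have H2 : \forall p \near (q0, y0), p.2 - phi p.1 (x0 + e) < 0.
  have := cphi' (x0 + e) (q0, y0) => /cvgr_lt; apply => /=.
  by rewrite subr_lt0 -[ltLHS](psiK q0 y0) mono -/x0; lra.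
near=> p.
have h1 : 0 < p.2 - phi p.1 (x0 - e) by near: p.
have h2 : p.2 - phi p.1 (x0 + e) < 0 by near: p.
move: h1; rewrite subr_gt0 -[ltRHS](psiK p.1 p.2) mono => ?.
move: h2; rewrite subr_lt0 -[ltLHS](psiK p.1 p.2) mono => ?.
rewrite ltr_norml; apply/andP; split; lra.
Unshelve. all: by end_near.
Qed.

(** Increasing bijections of the line form a convex set, so a homeomorphism that preserves
    the vertical lines and their orientation is joined to the identity by straight lines. *)
Lemma isotopic_fiber_z (phi : R * R -> R -> R) K :
  continuous (fun p : E3 => phi p.1 p.2) ->
  (forall q, {mono phi q : x y / x < y}) ->
  (forall q, exists C, forall x, `|phi q x - x| <= C) ->
  ambient_isotopic K ((fun p => (p.1, phi p.1 p.2)) @` K).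
Proof.
move=> cphi mono bnd.
pose h t q x := x + t * (phi q x - x).
exists (fun t p => (p.1, h t p.1 p.2)); split.
- apply: continuous_subspaceT; rewrite /h; cont.
  by apply: (cont_comp (g := fun p : E3 => phi p.1 p.2)) => //; cont.
- move=> t; rewrite in_itv /= => /andP[t0 t1].
  have ch : continuous (fun p : E3 => h t p.1 p.2) by rewrite /h; cont.
  have hlt q x y : x < y -> h t q x < h t q y.
    move=> xy; have := xy; rewrite -(mono q) /h => pxy.
    have a0 : 0 <= (1 - t) * (y - x) by apply: mulr_ge0; lra.
    move: t0; rewrite le_eqVlt => /orP[/eqP <-|t0]; first lra.
    have b0 : 0 < t * (phi q y - phi q x) by apply: mulr_gt0; lra.
    lra.
  have mh q : {mono h t q : x y / x < y}.
    move=> x y; apply/idP/idP; last exact: hlt.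
    rewrite ltNge => hn; rewrite ltNge; apply: contra hn.
    by rewrite le_eqVlt => /orP[/eqP->//|/(hlt q)/ltW].
  have bh q : exists C, forall x, `|h t q x - x| <= C.
    have [C HC] := bnd q; exists C => x; apply: le_trans (HC x).
    by rewrite /h addrAC subrr add0r normrM ger0_norm // ler_piMl.
  have [psi [cpsi pK Kp]] := fiberwise_homeo ch mh bh.
  split; first by cont.
  exists (fun p => (p.1, psi p.1 p.2)); split; first by cont.
    by case=> q x /=; rewrite pK.
  by case=> q x /=; rewrite Kp.
- by case=> q x /=; rewrite /h mul0r addr0.
- by congr (_ @` K); apply/funext => -[q x] /=; rewrite /h mul1r addrC subrK.
Qed.

End Isotopy.

(** * Moving figures that are unions of graphs *)

Section Figures.
Variable R : realType.
Local Notation E3 := (space3 R).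
#[local] Hint Resolve cont_clamp : cont.

Definition swap_xy (p : E3) : E3 := (p.1.2, p.1.1, p.2).
Definition swap_yz (p : E3) : E3 := (p.1.1, p.2, p.1.2).

Lemma swap_xyK : involutive swap_xy. Proof. by case=> [[x y] z]. Qed.
Lemma swap_yzK : involutive swap_yz. Proof. by case=> [[x y] z]. Qed.
Lemma cont_swap_xy : continuous swap_xy. Proof. rewrite /swap_xy; cont. Qed.
Lemma cont_swap_yz : continuous swap_yz. Proof. rewrite /swap_yz; cont. Qed.

Lemma isotopic_invol (h : E3 -> E3) (K L : set E3) :
  continuous h -> involutive h ->
  ambient_isotopic (h @` K) (h @` L) -> ambient_isotopic K L.
Proof.
move=> ch hK /(isotopic_conj ch ch hK hK).
have hh M : h @` (h @` M) = M.
  by rewrite image_comp -[RHS]image_id; congr (_ @` M); apply/funext => p /=; rewrite hK.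
by rewrite !hh.
Qed.

Lemma isotopic_move_y (L : R) (g : R -> R -> R -> R) (K : set E3) : L < 1 ->
  continuous (fun p : E3 => g p.1.1 p.2 p.1.2) ->
  (forall x z y y', `|g x z y - g x z y'| <= L * `|y - y'|) ->
  (forall x z, exists C, forall y, `|g x z y| <= C) ->
  ambient_isotopic K ((fun p => (p.1.1, p.1.2 + g p.1.1 p.2 p.1.2, p.2)) @` K).
Proof.
move=> L1 cg lip bnd.
apply: (isotopic_invol cont_swap_yz swap_yzK).
have : ambient_isotopic (swap_yz @` K)
  ((fun p => (p.1, p.2 + g p.1.1 p.1.2 p.2)) @` (swap_yz @` K)).
  apply: (@isotopic_fiber_z R (fun q y => y + g q.1 q.2 y)).
  - apply: cont_add; first by cont.
    exact: (cont_compT (g := fun p : E3 => g p.1.1 p.2 p.1.2) cg cont_swap_yz).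
  - move=> q.
    have H x y : x < y -> x + g q.1 q.2 x < y + g q.1 q.2 y.
      move=> xy; have := lip q.1 q.2 x y.
      rewrite (ltr0_norm (x := x - y)) ?subr_lt0// ler_norml => /andP[_ ?].
      have : L * (y - x) < y - x by rewrite gtr_pMl // subr_gt0.
      lra.
    move=> x y; apply/idP/idP; last exact: H.
    rewrite ltNge => hn; rewrite ltNge; apply: contra hn.
    by rewrite le_eqVlt => /orP[/eqP->//|/H/ltW].
  - move=> q; have [C HC] := bnd q.1 q.2; exists C => x.
    by rewrite addrAC subrr add0r.
by rewrite !image_comp.
Qed.

(** The strands [X i], [Y i] are given as functions of the height, so that the homeomorphisms
    used below act on them by simple formulas. *)
Definition fig (s : nat) (lo hi : R) (X Y : nat -> R -> R) : set E3 :=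
  [set p | exists2 i : nat, (1 <= i <= s)%N &
     exists2 z : R, lo <= z <= hi & p = (X i z, Y i z, z)].

Lemma swap_fig s lo hi X Y : swap_xy @` fig s lo hi X Y = fig s lo hi Y X.
Proof.
apply/seteqP; split=> [_ [_ [i ii [z zz ->] <-]]|_ [i ii [z zz ->]]].
  by exists i => //; exists z.
by exists (X i z, Y i z, z) => //; exists i => //; exists z.
Qed.

Lemma fig_move_y (L : R) (g : R -> R -> R -> R) s lo hi X Y Y' : L < 1 ->
  continuous (fun p : E3 => g p.1.1 p.2 p.1.2) ->
  (forall x z y y', `|g x z y - g x z y'| <= L * `|y - y'|) ->
  (forall x z, exists C, forall y, `|g x z y| <= C) ->
  (forall i z, (1 <= i <= s)%N -> lo <= z <= hi ->
     Y' i z = Y i z + g (X i z) z (Y i z)) ->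
  ambient_isotopic (fig s lo hi X Y) (fig s lo hi X Y').
Proof.
move=> L1 cg lip bnd HY.
suff -> : fig s lo hi X Y' =
  (fun p => (p.1.1, p.1.2 + g p.1.1 p.2 p.1.2, p.2)) @` fig s lo hi X Y.
  exact: (isotopic_move_y _ L1).
apply/seteqP; split=> [_ [i ii [z zz ->]]|_ [_ [i ii [z zz ->] <-]]].
  exists (X i z, Y i z, z); first by exists i => //; exists z.
  by rewrite /= HY.
by exists i => //; exists z => //=; rewrite HY.
Qed.

Lemma fig_shear_y (g : R -> R -> R) s lo hi X Y Y' :
  continuous (fun p : R * R => g p.1 p.2) ->
  (forall i z, (1 <= i <= s)%N -> lo <= z <= hi -> Y' i z = Y i z + g (X i z) z) ->
  ambient_isotopic (fig s lo hi X Y) (fig s lo hi X Y').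
Proof.
move=> cg HY; apply: (fig_move_y (L := 0) (g := fun x z _ => g x z)) => //.
- by apply: (cont_compT (g := fun p : R * R => g p.1 p.2) (f := fun p : E3 => (p.1.1, p.2)));
    cont.
- by move=> *; rewrite subrr normr0 mul0r.
- by move=> x z; exists `|g x z|.
Qed.

Lemma fig_swap s lo hi X Y X' Y' :
  ambient_isotopic (fig s lo hi Y X) (fig s lo hi Y' X') ->
  ambient_isotopic (fig s lo hi X Y) (fig s lo hi X' Y').
Proof.
by move=> H; apply: (isotopic_invol cont_swap_xy swap_xyK); rewrite !swap_fig.
Qed.

Lemma fig_shear_x (f : R -> R -> R) s lo hi X X' Y :
  continuous (fun p : R * R => f p.1 p.2) ->
  (forall i z, (1 <= i <= s)%N -> lo <= z <= hi -> X' i z = X i z + f (Y i z) z) ->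
  ambient_isotopic (fig s lo hi X Y) (fig s lo hi X' Y).
Proof. by move=> cf HX; apply: fig_swap; exact: (fig_shear_y cf). Qed.

(** Heights are changed by an increasing function [z + g z], the same for all strands. *)
Lemma fig_stretch (C : R) (g : R -> R) s lo hi X Y X' Y' :
  continuous g -> {homo g : x y / x <= y} -> (forall z, `|g z| <= C) ->
  (forall i z, (1 <= i <= s)%N -> lo <= z <= hi -> X' i (z + g z) = X i z) ->
  (forall i z, (1 <= i <= s)%N -> lo <= z <= hi -> Y' i (z + g z) = Y i z) ->
  ambient_isotopic (fig s lo hi X Y) (fig s (lo + g lo) (hi + g hi) X' Y').
Proof.
move=> cg mg bg HX HY.
have H (x y : R) : x < y -> x + g x < y + g y.
  by move=> xy; apply: ltr_leD => //; apply/mg/ltW.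
have mono : {mono (fun z => z + g z) : x y / x < y}.
  move=> x y; apply/idP/idP; last exact: H.
  rewrite ltNge => hn; rewrite ltNge; apply: contra hn.
  by rewrite le_eqVlt => /orP[/eqP->//|/H/ltW].
have cg' : continuous (fun p : R * R => p.2 + g p.2).
  by apply: cont_add; [cont|apply: (cont_compT cg); cont].
have bd : forall q : R, exists C, forall x, `|x + g x - x| <= C.
  by move=> q; exists C => x; rewrite addrAC subrr add0r.
have [psi [_ _ psiK]] := fiberwise_homeo cg' (fun=> mono) bd.
suff -> : fig s (lo + g lo) (hi + g hi) X' Y' =
  (fun p => (p.1, p.2 + g p.2)) @` fig s lo hi X Y.
  apply: (@isotopic_fiber_z R (fun _ z => z + g z)) => //.
  - by apply: cont_add; [cont|apply: (cont_compT cg); cont].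
  - by move=> q; exists C => x; rewrite addrAC subrr add0r.
have lemono : {mono (fun z => z + g z) : x y / x <= y}.
  by move=> x y; rewrite !leNgt mono.
apply/seteqP; split=> [_ [i ii [z zz ->]]|_ [_ [i ii [z zz ->] <-]]].
  have pz := psiK 0 z.
  have zz' : lo <= psi 0 z <= hi by rewrite -(lemono lo) -(lemono _ hi) pz.
  exists (X i (psi 0 z), Y i (psi 0 z), psi 0 z); first by exists i => //; exists (psi 0 z).
  by rewrite /= -HX // -HY // pz.
exists i => //; exists (z + g z); first by rewrite !lemono.
by rewrite /= HX // HY.
Qed.

Definition hat (t : R) : R := Num.max 0 (1 - `|t|).

Lemma cont_hat : continuous hat. Proof. rewrite /hat; cont. Qed.
#[local] Hint Resolve cont_hat : cont.

Lemma hat0 : hat 0 = 1. Proof. rewrite /hat; mml. Qed.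

Lemma hat_out t : 1 <= `|t| -> hat t = 0.
Proof. rewrite /hat; mml. Qed.

Lemma hat_bounds t : 0 <= hat t <= 1.
Proof. rewrite /hat; apply/andP; split; mml. Qed.

Lemma hat_lip t u : `|hat t - hat u| <= `|t - u|.
Proof. rewrite /hat; mml. Qed.

(** At distance at least 1/2 (in the 1-norm of the level planes) from all others, a strand
    can be dragged by a tent function centred on it without moving the others. Moving points
    along tent functions is only a homeomorphism when the motion is small, so it is cut
    into [N] steps; where the strands are closer to each other, none of them may move. *)
Lemma fig_push_y (M : R) s lo hi (X Y c : nat -> R -> R) :
  (forall i, continuous (X i)) -> (forall i, continuous (Y i)) ->
  (forall i, continuous (c i)) -> 0 <= M ->
  (forall i z, (1 <= i <= s)%N -> `|c i z| <= M) ->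
  (forall z, lo <= z <= hi ->
    (forall i, (1 <= i <= s)%N -> c i z = 0) \/
    (forall t i j, 0 <= t <= 1 -> (1 <= i <= s)%N -> (1 <= j <= s)%N -> i != j ->
      2^-1 <= `|X i z - X j z| + `|(Y i z + t * c i z) - (Y j z + t * c j z)|)) ->
  ambient_isotopic (fig s lo hi X Y) (fig s lo hi X (fun i z => Y i z + c i z)).
Proof.
move=> cX cY cc M0 bc sep.
have [N N0 HN] : exists2 N : nat, 0 < N%:R :> R & 4 * s%:R * M <= N%:R.
  exists (Num.truncn (4 * s%:R * M)).+1; first by rewrite ltr0n.
  by apply/ltW; apply: truncnS_gt.
pose Yk k := fun i z => Y i z + (k%:R / N%:R) * c i z.
suff H k : (k <= N)%N -> ambient_isotopic (fig s lo hi X Y) (fig s lo hi X (Yk k)).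
  have -> : (fun i z => Y i z + c i z) = Yk N.
    by apply/funext => i; apply/funext => z; rewrite /Yk divff ?mul1r// gt_eqF.
  exact: H.
elim: k => [_|k IH kN].
  have -> : Yk 0%N = Y by apply/funext => i; apply/funext => z; rewrite /Yk mul0r mul0r addr0.
  exact: isotopic_refl.
apply: isotopic_trans (IH (ltnW kN)) _.
pose r := index_iota 1 s.+1.
have rE i : (i \in r) = (1 <= i <= s)%N by rewrite mem_index_iota ltnS.
pose w i x z y := hat (2 * (`|x - X i z| + `|y - Yk k i z|)).
pose g x z y := \sum_(i <- r) (c i z / N%:R) * w i x z y.
have cYk i : continuous (Yk k i) by rewrite /Yk; cont.
apply: (fig_move_y (L := 2^-1) (g := g)).
- lra.
- by rewrite /g /w; cont.
- move=> x z y y'; rewrite /g -sumrB.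
  apply: le_trans (ler_norm_sum _ _ _) _.
  apply: (@le_trans _ _ (\sum_(i <- r) (M / N%:R) * (2 * `|y - y'|))).
    rewrite big_seq [leRHS]big_seq; apply: ler_sum => i; rewrite rE => ii.
    rewrite -mulrBr normrM; apply: ler_pM => //.
      by rewrite normrM normfV (ger0_norm (ltW N0)) ler_wpM2r ?bc// invr_ge0 ltW.
    apply: le_trans (hat_lip _ _) _.
    rewrite -mulrBr normrM ger0_norm // ler_pM2l //.
    set a := `|x - _|; rewrite (_ : a + _ - (a + _) =
      `|y - Yk k i z| - `|y' - Yk k i z|); last by ring.
    by apply: le_trans (ler_dist_dist _ _) _; rewrite opprB addrA subrK.
  rewrite big_const_seq count_predT size_iota subn1 /= iter_addr_0 -[leLHS]mulr_natr.
  have -> : M / N%:R * (2 * `|y - y'|) * s%:R = (4 * s%:R * M) / N%:R * (2^-1 * `|y - y'|).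
    by field; rewrite gt_eqF.
  apply: ler_piMl; first by rewrite mulr_ge0.
  by rewrite ler_pdivrMr // mul1r.
- move=> x z; exists (\sum_(i <- r) `|c i z / N%:R|) => y.
  apply: le_trans (ler_norm_sum _ _ _) _; apply: ler_sum => i _.
  rewrite normrM ler_piMr //.
  by rewrite /w; case/andP: (hat_bounds (2 * (`|x - X i z| + `|y - Yk k i z|))) => h0 h1;
    rewrite ger0_norm.
- move=> i z ii zz; rewrite /g.
  have [c0|sp] := sep z zz.
    rewrite big_seq big1 => [|j]; first by rewrite /Yk !c0 // !mulr0 !addr0.
    by rewrite rE => jj; rewrite c0 // !mul0r.
  rewrite (bigD1_seq i) /= ?rE ?iota_uniq //.
  rewrite /w !subrr normr0 addr0 mulr0 hat0 mulr1.
  rewrite big_seq_cond big1 ?addr0.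
    by rewrite /Yk -addrA; congr (_ + _); rewrite -natr1; field; rewrite gt_eqF.
  move=> j; rewrite rE => /andP[jj ji].
  rewrite hat_out ?mulr0 //.
  have kN1 : 0 <= (k%:R / N%:R : R) <= 1.
    apply/andP; split; first by rewrite divr_ge0 ?ler0n.
    by rewrite ler_pdivrMr // mul1r ler_nat; exact: ltnW.
  have := sp _ _ _ kN1 ii jj; rewrite eq_sym ji => /(_ isT).
  rewrite -/(Yk k i z) -/(Yk k j z) => h.
  rewrite ger0_norm ?mulr_ge0 ?addr_ge0 //.
  lra.
Qed.

Lemma fig_push_x (M : R) s lo hi (X Y c : nat -> R -> R) :
  (forall i, continuous (X i)) -> (forall i, continuous (Y i)) ->
  (forall i, continuous (c i)) -> 0 <= M ->
  (forall i z, (1 <= i <= s)%N -> `|c i z| <= M) ->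
  (forall z, lo <= z <= hi ->
    (forall i, (1 <= i <= s)%N -> c i z = 0) \/
    (forall t i j, 0 <= t <= 1 -> (1 <= i <= s)%N -> (1 <= j <= s)%N -> i != j ->
      2^-1 <= `|(X i z + t * c i z) - (X j z + t * c j z)| + `|Y i z - Y j z|)) ->
  ambient_isotopic (fig s lo hi X Y) (fig s lo hi (fun i z => X i z + c i z) Y).
Proof.
move=> cX cY cc M0 bc sep; apply: fig_swap; apply: (fig_push_y (M := M)) => // z zz.
have [?|H] := sep z zz; [by left|right] => *.
by rewrite addrC; exact: H.
Qed.

(** Linear interpolation in [y] of the values [e i] prescribed at the distinct
    natural numbers [D i]. *)
Definition interp (s : nat) (D : nat -> nat) (e : nat -> R) (y : R) : R :=
  \sum_(i <- index_iota 1 s.+1) e i * hat (y - (D i)%:R).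

Lemma natr_dist_ge1 (m n : nat) : m != n -> 1 <= `|m%:R - n%:R| :> R.
Proof.
move=> mn; have : (m < n)%N || (n < m)%N by rewrite -neq_ltn.
case/orP; rewrite -(ler_nat R) -natr1 => h; mml.
Qed.

Lemma interp_node s D e j : (forall i k, (1 <= i <= s)%N -> (1 <= k <= s)%N ->
    D i = D k -> i = k) ->
  (1 <= j <= s)%N -> interp s D e (D j)%:R = e j.
Proof.
move=> inj jj; rewrite /interp (bigD1_seq j) ?mem_index_iota ?ltnS ?iota_uniq //=.
rewrite subrr hat0 mulr1 big_seq_cond big1 ?addr0 // => i.
rewrite mem_index_iota ltnS => /andP[ii ij].
rewrite hat_out ?mulr0 //; apply: natr_dist_ge1.
by apply/eqP => /(inj _ _ jj ii) E; rewrite E eqxx in ij.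
Qed.

Lemma interp_segment s D e j k (t : R) :
  (forall i k, (1 <= i <= s)%N -> (1 <= k <= s)%N -> D i = D k -> i = k) ->
  (1 <= j <= s)%N -> (1 <= k <= s)%N -> (D k = (D j).+1 \/ D j = (D k).+1) ->
  0 <= t <= 1 ->
  interp s D e ((1 - t) * (D j)%:R + t * (D k)%:R) = (1 - t) * e j + t * e k.
Proof.
move=> inj jj kk Djk t01.
have jk : k != j by apply/eqP => E; move: Djk; rewrite E; lia.
rewrite /interp (bigD1_seq j) ?mem_index_iota ?ltnS ?iota_uniq //=.
rewrite (big_rem k) ?mem_index_iota ?ltnS //= jk big_seq_cond big1 ?addr0 => [|i].
  case/andP: t01 => t0 t1.
  have E1 : hat ((1 - t) * (D j)%:R + t * (D k)%:R - (D j)%:R) = 1 - t.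
    by case: Djk => ->; rewrite -natr1 /hat; mml.
  have E2 : hat ((1 - t) * (D j)%:R + t * (D k)%:R - (D k)%:R) = t.
    by case: Djk => ->; rewrite -natr1 /hat; mml.
  by rewrite E1 E2; ring.
rewrite rem_filter ?iota_uniq // mem_filter /= mem_index_iota ltnS.
move=> /andP[/andP[ik ii] ij]; rewrite hat_out ?mulr0 //.
have Di : D i != D j by apply: contra_neq ij => /inj ->.
have Dk : D i != D k by apply: contra_neq ik => /inj ->.
have : (D i < D j /\ D i < D k)%N \/ (D j < D i /\ D k < D i)%N by lia.
case/andP: t01 => t0 t1.
rewrite -!(ler_nat R) -!natr1 => -[[h1 h2]|[h1 h2]].
  have p1 : 0 <= (1 - t) * ((D j)%:R - (D i)%:R - 1) by apply: mulr_ge0; lra.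
  have p2 : 0 <= t * ((D k)%:R - (D i)%:R - 1) by apply: mulr_ge0; lra.
  by rewrite ler_normr; apply/orP; left; lra.
have p1 : 0 <= (1 - t) * ((D i)%:R - (D j)%:R - 1) by apply: mulr_ge0; lra.
have p2 : 0 <= t * ((D i)%:R - (D k)%:R - 1) by apply: mulr_ge0; lra.
by rewrite ler_normr; apply/orP; right; lra.
Qed.

Lemma cont_interp (T : topologicalType) s D (e : nat -> T -> R) (y : T -> R) :
  (forall i, continuous (e i)) -> continuous y ->
  continuous (fun x => interp s D (e^~ x) (y x)).
Proof. by move=> ce cy; rewrite /interp; cont. Qed.

End Figures.

(** * Strands *)

Section Strands.
Variable R : realType.
Local Notation E3 := (space3 R).

(** A profile says how a single crossing takes place in unit time: [p] is the
    horizontal progress of the strands, [t] their distance to the plane of the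
    diagram. *)
Record profile (p t : R -> R) : Prop := Profile {
  cont_p : continuous p;
  cont_t : continuous t;
  profile_lo : forall z, z <= 0 -> p z = 0;
  profile_hi : forall z, 1 <= z -> p z = 1;
  profile_tlo : forall z, z <= 0 -> t z = 0;
  profile_thi : forall z, 1 <= z -> t z = 0;
  profile_p01 : forall z, 0 <= p z <= 1;
  profile_t01 : forall z, 0 <= t z <= 2^-1;
  profile_sep : forall z, 1 <= `|1 - 2 * p z| + 2 * t z }.

Fixpoint xdisp (p : R -> R) (js : seq nat) (i : nat) (z : R) : R :=
  if js is j :: js' then
    ((transp j i)%:R - i%:R) * p z + xdisp p js' (transp j i) (z - 1)
  else 0.

Definition side (l : letter) (i : nat) : R :=
  if i == l.1 then sgn_of R l.2 else if i == l.1.+1 then - sgn_of R l.2 else 0.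

Fixpoint ydisp (t : R -> R) (w : seq letter) (i : nat) (z : R) : R :=
  if w is l :: w' then side l i * t z + ydisp t w' (transp l.1 i) (z - 1) else 0.

Lemma cont_xdisp p js i : continuous p -> continuous (xdisp p js i).
Proof.
move=> cp; elim: js i => [|j js IH] i /=; first by cont.
have := IH (transp j i) => c1; cont.
Qed.

Lemma cont_ydisp t w i : continuous t -> continuous (ydisp t w i).
Proof.
move=> ct; elim: w i => [|l w IH] i /=; first by cont.
have := IH (transp l.1 i) => c1; cont.
Qed.

Section Profile.
Variables (p t : R -> R).
Hypothesis pt : profile p t.

Lemma xdisp_lo js i z : z <= 0 -> xdisp p js i z = 0.
Proof.
elim: js i z => [|j js IH] i z z0 //=.
by rewrite (profile_lo pt) // IH ?mulr0 ?addr0 //; lra.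
Qed.

Lemma xdisp_hi js i z : (size js)%:R <= z -> xdisp p js i z = (pos js i)%:R - i%:R.
Proof.
elim: js i z => [|j js IH] i z /=; first by rewrite subrr.
rewrite -natr1 => hz; have := ler0n R (size js) => ?.
rewrite (profile_hi pt) ?IH //; try lra.
Qed.

Lemma xdisp_cat js ks i z :
  xdisp p (js ++ ks) i z = xdisp p js i z + xdisp p ks (pos js i) (z - (size js)%:R).
Proof.
elim: js i z => [|j js IH] i z /=; first by rewrite add0r subr0.
by rewrite IH addrA -natr1 (_ : z - (_ + 1) = z - 1 - (size js)%:R) //; ring.
Qed.

Lemma ydisp_lo w i z : z <= 0 -> ydisp t w i z = 0.
Proof.
elim: w i z => [|l w IH] i z z0 //=.
by rewrite (profile_tlo pt) // IH ?mulr0 ?addr0 //; lra.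
Qed.

Lemma ydisp_hi w i z : (size w)%:R <= z -> ydisp t w i z = 0.
Proof.
elim: w i z => [|l w IH] i z //=.
rewrite -natr1 => hz; have := ler0n R (size w) => ?.
rewrite (profile_thi pt) ?IH //; try lra.
Qed.

Lemma ydisp_cat v w i z :
  ydisp t (v ++ w) i z = ydisp t v i z + ydisp t w (pos (idx v) i) (z - (size v)%:R).
Proof.
elim: v i z => [|l v IH] i z /=; first by rewrite add0r subr0.
by rewrite IH addrA -natr1 (_ : z - (_ + 1) = z - 1 - (size v)%:R) //; ring.
Qed.

Lemma transp_dist j i : `|(transp j i)%:R - i%:R| <= 1 :> R.
Proof.
rewrite /transp; case: eqP => [->|_]; first by rewrite -natr1; mml.
case: eqP => [->|_]; first by rewrite -natr1; mml.
by rewrite subrr normr0.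
Qed.

Lemma xdisp_bound js i z : `|xdisp p js i z| <= (size js)%:R.
Proof.
elim: js i z => [|j js IH] i z /=; first by rewrite normr0.
rewrite -natr1 addrC; apply: le_trans (ler_normD _ _) _; apply: lerD => //.
have /andP[p0 p1] := profile_p01 pt z.
rewrite normrM (ger0_norm p0); have := transp_dist j i; have := normr_ge0 ((transp j i)%:R - i%:R : R).
nra.
Qed.

Lemma side_bound l i : `|side l i| <= 1.
Proof. rewrite /side /sgn_of; case: eqP => _; [|case: eqP => _]; case: l.2; mml. Qed.

Lemma ydisp_bound w i z : `|ydisp t w i z| <= (size w)%:R.
Proof.
elim: w i z => [|l w IH] i z /=; first by rewrite normr0.
rewrite -natr1 addrC; apply: le_trans (ler_normD _ _) _; apply: lerD => //.
have /andP[p0 p1] := profile_t01 pt z.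
rewrite normrM (ger0_norm p0); have := side_bound l i; have := normr_ge0 (side l i).
nra.
Qed.

(** A crossing takes place between two consecutive positions, so any other strand stays at
    distance at least 1 from both strands that cross. *)
Lemma letter_pair (l : letter) (i j : nat) (a : R) : 0 <= a <= 1 -> i != j ->
  1 <= `|(i%:R + ((transp l.1 i)%:R - i%:R) * a) - (j%:R + ((transp l.1 j)%:R - j%:R) * a)| \/
  (i == l.1) && (j == l.1.+1) \/ (i == l.1.+1) && (j == l.1).
Proof.
case: l => k e /= /andP[a0 a1] ij; rewrite /transp.
have far (m n : nat) : (m < n)%N -> m%:R + 1 <= n%:R :> R by rewrite natr1 ler_nat.
have [ik|ik] := eqVneq i k.
  have [jk|jk1] := eqVneq j k.+1; first by right; left.
  have jk : j == k = false by apply/negbTE; rewrite -ik eq_sym.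
  rewrite jk; left; rewrite -natr1.
  have : (j < k \/ k.+1 < j)%N by lia.
  by case=> /far; rewrite -?natr1 -ik; mml.
have [ik1|ik1] := eqVneq i k.+1.
  have [jk|jk] := eqVneq j k; first by right; right.
  have jk1 : j == k.+1 = false by apply/negbTE; rewrite -ik1 eq_sym.
  rewrite jk1; left.
  have : (j < k \/ k.+1 < j)%N by lia.
  by rewrite ik1; case=> /far; rewrite -?natr1; mml.
left; have [jk|jk] := eqVneq j k.
  have : (i < k \/ k.+1 < i)%N by lia.
  by rewrite jk; case=> /far; rewrite -?natr1; mml.
have [jk1|jk1] := eqVneq j k.+1.
  have : (i < k \/ k.+1 < i)%N by lia.
  by rewrite jk1; case=> /far; rewrite -?natr1; mml.
by rewrite !subrr !mul0r !addr0; exact: natr_dist_ge1.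
Qed.

Lemma side_lo (l : letter) : side l l.1 = sgn_of R l.2.
Proof. by rewrite /side eqxx. Qed.

Lemma side_hi (l : letter) : side l l.1.+1 = - sgn_of R l.2.
Proof. by rewrite /side eqxx; case: eqP => //; lia. Qed.

Lemma transp_lo j : transp j j = j.+1.
Proof. by rewrite /transp eqxx. Qed.

Lemma transp_hi j : transp j j.+1 = j.
Proof. by rewrite /transp eqxx; case: eqP => //; lia. Qed.

Lemma sgn_norm e (x : R) : 0 <= x -> `|2 * (sgn_of R e * x)| = 2 * x.
Proof. by rewrite /sgn_of; case: e; mml. Qed.

(** This uniform bound makes it possible to push all the strands of a word at the same time:
    two strands that cross get apart in the [y] direction at least as fast as they come
    closer horizontally, by [profile_sep]. *)
Lemma strand_sep w i j z : i != j ->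
  1 <= `|(i%:R + xdisp p (idx w) i z) - (j%:R + xdisp p (idx w) j z)| +
       `|ydisp t w i z - ydisp t w j z|.
Proof.
elim: w i j z => [|l w IH] i j z ij.
  by rewrite /= !addr0; apply: le_trans (natr_dist_ge1 R ij) _; rewrite lerDl.
have [z1|z1] := leP z 1.
  rewrite [xdisp _ _ i z]/= [xdisp _ _ j z]/= [ydisp _ _ i z]/= [ydisp _ _ j z]/=.
  rewrite !xdisp_lo ?ydisp_lo; try lra.
  rewrite !addr0.
  have [h|[/andP[/eqP -> /eqP ->]|/andP[/eqP -> /eqP ->]]] :=
    letter_pair l (profile_p01 pt z) ij.
  - by apply: le_trans h _; rewrite lerDl.
  - rewrite side_lo side_hi transp_lo transp_hi.
    have -> : sgn_of R l.2 * t z - - sgn_of R l.2 * t z = 2 * (sgn_of R l.2 * t z) by ring.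
    have /andP[t0 _] := profile_t01 pt z.
    rewrite sgn_norm //; apply: le_trans (profile_sep pt z) _.
    by rewrite -natr1 lerD2r -normrN; rewrite le_eqVlt; apply/orP; left; apply/eqP; congr (`|_|); ring.
  - rewrite side_lo side_hi transp_lo transp_hi.
    have -> : - sgn_of R l.2 * t z - sgn_of R l.2 * t z = - (2 * (sgn_of R l.2 * t z)) by ring.
    have /andP[t0 _] := profile_t01 pt z.
    rewrite normrN sgn_norm //; apply: le_trans (profile_sep pt z) _.
    by rewrite -natr1 lerD2r; rewrite le_eqVlt; apply/orP; left; apply/eqP; congr (`|_|); ring.
have := IH (transp l.1 i) (transp l.1 j) (z - 1); rewrite (inj_eq (@transp_inj _)) => /(_ ij).
have z1' := ltW z1; rewrite /= (profile_hi pt z1') (profile_thi pt z1').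
rewrite !mulr1 !mulr0 !add0r => h; apply: le_trans h _.
by rewrite lerD2r; rewrite le_eqVlt; apply/orP; left; apply/eqP; congr (`|_|); ring.
Qed.

End Profile.
End Strands.

Arguments clamp {R}.
Arguments tent {R}.

Section Profiles.
Variable R : realType.
Let cont_clampR := @cont_clamp R.
#[local] Hint Resolve cont_clampR : cont.

Lemma cont_tent : continuous (tent : R -> R).
Proof. rewrite /tent; cont. Qed.
#[local] Hint Resolve cont_tent : cont.

(** Crossings are delayed so that each letter begins and ends with a collar of height 1/4
    in which the strands are vertical. *)
Definition late (z : R) : R := clamp (2 * z - 2^-1).

Definition clamp_tent (z : R) : R := tent (clamp z).

Definition late_tent (z : R) : R := tent (late z).

Lemma clamp01 (z : R) : 0 <= clamp z <= 1.
Proof. by have := clamp_itv z; rewrite in_itv. Qed.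

Lemma tent_bounds (u : R) : 0 <= u <= 1 -> 0 <= tent u <= 2^-1.
Proof. by case/andP=> ? ?; rewrite /tent; apply/andP; split; mml. Qed.

Lemma tent_sep (u : R) : 1 <= `|1 - 2 * u| + 2 * tent u.
Proof. rewrite /tent; mml. Qed.

Lemma tent0 : tent (0 : R) = 0. Proof. rewrite /tent; mml. Qed.
Lemma tent1 : tent (1 : R) = 0. Proof. rewrite /tent; mml. Qed.

Lemma clamp_lo (z : R) : z <= 0 -> clamp z = 0.
Proof. rewrite /clamp; mml. Qed.

Lemma clamp_hi (z : R) : 1 <= z -> clamp z = 1.
Proof. rewrite /clamp; mml. Qed.

Lemma clamp_homo : {homo (clamp : R -> R) : x y / x <= y}.
Proof. by move=> x y xy; rewrite /clamp; mml. Qed.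

Lemma late_lo z : z <= 4^-1 -> late z = 0.
Proof. by move=> ?; apply: clamp_lo; lra. Qed.

Lemma late_hi z : 3 / 4 <= z -> late z = 1.
Proof. by move=> ?; apply: clamp_hi; lra. Qed.

Lemma profile_clamp : profile (clamp : R -> R) clamp_tent.
Proof.
split.
- exact: cont_clamp.
- by rewrite /clamp_tent; cont.
- exact: clamp_lo.
- exact: clamp_hi.
- by move=> z z0; rewrite /clamp_tent clamp_lo ?tent0.
- by move=> z z0; rewrite /clamp_tent clamp_hi ?tent1.
- exact: clamp01.
- by move=> z; apply: tent_bounds; exact: clamp01.
- by move=> z; exact: tent_sep.
Qed.

Lemma profile_late : profile late late_tent.
Proof.
split.
- by rewrite /late; cont.
- by rewrite /late_tent /late; cont.
- by move=> z z0; apply: late_lo; lra.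
- by move=> z z0; apply: late_hi; lra.
- by move=> z z0; rewrite /late_tent late_lo ?tent0 //; lra.
- by move=> z z0; rewrite /late_tent late_hi ?tent1 //; lra.
- by move=> z; exact: clamp01.
- by move=> z; apply: tent_bounds; exact: clamp01.
- by move=> z; exact: tent_sep.
Qed.

Lemma late_xdisp_lo js i z : z <= 4^-1 -> xdisp late js i z = 0.
Proof.
case: js => [|j js] //= hz.
by rewrite late_lo // (xdisp_lo profile_late) ?mulr0 ?addr0 //; lra.
Qed.

Lemma late_xdisp_hi js i z : (size js)%:R - 4^-1 <= z ->
  xdisp late js i z = (pos js i)%:R - i%:R.
Proof.
elim: js i z => [|j js IH] i z /=; first by rewrite subrr.
rewrite -natr1 => hz; have := ler0n R (size js) => ?.
by rewrite late_hi ?IH //; lra.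
Qed.

(** Two strands that are less than 1 apart horizontally are just crossing. This happens
    outside the collars, and by layeredness on the sides that their depths prescribe;
    so moving them to their depths does not decrease their distance. *)
Lemma layered_pair d w i j z : layered d w -> i != j ->
  let dx := (i%:R + xdisp late (idx w) i z) - (j%:R + xdisp late (idx w) j z) in
  let dy := ydisp late_tent w i z - ydisp late_tent w j z in
  1 <= `|dx| \/
  [/\ 4^-1 <= z <= (size w)%:R - 4^-1, 1 <= `|dx| + `|dy|, `|dy| <= 1
    & 0 <= dy * ((d i)%:R - (d j)%:R)].
Proof.
move=> + ij dx dy; rewrite {}/dx {}/dy.
elim: w d i j z ij => [|l w IH] d i j z ij.
  by move=> _; left; rewrite /= !addr0; exact: natr_dist_ge1.
move=> /= /andP[/eqP el lv].
have sz : (size w)%:R >= 0 :> R by exact: ler0n.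
have [z1|z1] := leP z 1; last first.
  have z1' := ltW z1.
  have := IH (d \o transp l.1) (transp l.1 i) (transp l.1 j) (z - 1).
  rewrite (inj_eq (@transp_inj _)) => /(_ ij lv) /=.
  rewrite !transpK !(profile_hi profile_late z1') (_ : late_tent z = 0); last first.
    exact: (profile_thi profile_late z1').
  rewrite !mulr1 !mulr0 !add0r -natr1.
  have E k : k%:R + ((transp l.1 k)%:R - k%:R + xdisp late (idx w) (transp l.1 k) (z - 1)) =
             (transp l.1 k)%:R + xdisp late (idx w) (transp l.1 k) (z - 1) by ring.
  rewrite !E.
  by case=> [h|[/andP[h1 h2] h3 h4 h5]]; [left|right; split=> //; apply/andP; split; lra].
rewrite !(xdisp_lo profile_late) ?(ydisp_lo profile_late); try lra.
rewrite !addr0 -(natr1 (size w)).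
have P := profile_p01 profile_late z.
have [h|H] := letter_pair l P ij; first by left.
have [z4|z4] := leP z 4^-1.
  by left; rewrite late_lo // !mulr0 !addr0; exact: natr_dist_ge1.
have [z3|z3] := leP (3 / 4) z.
  left; rewrite late_hi // !mulr1 !(addrC i%:R) !(addrC j%:R) !subrK.
  by apply: natr_dist_ge1; rewrite (inj_eq (@transp_inj _)).
right.
have := profile_sep profile_late z; have := profile_t01 profile_late z => /=.
set t := late_tent z => /andP[t0 t1] sep.
have D1 : l.2 -> 0 <= (d l.1)%:R - (d l.1.+1)%:R :> R.
  by rewrite el subr_ge0 ler_nat => /ltnW.
have D2 : ~~ l.2 -> 0 <= (d l.1.+1)%:R - (d l.1)%:R :> R.
  by rewrite el -leqNgt subr_ge0 ler_nat.
pose e : R := sgn_of R l.2 * t.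
have ne : `|2 * e| = 2 * t by apply: sgn_norm.
have De : 0 <= e * ((d l.1)%:R - (d l.1.+1)%:R).
  rewrite /e /sgn_of; case: l.2 D1 D2 => [/(_ isT) D _|_ /(_ isT) D].
    by rewrite mulr_ge0 // mul1r.
  by rewrite mulN1r mulr_le0 //; lra.
have zin : 4^-1 <= z <= (size w)%:R + 1 - 4^-1 by apply/andP; split; lra.
case: H => /andP[/eqP -> /eqP ->]; rewrite side_lo side_hi transp_lo transp_hi.
  rewrite (_ : _ - _ * t = 2 * e); last by rewrite /e; ring.
  rewrite ne -(natr1 l.1) [X in `|X| + _](_ : _ = - (1 - 2 * late z)); last by ring.
  by rewrite normrN; split=> //; lra.
rewrite (_ : _ - _ * t = - (2 * e)); last by rewrite /e; ring.
rewrite normrN ne -(natr1 l.1) [X in `|X| + _](_ : _ = 1 - 2 * late z); last by ring.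
by split=> //; lra.
Qed.

(** The direction in which the leg of a cap in position [i] leans towards its mate. *)
Definition dir (i : nat) : R := if odd i then 1 else -1.

(** The two ends of a strand are halves of caps, below height 0 and above height [h]. *)
Definition strand_x (p : R -> R) (js : seq nat) (h : R) (i : nat) (z : R) : R :=
  i%:R + dir i * Num.max 0 (- z) + xdisp p js i z + dir (pos js i) * Num.max 0 (z - h).

(** Late crossings, and an empty level between the word and the top caps: wherever a word
    is cut in two, there are vertical strands on both sides of the cut. *)
Definition roomy_plat (b : nat) (w : seq letter) : set (space3 R) :=
  fig (2 * b) (- 2^-1) ((size w)%:R + 3 / 2)
    (strand_x late (idx w) ((size w)%:R + 1)) (ydisp late_tent w).

Lemma cont_strand_x p js h i : continuous p -> continuous (strand_x p js h i).
Proof. by move=> cp; have := cont_xdisp (js := js) (i := i) cp => c1; rewrite /strand_x; cont. Qed.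

Lemma mate_dir i : (0 < i)%N -> (mate i)%:R = i%:R + dir i :> R.
Proof.
rewrite /mate /dir; case: ifP => _ i0; first by rewrite natr1.
by rewrite -[in RHS](prednK i0) -natr1 addrK.
Qed.

End Profiles.
Arguments late {R}.
Arguments late_tent {R}.
Arguments clamp_tent {R}.

Lemma interp_zero (R : realType) s D (e : nat -> R) y :
  (forall i, (1 <= i <= s)%N -> e i = 0) -> interp s D e y = 0.
Proof.
move=> e0; rewrite /interp big_seq big1 // => i.
by rewrite mem_index_iota ltnS => /e0 ->; rewrite mul0r.
Qed.

Lemma late_ydisp_lo (R : realType) w i (z : R) : z <= 4^-1 -> ydisp late_tent w i z = 0.
Proof.
case: w => [|l w] //= hz.
by rewrite /late_tent late_lo // tent0 (ydisp_lo (profile_late R)) ?mulr0 ?addr0 //; lra.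
Qed.

Section Moves.
Variable R : realType.
Let cont_clampR := @cont_clamp R.
#[local] Hint Resolve cont_clampR : cont.

Let cont_late_xdisp js i : continuous (xdisp (@late R) js i) :=
  cont_xdisp (cont_p (profile_late R)).
Let cont_late_ydisp w i : continuous (ydisp (@late_tent R) w i) :=
  cont_ydisp (cont_t (profile_late R)).
Let cont_late_strand_x js h i : continuous (strand_x (@late R) js h i) :=
  cont_strand_x (cont_p (profile_late R)).
#[local] Hint Resolve cont_late_xdisp cont_late_ydisp cont_late_strand_x : cont.

(** Where the strands of a word of length [m] are at their depths: up in the lower collar,
    down in the upper one. *)
Definition bump (m z : R) : R := clamp (Num.min (4 * z) (4 * (m - z))).

Lemma bump01 m z : 0 <= bump m z <= 1.
Proof. exact: clamp01. Qed.

Lemma bump_lo m z : z <= 0 -> bump m z = 0.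
Proof. by move=> ?; apply: clamp_lo; mml. Qed.

Lemma bump_hi m z : m <= z -> bump m z = 0.
Proof. by move=> ?; apply: clamp_lo; mml. Qed.

Lemma bump_mid m z : 4^-1 <= z <= m - 4^-1 -> bump m z = 1.
Proof. by case/andP=> ? ?; apply: clamp_hi; mml. Qed.

Lemma cont_bump m : continuous (bump m).
Proof. by rewrite /bump; cont. Qed.
#[local] Hint Resolve cont_bump : cont.

Variables (w1 u w2 : seq letter) (d : nat -> nat) (b : nat).
Hypotheses (v1 : valid (2 * b) (idx w1)) (vu : valid (2 * b) (idx u)).
Hypotheses (dinj : injective d) (layu : layered d u) (u0 : (0 < size u)%N).

Let s := (2 * b)%N.
Let w := w1 ++ u ++ w2.
Variables (n1 m n2 h : R).
Hypotheses (n1E : n1 = (size w1)%:R) (mE : m = (size u)%:R) (n2E : n2 = (size w2)%:R).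
Hypothesis hE : h = n1 + m + n2 + 1.
Let p1 := pos (idx w1).
Let D i := d (p1 i).
Let X0 := strand_x late (idx w) h.
Let Y0 := ydisp (@late_tent R) w.

Let heights : [/\ 1 <= m, 0 <= n1, 0 <= n2 & h = n1 + m + n2 + 1].
Proof. by rewrite hE mE n1E n2E ler1n !ler0n. Qed.

Let Dinj : injective D.
Proof. by move=> i j /dinj /pos_inj. Qed.

Definition inner_disp i (z : R) := xdisp late (idx u) (p1 i) (z - n1).

Let X0E i z : X0 i z = i%:R + dir R i * Num.max 0 (- z) + (xdisp late (idx w1) i z +
   inner_disp i z + xdisp late (idx w2) (pos (idx u) (p1 i)) (z - n1 - m))
   + dir R (pos (idx w) i) * Num.max 0 (z - h).
Proof.
rewrite /X0 /strand_x /inner_disp; congr (_ + _ + _).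
by rewrite /w !idx_cat !xdisp_cat !size_idx addrA n1E mE.
Qed.

Let Y0E i z : Y0 i z = ydisp late_tent w1 i z + ydisp late_tent u (p1 i) (z - n1) +
   ydisp late_tent w2 (pos (idx u) (p1 i)) (z - n1 - m).
Proof. by rewrite /Y0 /w !ydisp_cat addrA n1E mE. Qed.

Definition lifted i z := Y0 i z +
  (bump m (z - n1) * (D i)%:R - ydisp late_tent u (p1 i) (z - n1)).

Let X0_mid i z : n1 <= z <= n1 + m -> X0 i z = (p1 i)%:R + inner_disp i z.
Proof.
case: heights => m1 n1_ge0 n2_ge0 hE' /andP[z1 z2].
rewrite X0E (xdisp_hi (profile_late R)) ?size_idx -?n1E //.
rewrite (xdisp_lo (profile_late R) _ _ (z := z - n1 - m)); last lra.
rewrite (_ : Num.max 0 (- z) = 0); last by mml.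
rewrite (_ : Num.max 0 (z - h) = 0); last by mml.
by rewrite /p1; ring.
Qed.

Let Y0_mid i z : n1 <= z <= n1 + m -> Y0 i z = ydisp late_tent u (p1 i) (z - n1).
Proof.
case: heights => m1 n1_ge0 n2_ge0 hE' /andP[z1 z2].
rewrite Y0E (ydisp_hi (profile_late R)) -?n1E //.
by rewrite (ydisp_lo (profile_late R) _ _ (z := z - n1 - m)); [ring|lra].
Qed.

(** At a crossing, the sign of the difference of the depths is that of the present
    difference in the [y] direction, so the strands do not meet on their way to the
    planes of their depths. *)
Lemma lift_layers :
  ambient_isotopic (fig s (- 2^-1) (h + 2^-1) X0 Y0) (fig s (- 2^-1) (h + 2^-1) X0 lifted).
Proof.
case: heights => m1 n1_ge0 n2_ge0 hE'.
pose mx : R := \sum_(i <- index_iota 1 s.+1) (D i)%:R.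
have mx0 i : (1 <= i <= s)%N -> (D i)%:R <= mx.
  move=> ii; rewrite /mx (bigD1_seq i) ?mem_index_iota ?ltnS ?iota_uniq //= lerDl.
  by apply: sumr_ge0 => j _; exact: ler0n.
have mx_ge0 : 0 <= mx by apply: sumr_ge0 => j _; exact: ler0n.
rewrite /lifted; apply: (fig_push_y (M := mx + m)).
- by move=> i; rewrite /X0; exact: cont_late_strand_x.
- by move=> i; rewrite /Y0; exact: cont_late_ydisp.
- by move=> i; cont.
- lra.
- move=> i z ii; apply: le_trans (ler_normB _ _) _; apply: lerD.
    have /andP[b0 b1] := bump01 m (z - n1).
    rewrite ger0_norm ?mulr_ge0 ?ler0n //; apply: le_trans (mx0 i ii).
    by rewrite ler_piMl ?ler0n.
  by rewrite mE; exact: ydisp_bound (profile_late R) _ _ _.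
move=> z _.
have [z1|z1] := leP z n1.
  left=> i _; rewrite bump_lo ?(ydisp_lo (profile_late R)) ?mul0r ?subr0 //; lra.
have [z2|z2] := leP (n1 + m) z.
  by left=> i _; rewrite bump_hi ?(ydisp_hi (profile_late R)) -?mE ?mul0r ?subr0 //; lra.
right=> t i j /andP[t0 t1] ii jj ij.
have zz : n1 <= z <= n1 + m by apply/andP; split; lra.
rewrite !X0_mid // !Y0_mid // /inner_disp.
have pij : p1 i != p1 j by apply: contra_neq ij => /pos_inj.
have /= := layered_pair (R := R) (z - n1) layu pij.
set dx := `|_ - _|.
case=> [h1|[hz h1 h2 h3]].
  have ? : 0 <= `|ydisp late_tent u (p1 i) (z - n1) +
    t * (bump m (z - n1) * (D i)%:R - ydisp late_tent u (p1 i) (z - n1)) -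
    (ydisp late_tent u (p1 j) (z - n1) +
     t * (bump m (z - n1) * (D j)%:R - ydisp late_tent u (p1 j) (z - n1)))| by [].
  by lra.
rewrite bump_mid ?mE // !mul1r -/(D i) -/(D j) in h3 *.
have := natr_dist_ge1 R (contra_neq (@Dinj i j) ij).
move: h1 h2 h3; set a := ydisp _ _ (p1 i) _; set c := ydisp _ _ (p1 j) _.
set e := (D i)%:R; set f := (D j)%:R => h1 h2 h3 h4.
apply: (@le_trans _ _ (dx + `|a - c|)); first lra.
rewrite lerD2l (_ : _ - (c + _) = (1 - t) * (a - c) + t * (e - f)); last by ring.
have [ac|ac|ac] := ltrgt0P (a - c).
- have ef : 0 <= e - f by rewrite -(pmulr_rge0 _ ac).
  rewrite (ger0_norm ef) in h4; rewrite (gtr0_norm ac) in h2.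
  have tef : 0 <= t * ((e - f) - (a - c)) by apply: mulr_ge0; lra.
  by rewrite ler_normr; apply/orP; left; lra.
- have ef : e - f <= 0 by rewrite -(nmulr_rge0 _ ac).
  rewrite (ler0_norm ef) in h4; rewrite (ltr0_norm ac) in h2.
  have tef : 0 <= t * ((a - c) - (e - f)) by apply: mulr_ge0; lra.
  by rewrite ler_normr; apply/orP; right; lra.
- by [].
Qed.

(** ** Deleting a layered word *)

Section PureWord.
Hypothesis pureu : forall i, (1 <= i <= s)%N -> pos (idx u) i = i.

Let pw i : (1 <= i <= s)%N -> pos (idx w) i = pos (idx (w1 ++ w2)) i.
Proof. by move=> ii; rewrite /w !idx_cat !pos_cat pureu // pos_range. Qed.

Let p1_range i : (1 <= i <= s)%N -> (1 <= p1 i <= s)%N.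
Proof. by move=> ii; rewrite /p1 pos_range. Qed.

Let mid_out i z : (1 <= i <= s)%N -> z - n1 <= 4^-1 \/ m - 4^-1 <= z - n1 -> inner_disp i z = 0.
Proof.
move=> ii [zz|zz]; rewrite /inner_disp; first exact: late_xdisp_lo.
by rewrite late_xdisp_hi ?pureu ?p1_range ?subrr // size_idx -mE.
Qed.

(** In the plane of its depth each strand is alone, so a shear that depends on the depth
    makes it vertical. *)
Lemma straighten_layers :
  ambient_isotopic (fig s (- 2^-1) (h + 2^-1) X0 lifted)
    (fig s (- 2^-1) (h + 2^-1) (fun i z => X0 i z - inner_disp i z) lifted).
Proof.
case: heights => m1 n1_ge0 n2_ge0 hE'.
apply: (fig_shear_x (f := fun y z => interp s D (fun i => - inner_disp i z) y)).
  apply: (cont_interp (e := fun i (p : R * R) => - inner_disp i p.2)); last by cont.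
  by move=> i; rewrite /inner_disp; cont.
move=> i z ii zz; congr (_ + _).
have [h1|h1] := leP (z - n1) 4^-1.
  rewrite interp_zero ?(mid_out ii) ?oppr0 //; try by left.
  by move=> j jj; rewrite mid_out ?oppr0 //; left.
have [h2|h2] := leP (m - 4^-1) (z - n1).
  rewrite interp_zero ?(mid_out ii) ?oppr0 //; try by right.
  by move=> j jj; rewrite mid_out ?oppr0 //; right.
rewrite /lifted bump_mid; last by apply/andP; split; lra.
rewrite Y0_mid; last by apply/andP; split; lra.
rewrite mul1r addrC subrK interp_node // => j k _ _; exact: Dinj.
Qed.

Definition flat i z := Y0 i z - ydisp late_tent u (p1 i) (z - n1).

Lemma flatten_layers :
  ambient_isotopic (fig s (- 2^-1) (h + 2^-1) (fun i z => X0 i z - inner_disp i z) lifted)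
    (fig s (- 2^-1) (h + 2^-1) (fun i z => X0 i z - inner_disp i z) flat).
Proof.
case: heights => m1 n1_ge0 n2_ge0 hE'.
apply: (fig_shear_y (g := fun x z => - bump m (z - n1) * interp s p1 (fun i => (D i)%:R) x)).
  have := @cont_interp R _ s p1 (fun i (p : R * R) => (D i)%:R) fst
    (fun i => @cont_cst R _ _) (cont_fst (f := id) (@cont_id _)).
  by move=> ci; cont.
move=> i z ii zz; rewrite /flat /lifted.
have [h1|h1] := leP (z - n1) 0; first by rewrite bump_lo //; ring.
have [h2|h2] := leP m (z - n1); first by rewrite bump_hi //; ring.
have zm : n1 <= z <= n1 + m by apply/andP; split; lra.
rewrite X0_mid // addrK interp_node //; first by ring.
by move=> j k _ _ /pos_inj.
Qed.

(** Once the strands are vertical through the word, the collar of what follows (or the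
    empty level below the top caps) can be stretched over it. *)
Lemma squeeze_word :
  ambient_isotopic (@roomy_plat R b (w1 ++ w2))
   (fig s (- 2^-1) (h + 2^-1) (fun i z => X0 i z - inner_disp i z) flat).
Proof.
case: heights => m1 n1_ge0 n2_ge0 hE'.
pose g z := m * clamp (4 * (z - n1)).
have hh : h + 2^-1 = (size (w1 ++ w2))%:R + 3 / 2 + g ((size (w1 ++ w2))%:R + 3 / 2).
  by rewrite /g size_cat natrD -n1E -n2E clamp_hi ?hE'; lra.
have ll : - 2^-1 = - 2^-1 + g (- 2^-1) :> R by rewrite /g clamp_lo ?mulr0 ?addr0 //; lra.
rewrite hh [X in fig s X]ll; apply: (fig_stretch (C := m)).
- by rewrite /g; cont.
- move=> x y xy; rewrite /g ler_pM2l; last lra.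
  by apply: clamp_homo; lra.
- move=> z; rewrite /g normrM (ger0_norm (x := m)); last lra.
  by have /andP[c0 c1] := clamp01 (4 * (z - n1)); rewrite ger0_norm // ler_piMr //; lra.
- move=> i z ii zz; rewrite X0E pw // /strand_x idx_cat xdisp_cat size_idx -n1E -/p1 pureu ?p1_range //.
  rewrite size_cat natrD -n1E -n2E.
  set k := dir R (pos _ i).
  have [h1|h1] := leP (z - n1) 0.
    have -> : g z = 0 by rewrite /g clamp_lo ?mulr0 //; lra.
    rewrite addr0 !(xdisp_lo (profile_late R) (idx w2)); try lra.
    rewrite (_ : Num.max 0 (z - h) = 0); last by mml.
    rewrite (_ : Num.max 0 (z - (n1 + n2 + 1)) = 0); last by mml.
    by ring.
  have g0 : 0 <= g z by rewrite /g mulr_ge0 //; [lra|case/andP: (clamp01 (4 * (z - n1)))].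
  rewrite !(xdisp_hi (profile_late R) (js := idx w1)) ?size_idx -?n1E; try lra.
  rewrite (_ : Num.max 0 (- z) = 0); last by mml.
  rewrite (_ : Num.max 0 (- (z + g z)) = 0); last by mml.
  have [h2|h2] := leP (z - n1) 4^-1.
    have gm : g z <= m.
      by rewrite /g ler_piMr //; [lra|case/andP: (clamp01 (4 * (z - n1)))].
    rewrite !(late_xdisp_lo (idx w2)); try lra.
    rewrite (_ : Num.max 0 (z + g z - h) = 0); last by mml.
    rewrite (_ : Num.max 0 (z - (n1 + n2 + 1)) = 0); last by mml.
    by ring.
  have -> : g z = m by rewrite /g clamp_hi ?mulr1 //; lra.
  rewrite (_ : z + m - n1 - m = z - n1); last by ring.
  rewrite (_ : z + m - h = z - (n1 + n2 + 1)); last by rewrite hE'; ring.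
  by ring.
- move=> i z ii zz; rewrite /flat Y0E pureu ?p1_range // ydisp_cat -n1E -/p1.
  rewrite (_ : forall x y t : R, x + y + t - y = x + t); last by move=> *; ring.
  have [h1|h1] := leP (z - n1) 0.
    have -> : g z = 0 by rewrite /g clamp_lo ?mulr0 //; lra.
    by rewrite addr0 !(ydisp_lo (profile_late R) w2); try lra.
  have g0 : 0 <= g z by rewrite /g mulr_ge0 //; [lra|case/andP: (clamp01 (4 * (z - n1)))].
  rewrite !(ydisp_hi (profile_late R) (w := w1)) -?n1E; try lra.
  have [h2|h2] := leP (z - n1) 4^-1.
    have gm : g z <= m.
      by rewrite /g ler_piMr //; [lra|case/andP: (clamp01 (4 * (z - n1)))].
    by rewrite !(late_ydisp_lo w2); try lra.
  have -> : g z = m by rewrite /g clamp_hi ?mulr1 //; lra.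
  by rewrite (_ : z + m - n1 - m = z - n1); last by ring.
Qed.

Lemma delete_pure_word :
  ambient_isotopic (@roomy_plat R b w) (@roomy_plat R b (w1 ++ w2)).
Proof.
case: heights => m1 n1_ge0 n2_ge0 hE'.
have -> : @roomy_plat R b w = fig s (- 2^-1) (h + 2^-1) X0 Y0.
  rewrite /roomy_plat /X0 /Y0 (_ : h = (size w)%:R + 1); last first.
    by rewrite hE' /w !size_cat !natrD n1E mE n2E; ring.
  by congr fig; lra.
apply: isotopic_trans lift_layers _.
apply: isotopic_trans straighten_layers _.
apply: isotopic_trans flatten_layers _.
apply: isotopic_sym; exact: squeeze_word.
Qed.

End PureWord.

(** ** Sliding a layered word over the top caps *)

Section CapWord.
Hypotheses (w2E : w2 = [::])
  (u_mate : forall i, (1 <= i <= s)%N -> pos (idx u) (mate i) = mate (pos (idx u) i))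
  (d_mate : forall i, (1 <= i <= s)%N -> d (mate i) = (d i).+1 \/ d i = (d (mate i)).+1).

Let p2 := pos (idx w).

Let nu i := pos (rev (idx w1)) (mate (p1 i)).

Let p1nu i : p1 (nu i) = mate (p1 i).
Proof. exact: pos_revK. Qed.

Let p1_range i : (1 <= i <= s)%N -> (1 <= p1 i <= s)%N.
Proof. by move=> ii; rewrite /p1 pos_range. Qed.

Let nu_range i : (1 <= i <= s)%N -> (1 <= nu i <= s)%N.
Proof. by move=> ii; rewrite /nu pos_range ?valid_rev // mate_range // p1_range. Qed.

Let p2E i : p2 i = pos (idx u) (p1 i).
Proof. by rewrite /p2 /w w2E cats0 idx_cat pos_cat. Qed.

Let p2_range i : (1 <= i <= s)%N -> (1 <= p2 i <= s)%N.
Proof. by move=> ii; rewrite p2E pos_range // p1_range. Qed.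

Let p2nu i : (1 <= i <= s)%N -> p2 (nu i) = mate (p2 i).
Proof. by move=> ii; rewrite !p2E p1nu u_mate // p1_range. Qed.

Let Dnu i : (1 <= i <= s)%N -> D (nu i) = (D i).+1 \/ D i = (D (nu i)).+1.
Proof. by move=> ii; rewrite /D p1nu; apply: d_mate; exact: p1_range. Qed.

Let heights2 : [/\ 1 <= m, 0 <= n1 & h = n1 + m + 1].
Proof. by case: heights => m1 n1_ge0 _ ->; split=> //; rewrite n2E w2E addr0. Qed.

Let tau (z : R) := Num.max 0 (z - h).

Let tau01 z : z <= h + 2^-1 -> 0 <= tau z <= 1.
Proof. by move=> ?; rewrite /tau; apply/andP; split; mml. Qed.

Let tau0 z : z - n1 <= m -> tau z = 0.
Proof. by case: heights2 => m1 n1_ge0 hE' ?; rewrite /tau; mml. Qed.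

Let X0_up i z : n1 <= z -> X0 i z = (p1 i)%:R + inner_disp i z + dir R (p2 i) * tau z.
Proof.
case: heights2 => m1 n1_ge0 hE' z1; rewrite X0E (xdisp_hi (profile_late R)) ?size_idx -?n1E //.
have -> : idx w2 = [::] by rewrite w2E.
rewrite /= (_ : Num.max 0 (- z) = 0); last by mml.
by rewrite /p1 /p2 /tau; ring.
Qed.

Let Y0_up i z : n1 <= z -> Y0 i z = ydisp late_tent u (p1 i) (z - n1).
Proof.
by move=> z1; rewrite Y0E w2E (ydisp_hi (profile_late R)) -?n1E // add0r addr0.
Qed.

Let mid_lo i z : z - n1 <= 4^-1 -> inner_disp i z = 0.
Proof. by move=> zz; rewrite /inner_disp late_xdisp_lo. Qed.

Let mid_hi i z : m - 4^-1 <= z - n1 -> inner_disp i z = (p2 i)%:R - (p1 i)%:R.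
Proof. by move=> zz; rewrite /inner_disp late_xdisp_hi ?size_idx -?mE // p2E. Qed.

Let ramp (z : R) : R := clamp (4 * z).

Let ramp_bump z : z <= m - 4^-1 -> ramp z = bump m z.
Proof. by move=> ?; rewrite /ramp /bump /clamp; mml. Qed.

(* In the cap the depth passes linearly from that of one leg to that of the other one. *)
Let layer i z : R := (1 - tau z) * (D i)%:R + tau z * (D (nu i))%:R.

Let raised i z := lifted i z + (ramp (z - n1) - bump m (z - n1)) * layer i z.

(* Above the crossings the strands are vertical or legs of caps, so a shear in the [y]
   direction that interpolates the depths over the final positions reaches all of them. *)
Let raise_caps :
  ambient_isotopic (fig s (- 2^-1) (h + 2^-1) X0 lifted)
    (fig s (- 2^-1) (h + 2^-1) X0 raised).
Proof.
case: heights2 => m1 n1_ge0 hE'.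
apply: (fig_shear_y (g := fun x z => (ramp (z - n1) - bump m (z - n1)) *
   interp s p2 (fun i => (D i)%:R) x)).
  have := @cont_interp R _ s p2 (fun i (p : R * R) => (D i)%:R) fst
    (fun i => @cont_cst R _ _) (cont_fst (f := id) (@cont_id _)).
  by move=> ci; rewrite /ramp; cont.
move=> i z ii /andP[z0 z1]; rewrite /raised; congr (_ + _).
have [h1|h1] := leP (z - n1) (m - 4^-1).
  by rewrite ramp_bump // subrr !mul0r.
congr (_ * _); rewrite X0_up; last lra.
rewrite mid_hi; last lra.
rewrite (_ : _ + _ = (1 - tau z) * (p2 i)%:R + tau z * (p2 (nu i))%:R); last first.
  rewrite p2nu // mate_dir; last by case/andP: (p2_range ii).
  by ring.
rewrite (@interp_segment R s _ _ i (nu i)) ?nu_range ?tau01 //.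
  by move=> j k _ _ /pos_inj.
by rewrite p2nu //; apply: mate_consecutive; case/andP: (p2_range ii).
Qed.

Let raised_layer i z : 4^-1 <= z - n1 -> raised i z = layer i z.
Proof.
case: heights2 => m1 n1_ge0 hE' z1; rewrite /raised /lifted Y0_up; last lra.
rewrite /ramp clamp_hi; last lra.
have [h1|h1] := leP (z - n1) m.
  by rewrite /layer tau0 //; ring.
rewrite bump_hi; last lra.
by rewrite (ydisp_hi (profile_late R)) -?mE; [ring|lra].
Qed.

Let straight i (z : R) : R := i%:R + dir R i * Num.max 0 (- z) + xdisp late (idx w1) i z +
   dir R (p1 i) * tau z.

(* As the legs of a cap have consecutive depths, the shear that makes each strand vertical is
   affine between them, and maps the cap to the cap over the original positions. *)
Let turn_caps :
  ambient_isotopic (fig s (- 2^-1) (h + 2^-1) X0 raised)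
    (fig s (- 2^-1) (h + 2^-1) straight raised).
Proof.
case: heights2 => m1 n1_ge0 hE'.
apply: (fig_shear_x (f := fun y z => interp s D (fun i => - inner_disp i z) y)).
  apply: (cont_interp (e := fun i (p : R * R) => - inner_disp i p.2)); last by cont.
  by move=> i; rewrite /inner_disp; cont.
move=> i z ii /andP[z0 z1].
have [h1|h1] := leP (z - n1) 4^-1.
  rewrite interp_zero ?addr0; last by move=> j jj; rewrite mid_lo ?oppr0.
  rewrite X0E /straight mid_lo // w2E /= -/(tau z) tau0; last lra.
  by rewrite !mulr0 !addr0.
rewrite raised_layer; last lra.
rewrite (@interp_segment R s _ _ i (nu i)) ?nu_range ?tau01 //.
- rewrite X0_up; last lra.
  rewrite /straight (xdisp_hi (profile_late R)) ?size_idx -?n1E; last lra.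
  rewrite (_ : Num.max 0 (- z) = 0); last by mml.
  have [h2|h2] := leP (z - n1) m.
    by rewrite tau0 // /p1; ring.
  rewrite !mid_hi; try lra.
  rewrite p2nu // p1nu !mate_dir; first by rewrite /p1; ring.
    by case/andP: (p1_range ii).
  by case/andP: (p2_range ii).
- by move=> j k _ _; exact: Dinj.
- exact: Dnu.
Qed.

Let lower_caps :
  ambient_isotopic (fig s (- 2^-1) (h + 2^-1) straight raised)
    (fig s (- 2^-1) (h + 2^-1) straight (ydisp late_tent w1)).
Proof.
case: heights2 => m1 n1_ge0 hE'.
apply: (fig_shear_y (g := fun x z => - ramp (z - n1) * interp s p1 (fun i => (D i)%:R) x)).
  have := @cont_interp R _ s p1 (fun i (p : R * R) => (D i)%:R) fst
    (fun i => @cont_cst R _ _) (cont_fst (f := id) (@cont_id _)).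
  by move=> ci; rewrite /ramp; cont.
move=> i z ii /andP[z0 z1].
have [h1|h1] := leP (z - n1) 0.
  rewrite /raised /lifted Y0E w2E /= /ramp clamp_lo ?bump_lo //; last lra.
  by rewrite (ydisp_lo (profile_late R) u) //; ring.
rewrite (_ : straight i z = (1 - tau z) * (p1 i)%:R + tau z * (p1 (nu i))%:R); last first.
  rewrite p1nu mate_dir; last by case/andP: (p1_range ii).
  rewrite /straight (xdisp_hi (profile_late R)) ?size_idx -?n1E; last lra.
  rewrite (_ : Num.max 0 (- z) = 0); last by mml.
  by rewrite /p1; ring.
rewrite (@interp_segment R s _ _ i (nu i)) ?nu_range ?tau01 //.
- rewrite (ydisp_hi (profile_late R)) -?n1E; last lra.
  rewrite -/(layer i z).
  have [h2|h2] := leP (z - n1) 4^-1.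
    rewrite /raised /lifted Y0_up; last lra.
    by rewrite ramp_bump /layer ?tau0; [ring|lra|lra].
  rewrite raised_layer /ramp ?clamp_hi; [ring|lra|lra].
- by move=> j k _ _ /pos_inj.
- by rewrite p1nu; apply: mate_consecutive; case/andP: (p1_range ii).
Qed.

Let squeeze_caps :
  ambient_isotopic (@roomy_plat R b w1)
    (fig s (- 2^-1) (h + 2^-1) straight (ydisp late_tent w1)).
Proof.
case: heights2 => m1 n1_ge0 hE'.
pose g z := m * clamp (z - n1).
have hh : h + 2^-1 = (size w1)%:R + 3 / 2 + g ((size w1)%:R + 3 / 2).
  by rewrite /g -n1E clamp_hi ?hE'; lra.
have ll : - 2^-1 = - 2^-1 + g (- 2^-1) :> R by rewrite /g clamp_lo ?mulr0 ?addr0 //; lra.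
rewrite hh [X in fig s X]ll; apply: (fig_stretch (C := m)).
- by rewrite /g; cont.
- move=> x y xy; rewrite /g ler_pM2l; last lra.
  by apply: clamp_homo; lra.
- move=> z; rewrite /g normrM (ger0_norm (x := m)); last lra.
  by have /andP[c0 c1] := clamp01 (z - n1); rewrite ger0_norm // ler_piMr //; lra.
- move=> i z ii zz; rewrite /straight /strand_x -/p1 -n1E /tau.
  have [h1|h1] := leP (z - n1) 0.
    have -> : g z = 0 by rewrite /g clamp_lo ?mulr0 //.
    rewrite addr0 (_ : Num.max 0 (z - h) = 0); last by mml.
    by rewrite (_ : Num.max 0 (z - (n1 + 1)) = 0); last by mml.
  have g0 : 0 <= g z by rewrite /g mulr_ge0 //; [lra|case/andP: (clamp01 (z - n1))].
  rewrite !(xdisp_hi (profile_late R) (js := idx w1)) ?size_idx -?n1E; try lra.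
  rewrite (_ : Num.max 0 (- z) = 0); last by mml.
  rewrite (_ : Num.max 0 (- (z + g z)) = 0); last by mml.
  have [h2|h2] := leP (z - n1) 1.
    have gm : g z <= m by rewrite /g ler_piMr //; [lra|case/andP: (clamp01 (z - n1))].
    rewrite (_ : Num.max 0 (z + g z - h) = 0); last by mml.
    by rewrite (_ : Num.max 0 (z - (n1 + 1)) = 0); last by mml.
  have -> : g z = m by rewrite /g clamp_hi ?mulr1 //; lra.
  by rewrite (_ : z + m - h = z - (n1 + 1)); last by rewrite hE'; ring.
- move=> i z ii zz.
  have [h1|h1] := leP (z - n1) 0.
    have -> : g z = 0 by rewrite /g clamp_lo ?mulr0 //.
    by rewrite addr0.
  have g0 : 0 <= g z by rewrite /g mulr_ge0 //; [lra|case/andP: (clamp01 (z - n1))].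
  by rewrite !(ydisp_hi (profile_late R) (w := w1)) -?n1E; try lra.
Qed.

(** The strands of the word are pulled straight together with the caps they end in. Another
    cap would be torn apart if its depth were between those of two joined legs. *)
Lemma slide_over_caps :
  ambient_isotopic (@roomy_plat R b w) (@roomy_plat R b w1).
Proof.
case: heights => m1 n1_ge0 n2_ge0 hE'.
have -> : @roomy_plat R b w = fig s (- 2^-1) (h + 2^-1) X0 Y0.
  rewrite /roomy_plat /X0 /Y0 (_ : h = (size w)%:R + 1); last first.
    by rewrite hE' /w !size_cat !natrD n1E mE n2E; ring.
  by congr fig; lra.
apply: isotopic_trans lift_layers _.
apply: isotopic_trans raise_caps _.
apply: isotopic_trans turn_caps _.
apply: isotopic_trans lower_caps _.
apply: isotopic_sym; exact: squeeze_caps.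
Qed.

End CapWord.

End Moves.

(** * Plat closures as unions of graphs *)

Section PlatFigures.
Variable R : realType.
Let cont_clampR := @cont_clamp R.
#[local] Hint Resolve cont_clampR : cont.

Lemma strand_x_bottom p t js (h : R) i z : profile p t -> 0 <= h -> z <= 0 ->
  strand_x p js h i z = i%:R + dir R i * - z.
Proof.
move=> pt h0 z0; rewrite /strand_x (xdisp_lo pt) //.
rewrite (_ : Num.max 0 (- z) = - z); last by mml.
by rewrite (_ : Num.max 0 (z - h) = 0); [ring|mml].
Qed.

Lemma strand_x_middle p js (h : R) i z : 0 <= z <= h -> strand_x p js h i z = i%:R + xdisp p js i z.
Proof.
case/andP=> z0 z1; rewrite /strand_x.
rewrite (_ : Num.max 0 (- z) = 0); last by mml.
by rewrite (_ : Num.max 0 (z - h) = 0); [ring|mml].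
Qed.

Lemma strand_x_top p t js (h : R) i z : profile p t -> (size js)%:R <= h -> h <= z ->
  strand_x p js h i z = (pos js i)%:R + dir R (pos js i) * (z - h).
Proof.
move=> pt hs hz; have ? : 0 <= (size js)%:R :> R by [].
rewrite /strand_x (xdisp_hi pt); last lra.
rewrite (_ : Num.max 0 (- z) = 0); last by mml.
by rewrite (_ : Num.max 0 (z - h) = z - h); [ring|mml].
Qed.

Lemma word_split (w : seq letter) k : (k < size w)%N ->
  w = take k w ++ nth (0%N, true) w k :: drop k.+1 w.
Proof. by move=> kw; rewrite -drop_nth // cat_take_drop. Qed.

Section AtLetter.
Variables (w : seq letter) (k : nat) (t : R) (i : nat).
Hypotheses (kw : (k < size w)%N) (t01 : 0 <= t <= 1).
Let l := nth (0%N, true) w k.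
Let P := pos (idx (take k w)) i.

Let clampt : clamp t = t.
Proof. by rewrite clamp_id // in_itv. Qed.

Lemma xdisp_at_letter :
  i%:R + xdisp clamp (idx w) i (k%:R + t) = P%:R + ((transp l.1 P)%:R - P%:R) * t.
Proof.
have /andP[t0 t1] := t01.
have -> : idx w = idx (take k w) ++ l.1 :: idx (drop k.+1 w).
  by rewrite {1}(word_split kw) idx_cat.
rewrite xdisp_cat size_idx size_takel; last exact: ltnW.
rewrite (xdisp_hi (profile_clamp R)); last by rewrite size_idx size_takel; [lra|exact: ltnW].
rewrite /= (_ : k%:R + t - k%:R = t); last by ring.
rewrite clampt (xdisp_lo (profile_clamp R)); last lra.
by rewrite -/P -/l; ring.
Qed.

Lemma ydisp_at_letter : ydisp clamp_tent w i (k%:R + t) = side R l P * tent t.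
Proof.
have /andP[t0 t1] := t01.
have -> : ydisp clamp_tent w = ydisp clamp_tent (take k w ++ l :: drop k.+1 w).
  by rewrite -word_split.
rewrite ydisp_cat size_takel; last exact: ltnW.
rewrite (ydisp_hi (profile_clamp R)); last by rewrite size_takel; [lra|exact: ltnW].
rewrite /= (_ : k%:R + t - k%:R = t); last by ring.
rewrite /clamp_tent clampt (ydisp_lo (profile_clamp R)); last lra.
by rewrite -/P -/l; ring.
Qed.

End AtLetter.

Lemma dir_odd k : (0 < k)%N -> dir R (2 * k - 1) = 1.
Proof. by rewrite /dir mul2n; case: k => // k _; rewrite doubleS subn1 /= odd_double. Qed.

Lemma dir_even k : dir R (2 * k) = -1.
Proof. by rewrite /dir mul2n odd_double. Qed.

(** A cap is drawn with the horizontal coordinate as the parameter; on each of its two legs,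
    the height can take its place. *)
Lemma capP (b : nat) (x y : R) :
  (exists2 k : nat, (1 <= k <= b)%N & exists2 t : R, t \in `[0, 1] &
     x = (2 * k - 1)%N%:R + t /\ y = tent t) <->
  (exists2 i : nat, (1 <= i <= 2 * b)%N & 0 <= y <= 2^-1 /\ x = i%:R + dir R i * y).
Proof.
split=> [[k kb [t]]|[i ib [/andP[y0 y1] ->]]].
  rewrite in_itv /= => /andP[t0 t1] [-> ->].
  have [ht|ht] := leP t 2^-1.
    exists (2 * k - 1)%N; first lia.
    have -> : tent t = t by rewrite /tent; mml.
    by rewrite dir_odd ?mul1r; [split=> //; apply/andP; split; lra|lia].
  exists (2 * k)%N; first lia.
  have -> : tent t = 1 - t by rewrite /tent; mml.
  rewrite dir_even mulN1r natrB; last lia.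
  by split; [apply/andP; split; lra|lra].
have := odd_double_half i; case o : (odd i) => /= hi.
  exists (i./2.+1); first lia.
  exists y; first by rewrite in_itv /=; apply/andP; split; lra.
  rewrite /dir o mul1r (_ : (2 * i./2.+1 - 1)%N = i); last lia.
  by split=> //; rewrite /tent; mml.
exists (i./2); first lia.
exists (1 - y); first by rewrite in_itv /=; apply/andP; split; lra.
rewrite /dir o mulN1r.
have -> : (2 * i./2 - 1)%N = i.-1 by lia.
split; last by rewrite /tent; mml.
have -> : i%:R = i.-1%:R + 1 :> R by rewrite natr1 prednK //; lia.
lra.
Qed.

(** A strand is indexed by its position at the bottom; the strand that is in position [P]
    before the [k]-th letter is found by running the first [k] letters backwards. *)
Lemma plat_closureE b w : braid_word (2 * b) w ->
  @plat_closure R b w = fig (2 * b) (- 2^-1) ((size w)%:R + 2^-1)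
    (strand_x clamp (idx w) (size w)%:R) (ydisp clamp_tent w).
Proof.
move=> /braid_wordP vw; have h0 : 0 <= (size w)%:R :> R by [].
have vt k : valid (2 * b) (idx (take k w)).
  move: vw; rewrite -{1}(cat_take_drop k w) idx_cat valid_cat; by case/andP.
apply/seteqP; split=> p.
  rewrite /plat_closure => -[[]|].
  - case=> k kb [t tt ->].
    have [i ib [ht hx]] := (capP b _ _).1 (ex_intro2 _ _ k kb (ex_intro2 _ _ t tt (conj erefl erefl))).
    exists i => //; exists (- tent t); first by case/andP: ht => *; apply/andP; split; lra.
    have tz : - tent t <= 0 by case/andP: ht; lra.
    by rewrite (strand_x_bottom _ _ (profile_clamp R)) // (ydisp_lo (profile_clamp R)) // opprK -hx.
  - case=> k /= kw [t]; rewrite in_itv /= => t01 H.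
    set l := nth (0%N, true) w k in H.
    have /andP[t0 t1] := t01.
    have kz : k%:R + 1 <= (size w)%:R :> R by rewrite natr1 ler_nat.
    have k0 : 0 <= k%:R :> R by [].
    have lv : (0 < l.1 < 2 * b)%N.
      by move/allP: vw; apply; rewrite /l map_f // mem_nth.
    have main P : (1 <= P <= 2 * b)%N ->
      p = (P%:R + ((transp l.1 P)%:R - P%:R) * t, side R l P * tent t, k%:R + t) ->
      fig (2 * b) (- 2^-1) ((size w)%:R + 2^-1)
        (strand_x clamp (idx w) (size w)%:R) (ydisp clamp_tent w) p.
      move=> Pb ->; exists (pos (rev (idx (take k w))) P); first by rewrite pos_range ?valid_rev.
      exists (k%:R + t); first by apply/andP; split; lra.
      rewrite strand_x_middle; last by apply/andP; split; lra.
      by rewrite xdisp_at_letter // ydisp_at_letter // pos_revK.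
    case: H => [H|H|[j [jb jl jl1 H]]].
    + apply: (main l.1); first lia.
      by rewrite H side_lo transp_lo -natr1; congr (_, _, _); ring.
    + apply: (main l.1.+1); first lia.
      by rewrite H side_hi transp_hi -natr1; congr (_, _, _); ring.
    + apply: (main j) => //.
      by rewrite H /side /transp (negbTE jl) (negbTE jl1); congr (_, _, _); ring.
  - case=> k kb [t tt ->].
    have [i ib [ht hx]] := (capP b _ _).1 (ex_intro2 _ _ k kb (ex_intro2 _ _ t tt (conj erefl erefl))).
    have /andP[ht0 ht1] := ht.
    exists (pos (rev (idx w)) i); first by rewrite pos_range ?valid_rev.
    exists ((size w)%:R + tent t); first by apply/andP; split; lra.
    rewrite (strand_x_top _ (profile_clamp R)) ?size_idx ?(ydisp_hi (profile_clamp R)) ?lerDl //.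
    rewrite pos_revK (_ : (size w)%:R + tent t - (size w)%:R = tent t); last by ring.
    by rewrite -hx.
case=> i ib [z /andP[z0 z1] ->]; rewrite /plat_closure.
have [zn|zp] := leP z 0.
  left; left; rewrite (strand_x_bottom _ _ (profile_clamp R)) ?(ydisp_lo (profile_clamp R)) //.
  have [k kb [t tt [hx hy]]] : exists2 k : nat, (1 <= k <= b)%N & exists2 t : R, t \in `[0, 1] &
     i%:R + dir R i * - z = (2 * k - 1)%N%:R + t /\ - z = tent t.
    by apply/capP; exists i => //; split=> //; apply/andP; split; lra.
  by exists k => //; exists t => //; rewrite hx -hy opprK.
have [zt|zm] := leP (size w)%:R z.
  right; rewrite (strand_x_top _ (profile_clamp R)) ?size_idx ?(ydisp_hi (profile_clamp R)) //.
  set j := pos (idx w) i; have jb : (1 <= j <= 2 * b)%N by rewrite pos_range.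
  have [k kb [t tt [hx hy]]] : exists2 k : nat, (1 <= k <= b)%N & exists2 t : R, t \in `[0, 1] &
     j%:R + dir R j * (z - (size w)%:R) = (2 * k - 1)%N%:R + t /\ z - (size w)%:R = tent t.
    by apply/capP; exists j => //; split=> //; apply/andP; split; lra.
  exists k => //; exists t => //.
  by rewrite hx -hy (_ : (size w)%:R + (z - (size w)%:R) = z) //; ring.
left; right.
have zz : 0 <= z by lra.
pose k := Num.truncn z.
have /andP[k1 k2] : k%:R <= z < k.+1%:R by apply: truncn_itv.
have kw : (k < size w)%N by rewrite -(ltr_nat R); apply: le_lt_trans k1 zm.
exists k => //=.
pose t := z - k%:R; have zE : z = k%:R + t by rewrite /t addrC subrK.
have t01 : 0 <= t <= 1 by rewrite /t; move: k2; rewrite -natr1 => ?; apply/andP; split; lra.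
exists t; first by rewrite in_itv.
rewrite strand_x_middle; last by apply/andP; split; lra.
rewrite zE xdisp_at_letter // ydisp_at_letter //.
set P := pos _ i; set l := nth _ w k.
have Pb : (1 <= P <= 2 * b)%N by rewrite pos_range.
have [->|P1] := eqVneq P l.1.
  by apply: Or31; rewrite side_lo transp_lo -natr1; congr (_, _, _); ring.
have [->|P2] := eqVneq P l.1.+1.
  by apply: Or32; rewrite side_hi transp_hi -natr1; congr (_, _, _); ring.
apply: Or33; exists P; split=> //.
by rewrite /side /transp (negbTE P1) (negbTE P2); congr (_, _, _); ring.
Qed.

End PlatFigures.

(** * Making room for the moves *)

Section Room.
Variable R : realType.
Let cont_clampR := @cont_clamp R.
#[local] Hint Resolve cont_clampR : cont.

Definition mix (t : R) (p q : R -> R) (z : R) : R := p z + t * (q z - p z).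

Lemma xdisp_mix t (p q : R -> R) js i z :
  xdisp (mix t p q) js i z = xdisp p js i z + t * (xdisp q js i z - xdisp p js i z).
Proof. by elim: js i z => [|j js IH] i z /=; [ring|rewrite IH /mix; ring]. Qed.

Lemma ydisp_mix t (p q : R -> R) w i z :
  ydisp (mix t p q) w i z = ydisp p w i z + t * (ydisp q w i z - ydisp p w i z).
Proof. by elim: w i z => [|l w IH] i z /=; [ring|rewrite IH /mix; ring]. Qed.

Lemma mix_same t (p q : R -> R) z c : p z = c -> q z = c -> mix t p q z = c.
Proof. by rewrite /mix => -> ->; ring. Qed.

Lemma mix_bounds t (p q : R -> R) z c : 0 <= t <= 1 ->
  0 <= p z <= c -> 0 <= q z <= c -> 0 <= mix t p q z <= c.
Proof.
rewrite /mix => /andP[t0 t1] /andP[p0 p1] /andP[q0 q1].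
have a1 : 0 <= t * q z by apply: mulr_ge0.
have a2 : 0 <= (1 - t) * p z by apply: mulr_ge0 => //; lra.
have a3 : 0 <= t * (c - q z) by apply: mulr_ge0 => //; lra.
have a4 : 0 <= (1 - t) * (c - p z) by apply: mulr_ge0 => //; lra.
by apply/andP; split; lra.
Qed.

Lemma cont_mix t (p q : R -> R) : continuous p -> continuous q -> continuous (mix t p q).
Proof. by move=> cp cq; rewrite /mix; cont. Qed.

(* Delaying a crossing keeps each strand on its side of the crossing point, and does not
   bring it closer. *)
Lemma late_further (z : R) :
  0 <= 1 - 2 * clamp z <= 1 - 2 * late z \/
  0 <= 2 * clamp z - 1 <= 2 * late z - 1.
Proof.
have [h|h] := leP z 2^-1.
  left; rewrite /late /clamp; apply/andP; split; mml.
right; rewrite /late /clamp (@max_r _ _ 0 (Num.min z 1)); last by mml.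
by apply/andP; split; mml.
Qed.

Lemma profile_mix_x t : 0 <= t <= 1 -> profile (mix t clamp late) (@clamp_tent R).
Proof.
move=> t01; have pc := profile_clamp R; have pl := profile_late R.
split; try by [exact: cont_t pc|exact: profile_tlo pc|exact: profile_thi pc|exact: profile_t01 pc].
- by apply: cont_mix; [exact: cont_p pc|exact: cont_p pl].
- by move=> z z0; apply: mix_same; [exact: (profile_lo pc)|exact: (profile_lo pl)].
- by move=> z z0; apply: mix_same; [exact: (profile_hi pc)|exact: (profile_hi pl)].
- by move=> z; apply: mix_bounds => //; exact: clamp01.
move=> z; apply: le_trans (profile_sep pc z) _; rewrite lerD2r /mix.
move: t01 => /andP[t0 t1].
case: (late_further z) => /andP[h1 h2].
  have : 0 <= t * (clamp z - late z) by apply: mulr_ge0; lra.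
  by move=> ?; rewrite ger0_norm // ler_normr; apply/orP; left; lra.
have : 0 <= t * (late z - clamp z) by apply: mulr_ge0; lra.
move=> ?; rewrite ler0_norm; last lra.
by rewrite ler_normr; apply/orP; right; lra.
Qed.

Lemma profile_mix_t t : 0 <= t <= 1 -> profile late (mix t clamp_tent (@late_tent R)).
Proof.
move=> t01; have pc := profile_clamp R; have pl := profile_late R.
split; try by [exact: cont_p pl|exact: profile_lo pl|exact: profile_hi pl|exact: profile_p01 pl].
- by apply: cont_mix; [exact: cont_t pc|exact: cont_t pl].
- by move=> z z0; apply: mix_same; [exact: (profile_tlo pc)|exact: (profile_tlo pl)].
- by move=> z z0; apply: mix_same; [exact: (profile_thi pc)|exact: (profile_thi pl)].
- by move=> z; apply: mix_bounds => //; [exact: (profile_t01 pc)|exact: (profile_t01 pl)].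
move=> z; move: t01 => /andP[t0 t1].
have h1 := profile_sep pl z; have h2 := profile_sep pc z.
have h3 : `|1 - 2 * clamp z| <= `|1 - 2 * late z|.
  case: (late_further z) => /andP[? ?]; first by rewrite !ger0_norm //; lra.
  by rewrite !ler0_norm; lra.
rewrite /mix.
have a1 : 0 <= t * (`|1 - 2 * late z| + 2 * late_tent z - 1) by apply: mulr_ge0; lra.
have a2 : 0 <= (1 - t) * (`|1 - 2 * late z| + 2 * clamp_tent z - 1) by apply: mulr_ge0; lra.
lra.
Qed.

Section Widen.
Variables (b : nat) (w : seq letter).
Let s := (2 * b)%N.
Let js := idx w.
Let h : R := (size w)%:R.
Let lo : R := - 2^-1.
Let hi : R := h + 2^-1.

(* Straightens the legs of a cap up to height 1/8 above the word. *)
Let kink (z : R) : R := - Num.max 0 (Num.min (z - h) (4^-1 - (z - h))).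

Let cx i (z : R) := xdisp late js i z - xdisp clamp js i z + dir R (pos js i) * kink z.
Let cy i (z : R) := ydisp late_tent w i z - ydisp clamp_tent w i z.
Let X1 i z := strand_x clamp js h i z + cx i z.

Let cont_late_xdisp i : continuous (xdisp (@late R) js i) := cont_xdisp (cont_p (profile_late R)).
Let cont_clamp_xdisp i : continuous (xdisp (@clamp R) js i) := cont_xdisp (cont_p (profile_clamp R)).
Let cont_late_ydisp i : continuous (ydisp (@late_tent R) w i) := cont_ydisp (cont_t (profile_late R)).
Let cont_clamp_ydisp i : continuous (ydisp (@clamp_tent R) w i) := cont_ydisp (cont_t (profile_clamp R)).
Let cont_strand_xc i : continuous (strand_x (@clamp R) js h i) := cont_strand_x (cont_p (profile_clamp R)).
#[local] Hint Resolve cont_late_xdisp cont_clamp_xdisp cont_late_ydisp cont_clamp_ydisp cont_strand_xc : cont.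

Let hE : h = (size js)%:R. Proof. by rewrite size_idx. Qed.

Lemma dir_norm i : `|dir R i| = 1.
Proof. by rewrite /dir; case: odd; rewrite ?normrN normr1. Qed.

Lemma legs_apart i j (u : R) : i != j -> 0 <= u <= 4^-1 ->
  2^-1 <= `|(i%:R + dir R i * u) - (j%:R + dir R j * u)|.
Proof.
move=> ij /andP[u0 u1]; have := natr_dist_ge1 R ij.
by rewrite /dir; case: odd; case: odd; mml.
Qed.

Let push_x : ambient_isotopic (fig s lo hi (strand_x clamp js h) (ydisp clamp_tent w))
  (fig s lo hi X1 (ydisp clamp_tent w)).
Proof.
have h0 : 0 <= h by rewrite /h.
apply: (fig_push_x (M := (size js)%:R + (size js)%:R + 1)).
- by move=> i; cont.
- by move=> i; cont.
- by move=> i; rewrite /cx /kink; cont.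
- by rewrite !addr_ge0.
- move=> i z _; rewrite /cx; apply: le_trans (ler_normD _ _) _; apply: lerD.
    apply: le_trans (ler_normB _ _) _; apply: lerD.
      exact: xdisp_bound (profile_late R) _ _ _.
    exact: xdisp_bound (profile_clamp R) _ _ _.
  by rewrite normrM dir_norm mul1r /kink; mml.
move=> z _.
have [z0|z0] := leP z 0.
  left=> i _; rewrite /cx (xdisp_lo (profile_late R)) // (xdisp_lo (profile_clamp R)) //.
  by rewrite (_ : kink z = 0); [ring|rewrite /kink; mml].
have [z1|z1] := leP z h.
  right=> t i j t01 _ _ ij; rewrite /cx (_ : kink z = 0); last by rewrite /kink; mml.
  rewrite !strand_x_middle; try by apply/andP; split; lra.
  rewrite !mulr0 !addr0 -![_ + xdisp clamp _ _ _ + _]addrA -!xdisp_mix.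
  by apply: le_trans (strand_sep (profile_mix_x t01) _ _ ij); lra.
have D i : xdisp late js i z - xdisp clamp js i z = 0.
  rewrite (xdisp_hi (profile_late R)) -?hE ?(xdisp_hi (profile_clamp R)) -?hE ?subrr //; lra.
have [z2|z2] := leP (h + 4^-1) z.
  left=> i _; rewrite /cx D add0r (_ : kink z = 0); [ring|rewrite /kink; mml].
right=> t i j /andP[t0 t1] _ _ ij; rewrite /cx !D !add0r.
rewrite !(strand_x_top _ (profile_clamp R)) -?hE //; try lra.
set u := z - h + t * kink z.
have E k : (pos js k)%:R + dir R (pos js k) * (z - h) + t * (dir R (pos js k) * kink z) =
  (pos js k)%:R + dir R (pos js k) * u by rewrite /u; ring.
rewrite !E.
have uu : 0 <= u <= 4^-1.
  have k1 : - (z - h) <= kink z <= 0 by rewrite /kink; apply/andP; split; mml.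
  case/andP: k1 => k1 k2.
  have a1 : 0 <= t * (z - h + kink z) by apply: mulr_ge0; lra.
  have a2 : 0 <= (1 - t) * (z - h) by apply: mulr_ge0; lra.
  have a3 : 0 <= t * - kink z by apply: mulr_ge0; lra.
  by rewrite /u; apply/andP; split; lra.
apply: le_trans (legs_apart (i := pos js i) (j := pos js j) _ uu) _.
  by apply: contra_neq ij => /pos_inj.
by rewrite lerDl.
Qed.

Let push_y : ambient_isotopic (fig s lo hi X1 (ydisp clamp_tent w))
  (fig s lo hi X1 (ydisp late_tent w)).
Proof.
have -> : ydisp late_tent w = (fun i z => ydisp (@clamp_tent R) w i z + cy i z).
  by apply/funext => i; apply/funext => z; rewrite /cy addrC subrK.
have h0 : 0 <= h by rewrite /h.
apply: (fig_push_y (M := (size w)%:R + (size w)%:R)).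
- by move=> i; rewrite /X1 /cx /kink; cont.
- by move=> i; cont.
- by move=> i; rewrite /cy; cont.
- by rewrite addr_ge0.
- move=> i z _; rewrite /cy; apply: le_trans (ler_normB _ _) _; apply: lerD.
    exact: ydisp_bound (profile_late R) _ _ _.
  exact: ydisp_bound (profile_clamp R) _ _ _.
move=> z _.
have [z0|z0] := leP z 0.
  by left=> i _; rewrite /cy (ydisp_lo (profile_late R)) // (ydisp_lo (profile_clamp R)) // subrr.
have [z1|z1] := leP h z.
  by left=> i _; rewrite /cy (ydisp_hi (profile_late R)) // (ydisp_hi (profile_clamp R)) // subrr.
right=> t i j t01 _ _ ij; rewrite /X1 /cx (_ : kink z = 0); last by rewrite /kink; mml.
rewrite !strand_x_middle; try by apply/andP; split; lra.
rewrite /cy -!ydisp_mix !mulr0 !addr0.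
have E k : k%:R + xdisp clamp js k z + (xdisp late js k z - xdisp clamp js k z) =
  k%:R + xdisp late js k z by ring.
rewrite !E.
by apply: le_trans (strand_sep (profile_mix_t t01) _ _ ij); lra.
Qed.

Let stretch : ambient_isotopic (fig s lo hi X1 (ydisp late_tent w)) (@roomy_plat R b w).
Proof.
have h0 : 0 <= h by rewrite /h.
pose g z : R := 7 / 8 * clamp (8 * (z - h)) + 8^-1 * clamp (8 * (z - h) - 1).
have g_lo z : z <= h -> g z = 0 by move=> ?; rewrite /g !clamp_lo; lra.
have g_mid z : h <= z <= h + 8^-1 -> g z = 7 * (z - h).
  case/andP=> z0 z1; rewrite /g clamp_id; last by rewrite in_itv /=; apply/andP; split; lra.
  by rewrite clamp_lo; [field|lra].
have g_mid2 z : h + 8^-1 <= z <= h + 4^-1 -> g z = 7 / 8 + (z - h - 8^-1).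
  case/andP=> z0 z1; rewrite /g clamp_hi; last lra.
  by rewrite clamp_id; [field|rewrite in_itv /=; apply/andP; split; lra].
have g_hi z : h + 4^-1 <= z -> g z = 1 by move=> ?; rewrite /g !clamp_hi; lra.
rewrite /roomy_plat -/h -/s -/js.
have -> : h + 3 / 2 = hi + g hi by rewrite g_hi /hi; lra.
have -> : - 2^-1 = lo + g lo by rewrite g_lo /lo; lra.
apply: (fig_stretch (C := 1)).
- by rewrite /g; cont.
- move=> x y xy; rewrite /g; apply: lerD; apply: ler_wpM2l; rewrite ?invr_ge0 //; try lra;
    by apply: clamp_homo; lra.
- move=> z; have /andP[a0 a1] := clamp01 (8 * (z - h)).
  have /andP[b0 b1] := clamp01 (8 * (z - h) - 1).
  by rewrite /g ger0_norm; lra.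
- move=> i z ii zz; rewrite /X1 /cx /strand_x.
  have [z0|z0] := leP z h.
    rewrite g_lo // addr0 (_ : kink z = 0); last by rewrite /kink; mml.
    rewrite (_ : Num.max 0 (z - (h + 1)) = 0); last by mml.
    by rewrite (_ : Num.max 0 (z - h) = 0); [ring|mml].
  have gz : 0 <= g z.
    have /andP[a0 a1] := clamp01 (8 * (z - h)).
    have /andP[b0 b1] := clamp01 (8 * (z - h) - 1).
    by rewrite /g; lra.
  rewrite !(xdisp_hi (profile_late R)) -?hE; try lra.
  rewrite !(xdisp_hi (profile_clamp R)) -?hE; try lra.
  rewrite (_ : Num.max 0 (- z) = 0); last by mml.
  rewrite (_ : Num.max 0 (- (z + g z)) = 0); last by mml.
  suff -> : Num.max 0 (z + g z - (h + 1)) = Num.max 0 (z - h) + kink z by ring.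
  have zh : Num.max 0 (z - h) = z - h by rewrite max_r //; lra.
  have [z1|z1] := leP z (h + 8^-1).
    rewrite zh g_mid; last by apply/andP; split; lra.
    by rewrite max_l ?/kink ?min_l ?max_r ?subrr //; lra.
  have [z2|z2] := leP z (h + 4^-1).
    rewrite zh g_mid2; last by apply/andP; split; lra.
    by rewrite max_r ?/kink ?min_r ?max_r; [field|lra..].
  rewrite zh g_hi; last lra.
  by rewrite max_r ?/kink ?min_r ?max_l; [ring|lra..].
- move=> i z ii zz.
  have [z0|z0] := leP z h; first by rewrite g_lo ?addr0.
  have gz : 0 <= g z.
    have /andP[a0 a1] := clamp01 (8 * (z - h)).
    have /andP[b0 b1] := clamp01 (8 * (z - h) - 1).
    by rewrite /g; lra.
  by rewrite !(ydisp_hi (profile_late R)) //; rewrite -/h; lra.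
Qed.

(** Late crossings are reached through horizontal and then transversal pushes, and the
    kinks of the cap legs provide the vertical segments that are stretched into the
    empty level. *)
Lemma isotopic_roomy : braid_word s w ->
  ambient_isotopic (@plat_closure R b w) (@roomy_plat R b w).
Proof.
move=> vw; rewrite plat_closureE //.
apply: isotopic_trans push_x _; apply: isotopic_trans push_y _; exact: stretch.
Qed.

End Widen.
End Room.

(** * Turning plat closures upside down *)

Section Reflection.
Variable R : realType.
Local Notation E3 := (space3 R).

Definition flip (l : letter) : letter := (l.1, ~~ l.2).

Definition winv (w : seq letter) : seq letter := rev (map flip w).

Lemma size_winv w : size (winv w) = size w.
Proof. by rewrite /winv size_rev size_map. Qed.

Lemma flipK : involutive flip.
Proof. by case=> j e; rewrite /flip /= negbK. Qed.

Lemma winvK : involutive winv.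
Proof. by move=> w; rewrite /winv map_rev revK mapK //; exact: flipK. Qed.

Lemma winv_cat v w : winv (v ++ w) = winv w ++ winv v.
Proof. by rewrite /winv map_cat rev_cat. Qed.

Lemma idx_winv w : idx (winv w) = rev (idx w).
Proof. by rewrite /idx /winv map_rev -map_comp. Qed.

Definition upside_down (h : R) (p : E3) : E3 := (p.1, h - p.2).

Lemma upside_downK h : involutive (upside_down h).
Proof. by case=> q z; rewrite /upside_down /= opprB addrC subrK. Qed.

Lemma cont_upside_down h : continuous (upside_down h).
Proof. rewrite /upside_down; cont. Qed.

Lemma tent_sym (t : R) : tent (1 - t) = tent t.
Proof. by rewrite /tent minC opprB addrC subrK. Qed.

Lemma sgn_flip e : sgn_of R (~~ e) = - sgn_of R e.
Proof. by rewrite /sgn_of; case: e; rewrite ?opprK. Qed.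

Lemma upside_down_letter s l n k p : (k < n)%N -> @letter_strands R s l k p ->
  @letter_strands R s (flip l) (n - k.+1) (upside_down n%:R p).
Proof.
move=> kn [t]; rewrite in_itv /= => /andP[t0 t1] H.
have zE : n%:R - (k%:R + t) = (n - k.+1)%:R + (1 - t) :> R.
  by rewrite natrB // -natr1; ring.
exists (1 - t); first by rewrite in_itv /=; apply/andP; split; lra.
rewrite sgn_flip tent_sym /flip /=.
case: H => [->|->|[j [js jl jl1 ->]]]; rewrite /upside_down /= zE.
- by apply: Or32; congr (_, _, _); rewrite -?natr1; ring.
- by apply: Or31; congr (_, _, _); rewrite -?natr1; ring.
- by apply: Or33; exists j.
Qed.

Lemma upside_down_plat_sub b w p : @plat_closure R b w p ->
  @plat_closure R b (winv w) (upside_down (size w)%:R p).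
Proof.
case=> [[[k kb [t tt ->]]|[k /= kw H]]|[k kb [t tt ->]]].
- right; exists k => //; exists t => //.
  by rewrite /upside_down /= size_winv opprK.
- left; right; exists (size w - k.+1)%N; first by rewrite /= size_winv; lia.
  rewrite /winv nth_rev size_map; last lia.
  have E : (size w - (size w - k.+1).+1)%N = k by rewrite subnS subKn.
  rewrite (nth_map (0%N, true)) E //.
  exact: upside_down_letter.
- left; left; exists k => //; exists t => //.
  by rewrite /upside_down /= opprD addrA subrr add0r.
Qed.

Lemma upside_down_plat b w :
  upside_down (size w)%:R @` @plat_closure R b w = plat_closure b (winv w).
Proof.
apply/seteqP; split=> [_ [p pw <-]|p pw]; first exact: upside_down_plat_sub.
exists (upside_down (size w)%:R p); last by rewrite upside_downK.
by have := upside_down_plat_sub pw; rewrite winvK size_winv.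
Qed.

Lemma isotopic_shift (c : R) (K : set E3) :
  ambient_isotopic K ((fun p => (p.1, p.2 + c)) @` K).
Proof.
apply: (@isotopic_fiber_z R (fun _ z => z + c)).
- by cont.
- by move=> _ x y; rewrite ltrD2r.
- by move=> _; exists `|c| => x; rewrite addrAC subrr add0r.
Qed.

(** Upside down, a plat closure is that of the inverse word. So moves at the top caps yield
    moves at the bottom caps. *)
Lemma isotopic_winv b v w :
  ambient_isotopic (@plat_closure R b v) (plat_closure b w) ->
  ambient_isotopic (@plat_closure R b (winv v)) (plat_closure b (winv w)).
Proof.
move=> H; have := isotopic_conj (cont_upside_down (h := (size v)%:R)) (cont_upside_down (h := (size v)%:R))
  (upside_downK _) (upside_downK _) H.
rewrite upside_down_plat => H1; apply: isotopic_trans H1 _.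
rewrite -(upside_down_plat b w).
have := isotopic_shift ((size w)%:R - (size v)%:R) (upside_down (size v)%:R @` plat_closure b w).
rewrite image_comp; congr (ambient_isotopic _ (_ @` _)).
by apply/funext => -[q z]; rewrite /upside_down /=; congr (_, _); ring.
Qed.

End Reflection.

(** * Plat closures of words that split are not connected *)

Section Connected.
Variable R : realType.
Local Notation E3 := (space3 R).
Variables (b : nat) (w : seq letter).
Hypothesis vw : braid_word (2 * b) w.
Let s := (2 * b)%N.
Let lo : R := - 2^-1.
Let hi : R := (size w)%:R + 2^-1.
Let X := strand_x (@clamp R) (idx w) (size w)%:R.
Let Y := ydisp (@clamp_tent R) w.

(** The strand joined to [i] by a top cap. *)
Definition top_mate (js : seq nat) (i : nat) : nat := pos (rev js) (mate (pos js i)).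

Let strand i : set E3 := [set (X i z, Y i z, z) | z in `[lo, hi]].

Let strand_closed i : closed (strand i).
Proof.
apply: compact_closed; first exact: norm_hausdorff.
apply: continuous_compact; last exact: segment_compact.
apply: continuous_subspaceT.
have cX : continuous (X i) := cont_strand_x (cont_p (profile_clamp R)).
have cY : continuous (Y i) := cont_ydisp (cont_t (profile_clamp R)).
by cont.
Qed.

Let legs_meet i j (u : R) : 0 <= u <= 2^-1 -> (0 < i)%N -> (0 < j)%N ->
  i%:R + dir R i * u = j%:R + dir R j * u -> i = j \/ j = mate i.
Proof.
move=> /andP[u0 u1] i0 j0; have [->|ij] := eqVneq i j; first by left.
have := natr_dist_ge1 R ij; rewrite /dir /mate.
have far (a c : nat) : (a < c)%N -> a%:R + 1 <= c%:R :> R by rewrite natr1 ler_nat.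
case: (boolP (odd i)) => oi; case: (boolP (odd j)) => oj h1 h2.
- exfalso; move: h1; rewrite (_ : _ - _ = 0) ?normr0; lra.
- right; apply/eqP; rewrite eqn_leq; apply/andP; split.
    by rewrite -(ler_nat R) -natr1; lra.
  by rewrite ltn_neqAle ij -(ler_nat R); lra.
- right; suff -> : i = j.+1 by [].
  apply/eqP; rewrite eqn_leq; apply/andP; split.
    by rewrite -(ler_nat R) -natr1; lra.
  by rewrite ltn_neqAle eq_sym ij -(ler_nat R); lra.
- exfalso; move: h1; rewrite (_ : _ - _ = 0) ?normr0; lra.
Qed.

Let strands_meet i j p : (1 <= i <= s)%N -> (1 <= j <= s)%N ->
  strand i p -> strand j p -> [\/ i = j, j = mate i | j = top_mate (idx w) i].
Proof.
move=> ii jj [z zz <-] [z' zz'] [Xij Yij E]; rewrite {z' zz'}E in Xij Yij.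
move: zz; rewrite /= in_itv /= => /andP[z0 z1].
have h0 : 0 <= (size w)%:R :> R by [].
have vi : valid (2 * b) (idx w) by apply/braid_wordP.
have [zn|zp] := leP z 0.
  move: Xij; rewrite /X !(strand_x_bottom _ _ (profile_clamp R)) // => /esym /legs_meet.
  case; [|lia|lia|by move->; apply: Or31|by move->; apply: Or32].
  by move: z0; rewrite /lo => ?; apply/andP; split; lra.
have [zt|zm] := leP (size w)%:R z.
  move: Xij; rewrite /X !(strand_x_top _ (profile_clamp R)) ?size_idx // => /esym /legs_meet.
  have := pos_range i vi; have := pos_range j vi; rewrite -/s ii jj => pj pi.
  case; [|lia|lia|by move/pos_inj->; apply: Or31|].
    by move: z1; rewrite /hi => ?; apply/andP; split; lra.
  by move=> E; apply: Or33; rewrite /top_mate -E posK.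
have [->|ij] := eqVneq i j; first by apply: Or31.
have := strand_sep (profile_clamp R) w z ij.
move: Xij Yij; rewrite /X /Y !strand_x_middle; try by apply/andP; split; lra.
by move=> -> ->; rewrite !subrr normr0 addr0; lra.
Qed.

(** Strands meet only in the caps. So a set of strands that is closed under both
    matchings and its complement would split the plat closure into two disjoint closed
    sets, while the image of a connected set is connected. *)
Lemma connected_strands (K : set E3) (S : pred nat) i0 :
  knot K -> ambient_isotopic K (plat_closure b w) ->
  (forall i, (1 <= i <= s)%N -> S i -> S (mate i)) ->
  (forall i, (1 <= i <= s)%N -> S i -> S (top_mate (idx w) i)) ->
  (1 <= i0 <= s)%N -> S i0 -> forall i, (1 <= i <= s)%N -> S i.
Proof.
move=> [gamma [cg _ _ KE]] /isotopicP[H [cH hH _ HK]] S1 S2 i0s Si0 j js.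
apply: contrapT => nSj.
have lohi : lo <= hi.
  by rewrite /lo /hi; have : 0 <= (size w)%:R :> R by []; lra.
pose part (P : pred nat) : set E3 := \bigcup_(i in [set i | (1 <= i <= s)%N && P i]) strand i.
have part_closed P : closed (part P).
  apply: closed_bigcup => [|i _]; last exact: strand_closed.
  apply: (@sub_finite_set _ _ `I_s.+1); last exact: finite_II.
  by move=> i /= /andP[/andP[_ ?] _]; rewrite /= ltnS.
have platE : plat_closure b w = part S `|` part (predC S).
  rewrite plat_closureE // -/s -/lo -/hi -/X -/Y; apply/seteqP; split=> p.
    move=> [i ii [z zz ->]]; have zin : [set` `[lo, hi]] z by rewrite /= in_itv.
    case: (boolP (S i)) => Si; [left|right]; exists i; rewrite /= ?ii //; by exists z.
  by case=> -[i /= /andP[ii _] [z]]; rewrite /= in_itv /= => zz <-; exists i => //; exists z.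
have disj p : part S p -> part (predC S) p -> False.
  move=> [i /= /andP[ii Si] ip] [k /= /andP[kk /negP nSk] kp].
  apply: nSk; case: (strands_meet ii kk ip kp) => [<-|->|->]; [by []|exact: S1|exact: S2].
have conn : connected (plat_closure b w : set E3).
  rewrite -HK; apply: connected_continuous_connected.
    by rewrite KE; apply: connected_continuous_connected => //; exact: segment_connected.
  by apply: continuous_subspaceT; case: (hH 1).
have strand0 i : strand i (X i lo, Y i lo, lo).
  by exists lo => //; rewrite /= in_itv /= lexx lohi.
have AE : part S = plat_closure b w.
  apply: conn.
  - by exists (X i0 lo, Y i0 lo, lo); exists i0 => //=; rewrite i0s.
  - exists (~` part (predC S)); first by rewrite openC.
    rewrite platE; apply/seteqP; split=> p; first by move=> pS; split; [left|move/(disj _ pS)].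
    by move=> [[]].
  - exists (part S) => //; rewrite platE; apply/seteqP; split=> p; first by move=> ?; split=> //; left.
    by case.
apply: (disj (X j lo, Y j lo, lo)); last by exists j => //=; rewrite js; apply/negP.
by rewrite AE platE; right; exists j => //=; rewrite js; apply/negP.
Qed.

End Connected.

Local Close Scope ring_scope.
Local Close Scope classical_set_scope.

(** * Crossings in a sequence of positions *)

Definition meets (j a c : nat) : bool :=
  ((a == j) && (c == j.+1)) || ((c == j) && (a == j.+1)).

Fixpoint nocross (a c : nat) (js : seq nat) : bool :=
  if js is j :: js' then ~~ meets j a c && nocross (transp j a) (transp j c) js' else true.

Lemma meets_sym j a c : meets j a c = meets j c a.
Proof. by rewrite /meets orbC. Qed.

Lemma nocross_sym a c js : nocross a c js = nocross c a js.
Proof. by elim: js a c => //= j js IH a c; rewrite meets_sym IH. Qed.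

Lemma nocross_cat a c js ks :
  nocross a c (js ++ ks) = nocross a c js && nocross (pos js a) (pos js c) ks.
Proof. by elim: js a c => //= j js IH a c; rewrite IH andbA. Qed.

Lemma meets_transp j a c : meets j (transp j a) (transp j c) = meets j a c.
Proof.
have E x : (transp j x == j) = (x == j.+1).
  by rewrite -[in RHS](inj_eq (@transp_inj j)) transp_hi.
have F x : (transp j x == j.+1) = (x == j).
  by rewrite -[in RHS](inj_eq (@transp_inj j)) transp_lo.
by rewrite /meets !E !F orbC andbC [X in _ || X]andbC.
Qed.

Lemma nocross_rev a c js : nocross a c js -> nocross (pos js a) (pos js c) (rev js).
Proof.
elim: js a c => //= j js IH a c /andP[m n].
by rewrite rev_cons -cats1 nocross_cat IH //= !posK meets_transp m.
Qed.

Lemma transp_meets j a c : meets j a c -> transp j a = c /\ transp j c = a.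
Proof. by case/orP=> /andP[/eqP -> /eqP ->]; rewrite transp_lo transp_hi. Qed.

Lemma transp_ltn j a c : a != c -> ~~ meets j a c -> (transp j a < transp j c) = (a < c).
Proof.
rewrite /meets /transp => /eqP ac.
by case: (a =P j); case: (a =P j.+1); case: (c =P j); case: (c =P j.+1) => //=; lia.
Qed.

Lemma nocross_ltn a c js : a != c -> nocross a c js -> (pos js a < pos js c) = (a < c).
Proof.
elim: js a c => //= j js IH a c ac /andP[m n].
by rewrite IH ?transp_ltn // (inj_eq (@transp_inj j)).
Qed.

Lemma transp_pos j k js : meets k (pos js j) (pos js j.+1) ->
  forall y, pos js (transp j y) = transp k (pos js y).
Proof.
move=> m y; have [E1 E2] := transp_meets m; rewrite {1}/transp.
case: eqP => [->|y1]; first by rewrite E1.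
case: eqP => [->|y2]; first by rewrite E2.
have /negbTE n1 : pos js y != pos js j by rewrite (inj_eq (@pos_inj js)); apply/eqP.
have /negbTE n2 : pos js y != pos js j.+1 by rewrite (inj_eq (@pos_inj js)); apply/eqP.
case/orP: m => /andP[/eqP e1 /eqP e2]; first by rewrite /transp -e2 -e1 n1 n2.
by rewrite /transp -e2 -e1 n1 n2.
Qed.

Lemma meets_swap j a c k js : meets j a c -> meets k (pos js a) (pos js c) ->
  meets k (pos js j) (pos js j.+1).
Proof. by case/orP=> /andP[/eqP -> /eqP ->] //; rewrite meets_sym. Qed.

Lemma first_crossing a c js : ~~ nocross a c js ->
  exists u i v, [/\ js = u ++ i :: v, nocross a c u & meets i (pos u a) (pos u c)].
Proof.
elim: js a c => //= j js IH a c; rewrite negb_and negbK.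
have [m _|m /= /IH[u [i [v [-> n x]]]]] := boolP (meets j a c); first by exists [::], j, js.
by exists (j :: u), i, v; split=> //=; rewrite m.
Qed.

(** Two crossings of the same strands can be deleted together without changing the
    permutation, as the two strands just exchange their roles in between. *)
Lemma cross_once s a c js : valid s js -> a != c ->
  exists2 ks, valid s ks /\ pos ks =1 pos js &
    nocross a c ks \/
    exists u i v, [/\ ks = u ++ i :: v, nocross a c u, meets i (pos u a) (pos u c)
      & nocross (transp i (pos u a)) (transp i (pos u c)) v].
Proof.
elim/last_ind: js => [|js j IH] vj ac; first by exists [::]; [|left].
move: vj; rewrite -cats1 valid_cat => /andP[vjs vj].
have [ks [vks E] H] := IH vjs ac.
have V : valid s (ks ++ [:: j]) by rewrite valid_cat vks.
have EE : pos (ks ++ [:: j]) =1 pos (js ++ [:: j]) by move=> x; rewrite !pos_cat E.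
case: H => [n|[u [i [v [Ek n m n2]]]]].
  exists (ks ++ [:: j]) => //.
  have [mj|mj] := boolP (meets j (pos ks a) (pos ks c)).
    by right; exists ks, j, [::].
  by left; rewrite nocross_cat n /= mj.
have [mj|mj] := boolP (meets j (pos ks a) (pos ks c)); last first.
  exists (ks ++ [:: j]) => //; right; exists u, i, (v ++ [:: j]); split=> //.
    by rewrite Ek -catA.
  rewrite nocross_cat n2 /= andbT.
  by move: mj; rewrite Ek pos_cat pos_cons [in X in meets _ _ X]pos_cat pos_cons.
have [E1 E2] := transp_meets m.
exists (u ++ v).
  split; first by move: vks; rewrite Ek !valid_cat /= => /and3P[-> _ ->].
  move=> x; rewrite -EE Ek !pos_cat pos_cons /=.
  rewrite (@transp_pos _ j) ?transpK // (meets_swap m) // meets_sym -{1}E1 -{2}E2.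
  by move: mj; rewrite Ek !pos_cat !pos_cons.
by left; rewrite nocross_cat n /= -E2 -{2}E1 nocross_sym E1 E2 -{1}E2 -{1}E1.
Qed.

(** * Layered words *)

Fixpoint layered_word (d : nat -> nat) (js : seq nat) : seq letter :=
  if js is j :: js' then (j, d j.+1 < d j) :: layered_word (d \o transp j) js' else [::].

Lemma layered_word_layered d js : layered d (layered_word d js).
Proof. by elim: js d => //= j js IH d; rewrite eqxx IH. Qed.

Lemma idx_layered_word d js : idx (layered_word d js) = js.
Proof. by elim: js d => //= j js IH d; rewrite [idx _]IH. Qed.

Lemma eq_layered_word d d' js : d =1 d' -> layered_word d js = layered_word d' js.
Proof.
elim: js d d' => //= j js IH d d' E; rewrite !E; congr (_ :: _).
by apply: IH => x /=.
Qed.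

Lemma layered_word_cat d js ks : layered_word d (js ++ ks) = layered_word d js ++ layered_word (d \o pos (rev js)) ks.
Proof.
elim: js d => [|j js IH] d //=; congr (_ :: _); rewrite IH; congr (_ ++ _).
by apply: eq_layered_word => x /=; rewrite rev_cons pos_rcons.
Qed.

Lemma winv_layered_word d js : injective d -> winv (layered_word d js) = layered_word (d \o pos (rev js)) (rev js).
Proof.
elim: js d => //= j js IH d di.
rewrite -cat1s winv_cat IH; last by move=> x y /= /di /transp_inj.
rewrite rev_cons -cats1 layered_word_cat; congr (_ ++ _).
  by apply: eq_layered_word => x /=; rewrite pos_cat.
rewrite /= revK /winv /= /rev /= /flip /=; congr [:: (_, _)].
rewrite !pos_cat !posK /= transp_lo transp_hi -leqNgt leq_eqVlt.
by case: eqP => // /di; lia.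
Qed.

Definition agree (a c : nat) (d d' : nat -> nat) : Prop :=
  forall x y, ~~ ((x == a) && (y == c) || (x == c) && (y == a)) ->
    (d x < d y) = (d' x < d' y).

Lemma agree_transp a c d d' j : agree a c d d' -> agree (transp j a) (transp j c) (d \o transp j) (d' \o transp j).
Proof.
move=> H x y xy /=; apply: H; apply: contra xy.
by case/orP=> /andP[/eqP <- /eqP <-]; rewrite !transpK !eqxx ?orbT.
Qed.

Lemma agree_pos a c d d' js : agree a c d d' ->
  agree (pos js a) (pos js c) (d \o pos (rev js)) (d' \o pos (rev js)).
Proof.
move=> H x y xy /=; apply: H; apply: contra xy.
by case/orP=> /andP[/eqP <- /eqP <-]; rewrite !pos_revK !eqxx ?orbT.
Qed.

Lemma layered_word_nocross a c d d' js : agree a c d d' -> nocross a c js -> layered_word d js = layered_word d' js.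
Proof.
elim: js a c d d' => //= j js IH a c d d' H /andP[m n].
rewrite (IH _ _ _ (d' \o transp j) _ n); last exact: agree_transp.
congr ((_, _) :: _); apply: H; apply: contra m; rewrite /meets orbC.
by case/orP=> /andP[/eqP <- /eqP <-]; rewrite !eqxx ?orbT.
Qed.

(** Exchanging the consecutive depths [k] and [k.+1] only affects the strands that have
    them. *)
Lemma agree_depth d k a c : injective d -> d a = k -> d c = k.+1 -> agree a c d (transp k \o d).
Proof.
move=> di da dc x y xy /=.
have [->|xy'] := eqVneq x y; first by rewrite !ltnn.
rewrite transp_ltn ?(inj_eq di) //; apply: contra xy.
by rewrite /meets -dc -da !(inj_eq di); case/orP=> /andP[-> ->]; rewrite ?orbT.
Qed.

(** * Words that represent the same braid *)

Lemma pos_out s js i : valid s js -> ~~ (1 <= i <= s) -> pos js i = i.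
Proof.
elim: js i => //= j js IH i /andP[vj vjs] ii.
have -> : transp j i = i by rewrite /transp; case: eqP => [?|_]; [lia|case: eqP => ?; lia].
exact: IH.
Qed.

Section Words.
Variables (R : realType) (b : nat).
Let s := (2 * b)%N.

Definition plat_equiv (v w : seq letter) : Prop :=
  ambient_isotopic (@plat_closure R b v) (plat_closure b w).

(** Rather than by braid relations, equality of braids is replaced by its consequence for
    plat closures: the words can be exchanged inside any word. *)
Definition exchangeable (v w : seq letter) : Prop :=
  forall x y, valid s (idx x) -> valid s (idx y) ->
    plat_equiv (x ++ v ++ y) (x ++ w ++ y).

Local Notation "v ~~ w" := (exchangeable v w) (at level 70).
Local Notation vw w := (valid s (idx w)).

Lemma exchangeable_refl v : v ~~ v.
Proof. by move=> x y _ _; exact: isotopic_refl. Qed.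

Lemma exchangeable_sym v w : v ~~ w -> w ~~ v.
Proof. by move=> H x y vx vy; apply: isotopic_sym; exact: H. Qed.

Lemma exchangeable_trans u v w : u ~~ v -> v ~~ w -> u ~~ w.
Proof. by move=> H1 H2 x y vx vy; apply: isotopic_trans (H1 x y vx vy) (H2 x y vx vy). Qed.

Lemma exchangeable_catl x v w : vw x -> v ~~ w -> x ++ v ~~ x ++ w.
Proof.
move=> vx H x' y' vx' vy'; rewrite -!catA !(catA x').
by apply: H; rewrite // idx_cat valid_cat vx'.
Qed.

Lemma exchangeable_catr y v w : vw y -> v ~~ w -> v ++ y ~~ w ++ y.
Proof.
move=> vy H x' y' vx' vy'; rewrite -!catA.
by apply: H; rewrite // idx_cat valid_cat vy.
Qed.

Lemma exchangeable_plat v w : v ~~ w -> plat_equiv v w.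
Proof. by move=> /(_ [::] [::] isT isT); rewrite /= !cats0. Qed.

(** The moves of roomy plat closures, in terms of plat closures. *)
Lemma layered_pure d u : injective d -> layered d u -> vw u ->
  (forall i, 1 <= i <= s -> pos (idx u) i = i) -> u ~~ [::].
Proof.
move=> di lu vu pu x y vx vy; case: (posnP (size u)) => [/size0nil ->|u0].
  exact: isotopic_refl.
have vxy : vw (x ++ y) by rewrite idx_cat valid_cat vx.
have vxuy : vw (x ++ u ++ y) by rewrite !idx_cat !valid_cat vx vu.
apply: isotopic_trans (isotopic_roomy R (proj2 (braid_wordP _ _) vxuy)) _.
apply: isotopic_trans (isotopic_sym (isotopic_roomy R (proj2 (braid_wordP _ _) vxy))).
exact: (delete_pure_word vx di lu u0 erefl erefl erefl erefl pu).
Qed.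

Lemma slide_caps u w d : injective d -> layered d u -> vw u -> vw w ->
  (forall i, 1 <= i <= s -> pos (idx u) (mate i) = mate (pos (idx u) i)) ->
  (forall i, 1 <= i <= s -> d (mate i) = (d i).+1 \/ d i = (d (mate i)).+1) ->
  plat_equiv (w ++ u) w.
Proof.
move=> di lu vu vow um dm; case: (posnP (size u)) => [/size0nil ->|u0].
  by rewrite cats0; exact: isotopic_refl.
have vwu : vw (w ++ u) by rewrite idx_cat valid_cat vow.
apply: isotopic_trans (isotopic_roomy R (proj2 (braid_wordP _ _) vwu)) _.
apply: isotopic_trans (isotopic_sym (isotopic_roomy R (proj2 (braid_wordP _ _) vow))).
have := slide_over_caps (w2 := [::]) vow vu di lu u0 erefl erefl erefl erefl erefl um dm.
by rewrite cats0.
Qed.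

Lemma vw_layered_word d js : vw (layered_word d js) = valid s js.
Proof. by rewrite idx_layered_word. Qed.

Lemma vw_winv w : vw (winv w) = vw w.
Proof. by rewrite idx_winv valid_rev. Qed.

Lemma layered_word_pure d js : injective d -> valid s js -> pos js =1 id -> layered_word d js ~~ [::].
Proof.
move=> di vj pj; apply: (layered_pure di (layered_word_layered d js)); rewrite idx_layered_word //.
Qed.

Lemma winv_layered_word_cat d js ks : injective d ->
  winv (layered_word d js) ++ layered_word d ks = layered_word (d \o pos (rev js)) (rev js ++ ks).
Proof.
move=> di; rewrite winv_layered_word // layered_word_cat; congr (_ ++ _).
by apply: eq_layered_word => x /=; rewrite revK posK.
Qed.

Lemma winv_cancel w : vw w -> winv w ++ w ~~ [::].
Proof.
elim: w => [_|l w IH]; first exact: exchangeable_refl.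
move=> /andP[vl vww]; rewrite -cat1s winv_cat -catA (catA (winv [:: l])).
apply: exchangeable_trans (IH vww); apply: exchangeable_catl; first by rewrite vw_winv.
rewrite -[X in _ ~~ X]cat0s; apply: exchangeable_catr => //.
pose d := if l.2 then id else transp l.1.
have di : injective d by rewrite /d; case: l.2 => //; exact: transp_inj.
have -> : winv [:: l] ++ [:: l] = layered_word d [:: l.1; l.1].
  rewrite /winv /= /rev /= /flip /d; case: l {vl d di} => j e /=.
  by case: e; rewrite /= ?transpK ?transp_lo ?transp_hi; congr [:: (_, _); (_, _)]; lia.
apply: layered_word_pure => //; first by rewrite /= vl.
by move=> x /=; rewrite transpK.
Qed.

Lemma cancel_winv w : vw w -> w ++ winv w ~~ [::].
Proof. by move=> v; rewrite -{1}(winvK w); apply: winv_cancel; rewrite vw_winv. Qed.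

(** A layered word represents a braid that depends on the permutation and on the depths
    only: the quotient of two such words is a pure layered word. *)
Lemma layered_word_perm d js ks : injective d -> valid s js -> valid s ks ->
  pos js =1 pos ks -> layered_word d js ~~ layered_word d ks.
Proof.
move=> di vj vk E.
have H : layered_word d js ++ (winv (layered_word d ks) ++ layered_word d ks) ~~ layered_word d js.
  rewrite -[X in _ ~~ X]cats0; apply: exchangeable_catl; rewrite ?vw_layered_word //.
  by apply: winv_cancel; rewrite vw_layered_word.
apply: exchangeable_trans (exchangeable_sym H) _; rewrite catA -[X in _ ~~ X]cat0s.
apply: exchangeable_catr; rewrite ?vw_layered_word // winv_layered_word //.
have -> : layered_word (d \o pos (rev ks)) (rev ks) = layered_word (d \o pos (rev js)) (rev ks).
  apply: eq_layered_word => x /=; congr d; apply: (@pos_inj js).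
  by rewrite pos_revK E pos_revK.
rewrite -layered_word_cat; apply: layered_word_pure => //; first by rewrite valid_cat valid_rev vj.
by move=> x; rewrite pos_cat E posK.
Qed.

(** ** Changing depths *)

Variable rho : seq nat.
Hypotheses (vrho : valid s rho) (rho_id : pos rho =1 id)
  (rho_cross : forall a c, 1 <= a <= s -> 1 <= c <= s -> a != c -> ~~ nocross a c rho).

(** Exchanging the consecutive depths of two strands [a] and [c] changes the braid by a
    word over [rho]: if they cross, the two braids differ by a full twist of [a] and [c],
    and no strand has a depth between them, so the full twist can be slid along both
    strands, past all others, to the first crossing of [a] and [c] in [rho]. *)
Lemma swap_depths d k a c js : injective d -> valid s js ->
  1 <= a <= s -> 1 <= c <= s -> d a = k -> d c = k.+1 ->
  exists r, (idx r = [::] \/ idx r = rho) /\ layered_word d js ~~ r ++ layered_word (transp k \o d) js.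
Proof.
move=> di vjs a1 c1 da dc; set d' := transp k \o d.
have di' : injective d' by move=> x y /= /transp_inj /di.
have ac : a != c by apply/eqP => E; move: da; rewrite E dc; lia.
have ag : agree a c d d' by exact: agree_depth.
have [ks [vks E] H] := cross_once vjs ac.
have Hd e : injective e -> layered_word e js ~~ layered_word e ks by move=> ei; apply: layered_word_perm => // x; rewrite E.
case: H => [n|[u [i [v [Ek nu mu nv]]]]].
  exists [::]; split; first by left.
  apply: exchangeable_trans (Hd _ di) _; rewrite (layered_word_nocross ag n) cat0s.
  exact: exchangeable_sym (Hd _ di').
have [u0 [i0 [v0 [Er nu0 mu0]]]] := first_crossing (rho_cross a1 c1 ac).
(* Up to their first crossing [a] and [c] keep their order, so the two crossings have the
   same sign. *)
have sgn (f : nat -> nat) : (f (pos (rev u) i.+1) < f (pos (rev u) i)) =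
    (f (pos (rev u0) i0.+1) < f (pos (rev u0) i0)).
  have h1 := nocross_ltn ac nu; have h2 := nocross_ltn ac nu0.
  case/orP: mu mu0 => /andP[/eqP p1 /eqP p2]; case/orP=> /andP[/eqP q1 /eqP q2].
  - by rewrite -{1}p2 -{1}p1 -q2 -q1 !posK.
  - by move: h1 h2; rewrite p1 p2 q1 q2; lia.
  - by move: h1 h2; rewrite p1 p2 q1 q2; lia.
  - by rewrite -{1}p2 -{1}p1 -q2 -q1 !posK.
pose D f := f \o pos (rev u) : nat -> nat.
pose D0 f := f \o pos (rev u0) : nat -> nat.
pose e := D d i.+1 < D d i.
have e0 : D0 d i0.+1 < D0 d i0 = e by rewrite /e /D0 /D /= sgn.
have e' : D d' i.+1 < D d' i = ~~ e.
  rewrite /e /D /d' /=; case/orP: mu => /andP[/eqP <- /eqP <-]; rewrite !posK da dc transp_lo transp_hi; lia.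
have e0' : D0 d' i0.+1 < D0 d' i0 = ~~ e by rewrite -e' /D0 /D /= sgn.
have vuv : [/\ valid s u, 0 < i < s & valid s v].
  by move: vks; rewrite Ek valid_cat /= => /and3P[].
have vuv0 : [/\ valid s u0, 0 < i0 < s & valid s v0].
  by move: vrho; rewrite Er valid_cat /= => /and3P[].
case: vuv => vu vi vv; case: vuv0 => vu0 vi0 vv0.
pose U := layered_word d u; pose U0 := layered_word d u0.
pose V := layered_word (D d' \o transp i) v; pose V0 := layered_word (D0 d' \o transp i0) v0.
have ksE : layered_word d ks = U ++ (i, e) :: V.
  rewrite Ek layered_word_cat /=; congr (_ ++ _ :: _).
  by apply: (layered_word_nocross _ nv); apply: agree_transp; exact: agree_pos.
have ksE' : layered_word d' ks = U ++ (i, ~~ e) :: V.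
  by rewrite Ek layered_word_cat /= -/(D d') e' -(layered_word_nocross ag nu).
have rhoE' : layered_word d' rho = U0 ++ (i0, ~~ e) :: V0.
  by rewrite Er layered_word_cat /= -/(D0 d') e0' -(layered_word_nocross ag nu0).
have vU : vw U by rewrite vw_layered_word.
have vU0 : vw U0 by rewrite vw_layered_word.
have vV : vw V by rewrite vw_layered_word.
have vV0 : vw V0 by rewrite vw_layered_word.
have vx f : vw [:: (i, f)] by rewrite /= vi.
have vx0 f : vw [:: (i0, f)] by rewrite /= vi0.
pose r := U0 ++ (i0, e) :: V0.
have hV0 : V0 ~~ (i0, e) :: winv U0.
  have h1 : winv (U0 ++ [:: (i0, ~~ e)]) ++ (U0 ++ [:: (i0, ~~ e)]) ++ V0 ~~ V0.
    rewrite catA -[X in _ ~~ X]cat0s; apply: exchangeable_catr => //; apply: winv_cancel.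
    by rewrite idx_cat valid_cat vU0 vx0.
  apply: exchangeable_trans (exchangeable_sym h1) _.
  have -> : (i0, e) :: winv U0 = winv (U0 ++ [:: (i0, ~~ e)]) ++ [::].
    by rewrite cats0 winv_cat /winv /= /rev /= /flip /= negbK.
  apply: exchangeable_catl; first by rewrite vw_winv idx_cat valid_cat vU0 vx0.
  by rewrite -catA /= -rhoE'; apply: layered_word_pure.
(* Follow the strands from their first crossing in [rho] to their crossing in [ks]; on the
   way they do not cross, so the word [winv U0 ++ U] has the same letters when their
   depths are exchanged. *)
pose c' := rev u0 ++ u.
have vc' : valid s c' by rewrite valid_cat valid_rev vu0.
have CE : winv U0 ++ U = layered_word (D0 d) c' by rewrite winv_layered_word_cat.
have mc : meets i (pos c' i0) (pos c' i0.+1).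
  apply: (meets_swap (j := i0) mu0); rewrite !pos_cat !posK; exact: mu.
have hC : [:: (i0, e)] ++ (winv U0 ++ U) ~~ (winv U0 ++ U) ++ [:: (i, e)].
  have -> : (winv U0 ++ U) ++ [:: (i, e)] = layered_word (D0 d) (c' ++ [:: i]).
    rewrite CE layered_word_cat /=; congr (_ ++ [:: (_, _)]).
    by rewrite /e /D /D0 /= rev_cat revK !pos_cat !posK.
  have -> : [:: (i0, e)] ++ (winv U0 ++ U) = layered_word (D0 d) (i0 :: c').
    rewrite CE /= e0; congr (_ :: _).
    have ag0 : agree (pos u0 a) (pos u0 c) (D0 d) (D0 d \o transp i0).
      have [m1 m2] := transp_meets mu0.
      move=> x y xy; rewrite (agree_pos ag xy) /=.
      have sE z : d (pos (rev u0) (transp i0 z)) = transp k (d (pos (rev u0) z)).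
        rewrite /transp; case: eqP => [->|z1].
          case/orP: mu0 => /andP[/eqP p1 /eqP p2].
            by rewrite -p2 -p1 !posK da dc eqxx.
          by rewrite -p2 -p1 !posK da dc eqxx; case: eqP => //; lia.
        case: eqP => [->|z2].
          case/orP: mu0 => /andP[/eqP p1 /eqP p2].
            by rewrite -p2 -p1 !posK da dc eqxx; case: eqP => //; lia.
          by rewrite -p2 -p1 !posK da dc eqxx.
        have n1' : d (pos (rev u0) z) != k.
          rewrite -da (inj_eq di) -(inj_eq (@pos_inj u0)) pos_revK.
          by case/orP: mu0 => /andP[/eqP p1 /eqP p2]; rewrite ?p1 ?p2; apply/eqP.
        have n2' : d (pos (rev u0) z) != k.+1.
          rewrite -dc (inj_eq di) -(inj_eq (@pos_inj u0)) pos_revK.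
          by case/orP: mu0 => /andP[/eqP p1 /eqP p2]; rewrite ?p1 ?p2; apply/eqP.
        by rewrite (negbTE n1') (negbTE n2').
      by rewrite /D0 /d' /= !sE.
    apply: (layered_word_nocross ag0); rewrite nocross_cat nocross_rev //= !posK; exact: nu.
  apply: layered_word_perm.
  - by move=> x y /= /di /pos_inj.
  - by rewrite /= vi0.
  - by rewrite valid_cat vc' /= vi.
  by move=> x; rewrite pos_cons pos_cat /= (transp_pos mc).
exists r; split.
  by right; rewrite /r idx_cat /= !idx_layered_word Er.
apply: exchangeable_trans (Hd _ di) _.
apply: exchangeable_trans (exchangeable_sym (exchangeable_catl _ (Hd _ di'))); last first.
  by rewrite /r idx_cat valid_cat vU0 /= vi0 vV0.
rewrite ksE ksE' -[U ++ _ :: _]cat_rcons -cats1 -[U ++ (i, ~~ e) :: V]cat_rcons -cats1 catA.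
apply: exchangeable_catr => //.
have hr : r ~~ U0 ++ [:: (i0, e); (i0, e)] ++ winv U0.
  by apply: exchangeable_catl => //; rewrite -cat1s; exact: (exchangeable_catl (vx0 e) hV0).
(* What carries one crossing to the other also carries its square, the full twist. *)
have hx2 : [:: (i0, e); (i0, e)] ++ winv U0 ++ U ~~ (winv U0 ++ U) ++ [:: (i, e); (i, e)].
  apply: exchangeable_trans (exchangeable_catl (vx0 e) hC) _.
  have -> : [:: (i, e); (i, e)] = [:: (i, e)] ++ [:: (i, e)] by [].
  by rewrite catA (catA _ [:: (i, e)] [:: (i, e)]); apply: (exchangeable_catr (vx e)); exact: hC.
have vUx : vw (U ++ [:: (i, ~~ e)]) by rewrite idx_cat valid_cat vU vx.
apply: exchangeable_trans (exchangeable_sym (exchangeable_catr vUx hr)).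
rewrite -!catA.
have H2 := exchangeable_catr (vx (~~ e)) (exchangeable_catl vU0 hx2).
rewrite -!catA in H2; apply: exchangeable_trans (exchangeable_sym H2).
have H3 : [:: (i, e); (i, e)] ++ [:: (i, ~~ e)] ~~ [:: (i, e)].
  have := exchangeable_catl (vx e) (cancel_winv (vx e)).
  by rewrite /winv /= /rev /= /flip /=.
apply: exchangeable_sym; apply: exchangeable_trans (exchangeable_catl _ (exchangeable_catl _ (exchangeable_catl vU H3))) _ => //.
  by rewrite vw_winv.
by rewrite catA; apply: exchangeable_catr (cancel_winv vU0); rewrite idx_cat valid_cat vU vx.
Qed.

End Words.

(** * Rosettes *)

Definition odds (s : nat) : seq nat := [seq j <- index_iota 1 s | odd j].
Definition evens (s : nat) : seq nat := [seq j <- index_iota 1 s | ~~ odd j].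
Definition row_idx (s : nat) : seq nat := odds s ++ evens s.
Definition rows_idx (s n : nat) : seq nat := flatten (nseq n (row_idx s)).

Lemma mem_odds s j : (j \in odds s) = odd j && (0 < j < s).
Proof. by rewrite mem_filter mem_index_iota. Qed.

Lemma mem_evens s j : (j \in evens s) = ~~ odd j && (0 < j < s).
Proof. by rewrite mem_filter mem_index_iota. Qed.

Lemma valid_odds s : valid s (odds s).
Proof. by apply/allP => j; rewrite mem_odds => /andP[]. Qed.

Lemma valid_evens s : valid s (evens s).
Proof. by apply/allP => j; rewrite mem_evens => /andP[]. Qed.

Lemma uniq_row s : uniq (row_idx s).
Proof.
rewrite cat_uniq !filter_uniq ?iota_uniq // andbT; apply/hasPn => j.
by rewrite mem_evens [j \in _]mem_odds => /andP[/negbTE ->].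
Qed.

Lemma rows_idxS s n : rows_idx s n.+1 = row_idx s ++ rows_idx s n.
Proof. by []. Qed.

Lemma rows_idx_add s m n : rows_idx s (m + n) = rows_idx s m ++ rows_idx s n.
Proof. by rewrite /rows_idx nseqD flatten_cat. Qed.

Lemma rows_idxSr s n : rows_idx s n.+1 = rows_idx s n ++ row_idx s.
Proof. by rewrite -addn1 rows_idx_add /= /rows_idx /= cats0. Qed.

Lemma valid_rows s n : valid s (rows_idx s n).
Proof.
elim: n => // n IH; rewrite rows_idxS valid_cat IH andbT valid_cat.
by rewrite valid_odds valid_evens.
Qed.

(** Crossings at pairwise non-adjacent positions do not interact. *)
Lemma pos_sparse js i : uniq js -> (forall j, j \in js -> j.+1 \notin js) ->
  pos js i = if i \in js then i.+1 else if (0 < i) && (i.-1 \in js) then i.-1 else i.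
Proof.
elim: js i => [|j js IH] i; first by rewrite /= andbF.
move=> /andP[jjs ujs] sp.
have sp' k : k \in js -> k.+1 \notin js.
  by move=> kj; have := sp k; rewrite !inE kj orbT => /(_ isT); rewrite negb_or => /andP[].
have j1 : j.+1 \notin js.
  by have := sp j; rewrite !inE eqxx => /(_ isT); rewrite negb_or => /andP[].
have jm : ~~ ((0 < j) && (j.-1 \in js)).
  apply/negP => /andP[j0 jj]; have := sp j.-1; rewrite inE jj orbT prednK // => /(_ isT).
  by rewrite inE eqxx.
rewrite pos_cons IH // !inE /transp.
have [->|ij] := eqVneq i j.
  by rewrite (negbTE j1) /= (negbTE jjs).
have [->|ij1] := eqVneq i j.+1.
  by rewrite (negbTE jjs) (negbTE jm) /= eqxx (negbTE j1).
by rewrite /=; case: i ij ij1 => //= i ij; rewrite eqSS => /negbTE ->.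
Qed.

Lemma pos_odds b i : 1 <= i <= 2 * b -> pos (odds (2 * b)) i = mate i.
Proof.
move=> ib; rewrite pos_sparse ?filter_uniq ?iota_uniq //; last first.
  by move=> j; rewrite !mem_odds /= => /andP[->].
have := odd_double_half i; rewrite !mem_odds /mate.
case: i ib => // i ib /=; case: (odd i) => /= hi; last by rewrite ifT //; lia.
by case: ifP => //; lia.
Qed.

Lemma pos_evens b i : 1 <= i <= 2 * b -> pos (evens (2 * b)) i =
  if odd i then if i == 1 then 1 else i.-1 else if i == 2 * b then i else i.+1.
Proof.
move=> ib; rewrite pos_sparse ?filter_uniq ?iota_uniq //; last first.
  by move=> j; rewrite !mem_evens /= => /andP[/negbTE ->].
have := odd_double_half i; rewrite !mem_evens.
case: i ib => // i ib /=; case: (odd i) => /= hi; rewrite ?andbF //=.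
  by case: ifP; case: eqP => //; lia.
by case: ifP; case: eqP => //; lia.
Qed.

(** The strands bounce between the sides of the rosette like billiard balls, moving two
    positions in each row; after [b] rows their order is reversed. *)
Lemma pos_rows b r i : r <= b -> 1 <= i <= 2 * b ->
  pos (rows_idx (2 * b) r) i =
    if odd i then if i + 2 * r <= 2 * b then i + 2 * r else 4 * b + 1 - i - 2 * r
    else if 2 * r < i then i - 2 * r else 2 * r - i + 1.
Proof.
elim: r => [|r IH] rb ib.
  by rewrite /= muln0 addn0 subn0; case: ifP => _; rewrite ifT //; lia.
rewrite rows_idxSr pos_cat IH //; last exact: ltnW.
set p := (if odd i then _ else _).
have pb : 1 <= p <= 2 * b.
  rewrite /p; case: (odd i); case: ifP; lia.
rewrite pos_cat pos_odds // pos_evens ?mate_range //.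
have := odd_double_half i; rewrite {}/p in pb *; case: (odd i) => hi.
  case: (leqP (i + 2 * r) (2 * b)) => h1.
    have o : odd (i + 2 * r).
      have -> : i + 2 * r = ((i./2 + r).*2).+1 by lia.
      by rewrite /= odd_double.
    rewrite /mate o /= ?o /=; case: eqP => h2; case: ifP => h3; lia.
  have o : odd (4 * b + 1 - i - 2 * r) = false.
    have -> : 4 * b + 1 - i - 2 * r = (2 * b - i./2 - r).*2 by lia.
    exact: odd_double.
  rewrite /mate o; have -> : odd (4 * b + 1 - i - 2 * r).-1.
    have -> : (4 * b + 1 - i - 2 * r).-1 = ((2 * b - i./2 - r).-1.*2).+1 by lia.
    by rewrite /= odd_double.
  case: eqP => h2; case: ifP => h3; lia.
case: (ltnP (2 * r) i) => h1.
  have o : odd (i - 2 * r) = false.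
    have -> : i - 2 * r = (i./2 - r).*2 by lia.
    exact: odd_double.
  rewrite /mate o; have -> : odd (i - 2 * r).-1.
    have -> : (i - 2 * r).-1 = ((i./2 - r).-1.*2).+1 by lia.
    by rewrite /= odd_double.
  case: eqP => h2; case: ifP => h3; lia.
have o : odd (2 * r - i + 1).
  have -> : 2 * r - i + 1 = ((r - i./2).*2).+1 by lia.
  by rewrite /= odd_double.
rewrite /mate o /= ?o /=; case: eqP => h2; case: ifP => h3; lia.
Qed.

Lemma pos_half_turn b i : 1 <= i <= 2 * b -> pos (rows_idx (2 * b) b) i = 2 * b + 1 - i.
Proof. by move=> ib; rewrite pos_rows //; case: (odd i); case: ifP; lia. Qed.

Lemma full_turn_rows b : rows_idx (2 * b) (2 * b) = rows_idx (2 * b) b ++ rows_idx (2 * b) b.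
Proof. by rewrite -rows_idx_add; congr rows_idx; lia. Qed.

Lemma pos_full_turn b : pos (rows_idx (2 * b) (2 * b)) =1 id.
Proof.
move=> i; have [ib|ib] := boolP (1 <= i <= 2 * b); last exact: pos_out (valid_rows _ _) ib.
by rewrite full_turn_rows pos_cat !pos_half_turn //; lia.
Qed.

Lemma full_turn_crosses b a c : 1 <= a <= 2 * b -> 1 <= c <= 2 * b -> a != c ->
  ~~ nocross a c (rows_idx (2 * b) (2 * b)).
Proof.
move=> ab cb ac; rewrite full_turn_rows nocross_cat; apply/negP => /andP[n _].
by have := nocross_ltn ac n; rewrite !pos_half_turn //; lia.
Qed.

(** Each generator occurs once in a row, so its sign can be read off from the word. *)
Lemma idx_row_rosette s w : idx w = row_idx s -> exists eps, w = rosette_row s eps.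
Proof.
move=> Ew; pose eps j := nth true (map snd w) (index j (row_idx s)).
exists eps; rewrite /rosette_row -map_cat -/(odds s) -/(evens s) -/(row_idx s).
have sz : size w = size (row_idx s) by rewrite -Ew size_idx.
apply: (@eq_from_nth _ (0, true)); first by rewrite size_map.
move=> i iw; have ir : i < size (row_idx s) by rewrite -sz.
rewrite (nth_map 0) // /eps index_uniq ?uniq_row //.
by rewrite (nth_map (0, true)) // -{1}Ew (nth_map (0, true)) //; case: nth.
Qed.

Lemma idx_rosette s n w : idx w = rows_idx s n -> rosette_braid s n w.
Proof.
elim: n w => [|n IH] w.
  by case: w => // _; exists (fun _ _ => true).
rewrite rows_idxSr => Ew.
have E1 : idx (take (size (rows_idx s n)) w) = rows_idx s n.
  by rewrite /idx map_take -/(idx w) Ew take_size_cat.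
have E2 : idx (drop (size (rows_idx s n)) w) = row_idx s.
  by rewrite /idx map_drop -/(idx w) Ew drop_size_cat.
have [eps e1] := IH _ E1; have [f e2] := idx_row_rosette E2.
exists (fun i => if i == n.+1 then f else eps i).
rewrite -(cat_take_drop (size (rows_idx s n)) w) e1 e2 /rosette_word.
have -> : index_iota 1 n.+2 = index_iota 1 n.+1 ++ [:: n.+1].
  by rewrite /index_iota !subSS !subn0 -{1}(addn1 n) iotaD add1n.
rewrite map_cat flatten_cat /= eqxx cats0.
congr (flatten _ ++ _); apply/eq_in_map => i; rewrite mem_index_iota => ir.
by rewrite ifF //; lia.
Qed.

(** * Pure braids are rosettes *)

Section PureRosette.
Variables (R : realType) (b : nat).
Let s := 2 * b.
Let rho := rows_idx s s.
Local Notation "v ~~ w" := (exchangeable R b v w) (at level 70).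

Lemma depths_of_swaps ks js k : valid s ks -> valid s js -> 0 < k < s ->
  exists n r, idx r = rows_idx s (s * n) /\
    layered_word (pos ks) js ~~ r ++ layered_word (pos (rcons ks k)) js.
Proof.
move=> vks vjs ks0.
have kr x : 1 <= x <= s -> 1 <= pos (rev ks) x <= s by move=> ?; rewrite pos_range ?valid_rev.
have k1 : 1 <= k <= s by lia.
have k2 : 1 <= k.+1 <= s by lia.
have [r [Er H]] := swap_depths R (valid_rows s s) (@pos_full_turn b)
  (@full_turn_crosses b) (@pos_inj ks) vjs (kr _ k1) (kr _ k2) (pos_revK _ _) (pos_revK _ _).
have E : layered_word (transp k \o pos ks) js = layered_word (pos (rcons ks k)) js.
  by apply: eq_layered_word => x; rewrite pos_rcons.
rewrite -E; case: Er => Er; [exists 0|exists 1]; exists r; split=> //.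
  by rewrite muln0.
by rewrite muln1.
Qed.

(** Any two orders of depths are related by exchanges of consecutive depths, here the letters
    of [rev ks ++ ls]. *)
Lemma change_depths ks ls js : valid s ks -> valid s ls -> valid s js ->
  exists n r, idx r = rows_idx s (s * n) /\ layered_word (pos ks) js ~~ r ++ layered_word (pos ls) js.
Proof.
move=> vks vls vjs.
have H ms : valid s ms -> exists n r, idx r = rows_idx s (s * n) /\
    layered_word (pos ks) js ~~ r ++ layered_word (pos (ks ++ ms)) js.
  elim/last_ind: ms => [|ms k IH].
    by move=> _; exists 0, [::]; rewrite muln0 cats0; split=> //; exact: exchangeable_refl.
  rewrite -cats1 valid_cat => /andP[vms /=]; rewrite andbT => vk.
  have [n [r [Er Hr]]] := IH vms.
  have vkms : valid s (ks ++ ms) by rewrite valid_cat vks.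
  have [n' [r' [Er' Hr']]] := depths_of_swaps vkms vjs vk.
  exists (n + n'), (r ++ r'); rewrite idx_cat Er Er' mulnDr rows_idx_add; split=> //.
  apply: exchangeable_trans Hr _; rewrite -catA catA cats1 -rcons_cat.
  by rewrite -catA; apply: exchangeable_catl => //; rewrite Er valid_rows.
have [|n [r [Er Hr]]] := H (rev ks ++ ls); first by rewrite valid_cat valid_rev vks.
have E : pos (ks ++ rev ks ++ ls) =1 pos ls by move=> x; rewrite !pos_cat posK.
by exists n, r; split=> //; rewrite -(eq_layered_word _ E).
Qed.

(** If the sign of the next letter does not fit the depths, change them before the letter
    and back after it. Exchanging the depths of the two strands that cross makes
    the sign fit. *)
Lemma word_rosette ks w : valid s ks -> valid s (idx w) ->
  exists n r, idx r = rows_idx s (s * n) /\ w ~~ r ++ layered_word (pos ks) (idx w).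
Proof.
move=> + ; elim/last_ind: w ks => [|w [j e] IH] ks vks.
  by move=> _; exists 0, [::]; rewrite muln0; split=> //; exact: exchangeable_refl.
rewrite -cats1 idx_cat valid_cat => /andP[vw vj].
pose D ls := pos ls \o pos (rev (idx w)).
have [ls vls Els] : exists2 ls, valid s ls & (D ls j.+1 < D ls j) = e.
  have [E|E] := eqVneq (D ks j.+1 < D ks j) e; first by exists ks.
  exists (idx w ++ [:: j] ++ rev (idx w) ++ ks).
    by rewrite !valid_cat valid_rev vw vks; move: vj => /= ->.
  rewrite /D /= !pos_cat !pos_revK /= !pos_cat transp_lo transp_hi.
  have jj : D ks j != D ks j.+1 by apply/eqP => /pos_inj /pos_inj; lia.
  by move: E jj; rewrite /D /=; clear vj; case: e; case: ltngtP.
have [n [r [Er Hr]]] := IH ls vls vw.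
have vwj : valid s (idx w ++ [:: j]) by rewrite valid_cat vw.
have [n' [r' [Er' Hr']]] := change_depths vls vks vwj.
exists (n + n'), (r ++ r'); rewrite idx_cat Er Er' mulnDr rows_idx_add; split=> //.
apply: exchangeable_trans (exchangeable_catr _ Hr) _; first by [].
rewrite -!catA; apply: exchangeable_catl; first by rewrite Er valid_rows.
apply: exchangeable_trans Hr'; rewrite layered_word_cat /=.
rewrite -/(D ls) (_ : (pos ls (pos _ j.+1) < _) = e) //.
exact: exchangeable_refl.
Qed.

(** The additional full turn, a trivial braid, only serves to make [n] positive. *)
Lemma pure_rosette w : valid s (idx w) -> (forall i, 1 <= i <= s -> pos (idx w) i = i) ->
  exists n r, [/\ 0 < n, rosette_braid s (s * n) r & w ~~ r].
Proof.
move=> vw pw; have [n [r [Er Hr]]] := word_rosette (ks := [::]) isT vw.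
exists n.+1, (r ++ layered_word (pos [::]) rho); split=> //.
  apply: idx_rosette; rewrite idx_cat idx_layered_word Er -rows_idx_add; congr rows_idx; lia.
have vr : valid s (idx r) by rewrite Er valid_rows.
apply: exchangeable_trans Hr _; apply: exchangeable_catl => //.
have pw' : pos (idx w) =1 id.
  move=> i; have [ib|ib] := boolP (1 <= i <= s); first exact: pw.
  exact: pos_out vw ib.
apply: exchangeable_trans (layered_word_pure R (@pos_inj [::]) vw pw') _; apply: exchangeable_sym.
exact: (layered_word_pure R (@pos_inj [::]) (valid_rows _ _) (@pos_full_turn b)).
Qed.

End PureRosette.

(** * Realizing permutations *)

Lemma pos_push q n : pos (iota q n) q = q + n.
Proof. by elim: n q => [|n IH] q /=; [rewrite addn0|rewrite transp_lo IH addnS]. Qed.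

(** Bring the strand [s.+1] to its place last, moving the strands in between by one. *)
Lemma realize_perm s (h : nat -> nat) :
  (forall i, 1 <= i <= s -> 1 <= h i <= s) ->
  (forall i j, 1 <= i <= s -> 1 <= j <= s -> h i = h j -> i = j) ->
  exists2 js, valid s js & forall i, 1 <= i <= s -> pos js i = h i.
Proof.
elim: s h => [|s IH] h hr hi; first by exists [::] => //; lia.
pose q := h s.+1; have qs : 1 <= q <= s.+1 by apply: hr; lia.
pose B := iota q (s.+1 - q).
have vB : valid s.+1 B by apply/allP => j; rewrite mem_iota; lia.
have Bq : pos B q = s.+1 by rewrite pos_push; lia.
have [i ii|i j ii jj E|js vjs H] := IH (fun i => pos B (h i)).
- have : 1 <= pos B (h i) <= s.+1 by rewrite pos_range // hr //; lia.
  have : pos B (h i) <> s.+1.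
    rewrite -Bq => /pos_inj E; have : i = s.+1 by apply: hi E; lia.
    lia.
  lia.
- by apply: hi; try lia; exact: pos_inj E.
exists (js ++ rev B).
  rewrite valid_cat valid_rev vB andbT; apply: sub_all vjs => j; lia.
move=> i ii; rewrite pos_cat; have [->|ne] := eqVneq i s.+1.
  by rewrite (pos_out vjs); [rewrite -{1}Bq posK|lia].
by rewrite H ?posK //; lia.
Qed.

(** * Matchings *)

(** Walking along the plat closure, [mu] goes through the bottom caps and [nu] goes up a
    strand, through a top cap and down again. If the strands form a single component, then the
    walk from strand 1 passes every bottom cap exactly once before it returns. *)
Section Walk.
Variables (s : nat) (mu nu : nat -> nat).
Hypotheses (mu_r : forall i, 1 <= i <= s -> 1 <= mu i <= s)
  (nu_r : forall i, 1 <= i <= s -> 1 <= nu i <= s)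
  (muK : forall i, 1 <= i <= s -> mu (mu i) = i)
  (nuK : forall i, 1 <= i <= s -> nu (nu i) = i)
  (mu_ne : forall i, 1 <= i <= s -> mu i != i)
  (nu_ne : forall i, 1 <= i <= s -> nu i != i)
  (s_gt0 : 0 < s)
  (conn : forall S : pred nat, (forall i, 1 <= i <= s -> S i -> S (mu i)) ->
    (forall i, 1 <= i <= s -> S i -> S (nu i)) -> S 1 -> forall i, 1 <= i <= s -> S i).

Let x k := iter k (nu \o mu) 1.
Let xs n := map x (iota 0 n).
Let ends n := xs n ++ map mu (xs n).

Let x_r k : 1 <= x k <= s.
Proof. by elim: k => [|k IH] /=; [lia|exact: nu_r (mu_r IH)]. Qed.

Let xsS n : xs n.+1 = rcons (xs n) (x n).
Proof. by rewrite /xs -addn1 iotaD map_cat cats1. Qed.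

Let mem_xs n y : reflect (exists2 k, k < n & y = x k) (y \in xs n).
Proof.
apply: (iffP mapP) => [[k]|[k kn ->]]; first by rewrite mem_iota add0n => /andP[_ ?] ->; exists k.
by exists k; rewrite // mem_iota.
Qed.

Let uniq_xs n : uniq (ends n) -> uniq (xs n). Proof. by rewrite cat_uniq => /andP[]. Qed.

Let x_inj n j k : uniq (ends n) -> j < n -> k < n -> x j = x k -> j = k.
Proof.
move=> /uniq_xs u jn kn E; apply/eqP.
rewrite -(nth_uniq 0 (s := xs n)) ?size_map ?size_iota // !(nth_map 0) ?size_iota //.
by rewrite !nth_iota // !add0n E.
Qed.

Let x_mu_ne n j k : uniq (ends n) -> j < n -> k < n -> x j <> mu (x k).
Proof.
rewrite cat_uniq => /and3P[_ /hasPn H _] jn kn E.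
have : mu (x k) \in map mu (xs n) by apply: map_f; apply/mem_xs; exists k.
by move=> /H /mem_xs; apply; exists j.
Qed.

(* The walk can only close up at its starting point. *)
Let walk_closes n : 0 < n -> uniq (ends n) -> ~~ uniq (ends n.+1) -> x n = 1.
Proof.
case: n => // n _ u nu1.
have : x n.+1 \in ends n.+1.
  apply: contraNT nu1 => nx.
  have E : perm_eq (ends n.+2) (x n.+1 :: mu (x n.+1) :: ends n.+1).
    rewrite /ends (xsS n.+1) map_rcons -!cats1.
    move: (xs n.+1) => l; apply/permP => P.
    by rewrite !count_cat /= !count_cat; lia.
  rewrite (perm_uniq E) 2!cons_uniq u andbT in_cons negb_or nx andbT eq_sym mu_ne ?andTb;last exact: x_r.
  apply: contra nx; rewrite !mem_cat => /orP[h|/mapP[y yx E2]].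
    by apply/orP; right; rewrite -(muK (x_r n.+1)); exact: map_f.
  apply/orP; left; have [k _ yk] := mem_xs _ _ yx.
  by rewrite -(muK (x_r n.+1)) E2 yk muK // -yk.
have nux k : nu (x k.+1) = mu (x k) by rewrite /= nuK //; exact: mu_r.
rewrite mem_cat => /orP[/mem_xs[k kn E]|/mapP[_ /mem_xs[k kn ->] E]].
  case: k kn E => [//|k] kn E.
  have E2 : mu (x k) = mu (x n) by rewrite -!nux E.
  have : x k = x n by rewrite -(muK (x_r k)) E2 muK.
  by move/(x_inj u); lia.
have E2 : nu (mu (x k)) = mu (x n) by rewrite -E nux.
have [kn1|kn1] := ltnP k n.
  by have := @x_mu_ne _ k.+1 n u kn1 (leqnn _); case; rewrite /= E2.
have {kn1} kE : k = n by lia.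
by have := nu_ne (mu_r (x_r n)); rewrite -{1}kE E2 eqxx.
Qed.

Lemma walkP : exists n, [/\ s = 2 * n, x n = 1,
  (forall j k, j < n -> k < n -> x j = x k -> j = k),
  (forall j k, j < n -> k < n -> x j <> mu (x k)) &
  forall i, 1 <= i <= s -> exists2 k, k < n & i = x k \/ i = mu (x k)].
Proof.
have bound n : uniq (ends n) -> n <= s.
  move=> /uniq_xs u; have : size (xs n) <= size (iota 1 s).
    apply: uniq_leq_size u _ => _ /mem_xs[k _ ->]; rewrite mem_iota; have := x_r k; lia.
  by rewrite size_map !size_iota.
have u1 : uniq (ends 1) by rewrite /= inE eq_sym mu_ne.
have ex1 : exists n, uniq (ends n) by exists 1.
have [n un nmax] := ex_maxnP ex1 bound.
have n0 : 0 < n by exact: nmax.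
have nn : ~~ uniq (ends n.+1) by apply/negP => /nmax; rewrite ltnn.
have xn := walk_closes n0 un nn.
have cover i : 1 <= i <= s -> exists2 k, k < n & i = x k \/ i = mu (x k).
  move=> ii; have : i \in ends n.
    apply: (conn (S := mem (ends n))) ii => [i0 _|i0 _|].
    - rewrite /= !mem_cat => /orP[h|/mapP[y /mem_xs[k kn ->] ->]].
        by apply/orP; right; exact: map_f.
      by apply/orP; left; rewrite muK //; apply/mem_xs; exists k.
    - rewrite /= !mem_cat => /orP[/mem_xs[k kn ->]|/mapP[y /mem_xs[k kn ->] ->]].
        apply/orP; right; case: k kn => [|k] kn.
          rewrite -[x 0]/1 -xn; case: n n0 {un nmax nn xn kn} => // n _.
          by rewrite [x _]/= nuK ?mu_r //; apply: map_f; apply/mem_xs; exists n.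
        rewrite [x _]/= nuK ?mu_r //; apply: map_f; apply/mem_xs; exists k => //; lia.
      apply/orP; left; rewrite -[nu _]/(x k.+1); apply/mem_xs.
      have [kn1|kn1] := ltnP k.+1 n; first by exists k.+1.
      have -> : k.+1 = n by lia.
      by exists 0.
    - by rewrite /= mem_cat; apply/orP; left; apply/mem_xs; exists 0.
  rewrite mem_cat => /orP[/mem_xs[k kn ->]|/mapP[_ /mem_xs[k kn ->] ->]]; exists k => //.
    by left.
  by right.
exists n; split=> //; [|by move=> j k; exact: x_inj|by move=> j k; exact: x_mu_ne].
have P : perm_eq (ends n) (iota 1 s).
  apply: uniq_perm => //; first exact: iota_uniq.
  move=> i; rewrite mem_iota; apply/idP/idP.
    rewrite mem_cat => /orP[/mem_xs[k kn ->]|/mapP[_ /mem_xs[k kn ->] ->]].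
      by have := x_r k; lia.
    by have := mu_r (x_r k); lia.
  move=> ii; have [|k kn H] := cover i; first lia.
  rewrite mem_cat; apply/orP; case: H => ->; [left|right; apply: map_f]; apply/mem_xs; by exists k.
by have := perm_size P; rewrite size_cat !size_map !size_iota; lia.
Qed.

End Walk.

(** * Every knot is a checkerboard *)

Section TopMate.
Variables (b : nat) (js : seq nat).
Let s := 2 * b.
Hypothesis vj : valid s js.

Lemma top_mate_range i : 1 <= i <= s -> 1 <= top_mate js i <= s.
Proof. by move=> ii; rewrite /top_mate pos_range ?valid_rev // mate_range // pos_range. Qed.

Lemma pos_gt0 i : 1 <= i <= s -> 0 < pos js i.
Proof. by rewrite -(pos_range i vj) => /andP[]. Qed.

Lemma top_mateK i : 1 <= i <= s -> top_mate js (top_mate js i) = i.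
Proof. by move=> ii; rewrite /top_mate pos_revK mateK ?posK // pos_gt0. Qed.

Lemma top_mate_neq i : 1 <= i <= s -> top_mate js i != i.
Proof.
move=> ii; apply/eqP => E; have /eqP := mate_neq (pos_gt0 ii); apply.
by rewrite -{2}E pos_revK.
Qed.

Definition one_component : Prop := forall S : pred nat,
  (forall i, 1 <= i <= s -> S i -> S (mate i)) ->
  (forall i, 1 <= i <= s -> S i -> S (top_mate js i)) ->
  S 1 -> forall i, 1 <= i <= s -> S i.

Definition walk k := iter k (top_mate js \o mate) 1.

Lemma walk_spec : 0 < b -> one_component -> [/\ walk b = 1,
  (forall j k, j < b -> k < b -> walk j = walk k -> j = k),
  (forall j k, j < b -> k < b -> walk j <> mate (walk k)) &
  forall i, 1 <= i <= s -> exists2 k, k < b & i = walk k \/ i = mate (walk k)].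
Proof.
move=> b0 conn.
have [| | | | | | | |n [sn wn inj dis cov]] := @walkP s mate (top_mate js).
- exact: mate_range.
- exact: top_mate_range.
- by move=> i /andP[i0 _]; exact: mateK.
- exact: top_mateK.
- by move=> i /andP[i0 _]; exact: mate_neq.
- exact: top_mate_neq.
- by rewrite /s; lia.
- exact: conn.
by have -> : b = n by rewrite /s in sn; lia.
Qed.

Lemma walk_range k : 0 < b -> 1 <= walk k <= s.
Proof.
move=> b0; elim: k => [|k IH] /=; first by rewrite /s; lia.
by apply: top_mate_range; exact: mate_range.
Qed.

Lemma top_mate_walkS k : 0 < b -> top_mate js (walk k.+1) = mate (walk k).
Proof. by move=> b0; rewrite /= top_mateK // mate_range // walk_range. Qed.

End TopMate.

Lemma top_mateE js i k : mate (pos js i) = pos js k -> top_mate js i = k.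
Proof. by rewrite /top_mate => ->; rewrite posK. Qed.

Lemma one_component_evens b : one_component b (evens (2 * b)).
Proof.
move=> S S1 S2 Sb.
have pair k : k.*2.+1 < 2 * b -> S k.*2.+1 -> S k.*2.+2.
  move=> kb /S1; rewrite /mate /= odd_double /=; apply; lia.
have H k : k.*2.+1 < 2 * b -> S k.*2.+1.
  elim/ltn_ind: k => -[//|[|k]] IH kb.
    have -> : 3 = top_mate (evens (2 * b)) 1.
      apply/esym/top_mateE; rewrite !pos_evens; [|lia|lia].
      by rewrite /mate.
    by apply: S2 => //; lia.
  have -> : k.+2.*2.+1 = top_mate (evens (2 * b)) k.*2.+2.
    apply/esym/top_mateE; rewrite !pos_evens; [|lia|lia].
    have o1 : odd k.*2.+2 = false by rewrite /= odd_double.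
    have o2 : odd k.+2.*2.+1 by rewrite /= odd_double.
    have o3 : odd k.*2.+3 by rewrite /= odd_double.
    rewrite o1 o2; case: eqP => [|_]; first lia.
    by rewrite /mate o3; case: eqP; lia.
  apply: S2; first lia.
  by apply: pair; [lia|apply: IH; lia].
move=> i ii; have := odd_double_half i; case: (odd i) => /= hi.
  by rewrite -hi add1n; apply: H; lia.
have -> : i = (i./2.-1).*2.+2 by lia.
by apply: pair; [lia|apply: H; lia].
Qed.

(** Two one-component patterns of arcs are related by a permutation of the bottom caps:
    match the two walks. *)
Lemma match_walks b js ks : 0 < b -> valid (2 * b) js -> valid (2 * b) ks ->
  one_component b js -> one_component b ks ->
  exists h : nat -> nat, [/\ (forall i, 1 <= i <= 2 * b -> 1 <= h i <= 2 * b),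
    (forall i j, 1 <= i <= 2 * b -> 1 <= j <= 2 * b -> h i = h j -> i = j),
    (forall i, 1 <= i <= 2 * b -> h (mate i) = mate (h i)) &
    (forall i, 1 <= i <= 2 * b -> h (top_mate js i) = top_mate ks (h i))].
Proof.
move=> b0 vj vk cj ck.
have [wj injj disj covj] := walk_spec vj b0 cj.
have [wk injk disk covk] := walk_spec vk b0 ck.
pose x := walk js; pose y := walk ks.
have xr k : 1 <= x k <= 2 * b by exact: walk_range.
have yr k : 1 <= y k <= 2 * b by exact: walk_range.
have x0 k : 0 < x k by case/andP: (xr k).
have y0 k : 0 < y k by case/andP: (yr k).
pose xs := map x (iota 0 b).
have szx : size xs = b by rewrite size_map size_iota.
have nx k : k < b -> nth 0 xs k = x k.
  by move=> kb; rewrite (nth_map 0) ?size_iota // nth_iota.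
have ux : uniq xs.
  rewrite map_inj_in_uniq ?iota_uniq // => i j.
  by rewrite !mem_iota => /andP[_ ib] /andP[_ jb]; apply: injj; lia.
have ix k : k < b -> index (x k) xs = k by move=> kb; rewrite -nx // index_uniq // szx.
pose h i := if index i xs < b then y (index i xs) else mate (y (index (mate i) xs)).
have hx k : k < b -> h (x k) = y k by move=> kb; rewrite /h ix // kb.
have hmx k : k < b -> h (mate (x k)) = mate (y k).
  move=> kb; rewrite /h mateK // ix // ifF //; apply/negP.
  rewrite -szx index_mem => /mapP[j]; rewrite mem_iota => /andP[_ jb] E.
  by apply: (disj j k) (esym E); lia.
exists h; split.
- move=> i /covj[k kb [->|->]]; first by rewrite hx.
  by rewrite hmx // mate_range.
- move=> i j /covj[k kb E1] /covj[l lb E2].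
  case: E1 => ->; case: E2 => ->; rewrite ?hx ?hmx //.
  + by move/(injk _ _ kb lb) ->.
  + by move/(disk _ _ kb lb).
  + by move/esym/(disk _ _ lb kb).
  + move=> E; have : y k = y l by rewrite -(mateK (y0 k)) E mateK.
    by move/(injk _ _ kb lb) ->.
- move=> i /covj[k kb [->|->]]; first by rewrite hx ?hmx.
  by rewrite mateK // hx // hmx // mateK.
- have step k : k < b -> h (x k.+1) = y k.+1.
    move=> kb; have [kb1|kb1] := ltnP k.+1 b; first exact: hx.
    have -> : k.+1 = b by lia.
    by rewrite /x /y wj wk; exact: (hx 0 b0).
  have back k : k < b -> exists2 l, l < b & x k = x l.+1 /\ y k = y l.+1.
    case: k => [_|k kb]; last by exists k => //; exact: ltnW.
    by exists b.-1; [lia|rewrite prednK // /x /y wj wk].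
  move=> i /covj[k kb [->|->]].
    have [l lb [E1 E2]] := back k kb.
    rewrite hx // -/(x k) E1 E2 /x /y (top_mate_walkS vj) // (top_mate_walkS vk) //.
    exact: hmx.
  by rewrite hmx //; exact: step.
Qed.

Section Checkerboard.
Variables (R : realType) (b : nat) (w : seq letter).
Let s := 2 * b.
Hypotheses (b0 : 0 < b) (vw : valid s (idx w)) (cw : one_component b (idx w)).

(** The permutation [h] of the bottom strands respects the bottom caps and carries the top
    matching of [w] to that of the even row; hence the permutation [t] of the top
    positions that makes the diagram commute respects the top caps. Both are realized
    by layered words with the identity for depths, where mates are consecutive. *)
Lemma plat_equiv_evens : exists v, [/\ valid s (idx v), plat_equiv R b w v &
  forall i, 1 <= i <= s -> pos (idx v) i = pos (evens s) i].
Proof.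
have [h [hr hi hm ht]] := match_walks b0 vw (valid_evens s) cw (@one_component_evens b).
have [hs vhs Hs] := realize_perm hr hi.
pose t i := pos (evens s) (h (pos (rev (idx w)) i)).
have pr i : 1 <= i <= s -> 1 <= pos (rev (idx w)) i <= s by rewrite pos_range ?valid_rev.
have tr i : 1 <= i <= s -> 1 <= t i <= s.
  by move=> ii; rewrite pos_range ?valid_evens // hr // pr.
have tinj i j : 1 <= i <= s -> 1 <= j <= s -> t i = t j -> i = j.
  by move=> ii jj /pos_inj /hi E; apply: (@pos_inj (rev (idx w))); apply: E; exact: pr.
have [ts vts Ts] := realize_perm tr tinj.
have tm i : 1 <= i <= s -> t (mate i) = mate (t i).
  move=> ii; have := ht _ (pr i ii); rewrite {1}/top_mate pos_revK /t => ->.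
  by rewrite /top_mate pos_revK.
pose H := layered_word id hs; pose T := layered_word id ts.
have vH : valid s (idx H) by rewrite idx_layered_word.
have vT : valid s (idx T) by rewrite idx_layered_word.
have vwT : valid s (idx (w ++ T)) by rewrite idx_cat valid_cat vw.
have consec i : 1 <= i <= s -> id (mate i) = (id i).+1 \/ id i = (id (mate i)).+1.
  by case/andP=> i0 _; exact: mate_consecutive.
exists (winv H ++ w ++ T); split.
- by rewrite idx_cat valid_cat idx_winv valid_rev vH.
- have E1 : plat_equiv R b (w ++ T) w.
    apply: (slide_caps R (d := id)) => //; first exact: layered_word_layered.
    by move=> i ii; rewrite idx_layered_word !Ts ?mate_range // tm.
  apply: isotopic_trans (isotopic_sym E1) _; apply: isotopic_sym.
  have E2 : plat_equiv R b (winv (w ++ T) ++ H) (winv (w ++ T)).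
    apply: (slide_caps R (d := id)) => //; first exact: layered_word_layered.
      by rewrite idx_winv valid_rev.
    by move=> i ii; rewrite idx_layered_word !Hs ?mate_range // hm.
  by have := isotopic_winv E2; rewrite winv_cat winvK.
- move=> i ii; rewrite !idx_cat !pos_cat idx_winv !idx_layered_word.
  have xi : 1 <= pos (rev hs) i <= s by rewrite pos_range ?valid_rev.
  rewrite Ts; last by rewrite pos_range.
  by rewrite /t posK -Hs // pos_revK.
Qed.

Lemma plat_equiv_checkerboard : exists n v,
  [/\ 0 < n, checkerboard_word b (2 * n * b) v & plat_equiv R b w v].
Proof.
have [v [vv Ev pv]] := plat_equiv_evens.
(* All signs of the prefix may be positive. *)
pose P : seq letter := [seq (j, true) | j <- evens s].
have PE : idx P = evens s by rewrite /idx /P -map_comp map_id.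
have vP : valid s (idx P) by rewrite PE valid_evens.
have vu : valid s (idx (winv P ++ v)).
  by rewrite idx_cat valid_cat idx_winv valid_rev vP.
have [|n [r [n0 rr Er]]] := @pure_rosette R b _ vu.
  move=> i ii; rewrite idx_cat pos_cat idx_winv PE pv ?pos_revK //.
  by rewrite pos_range ?valid_rev ?valid_evens.
exists n, (P ++ r); split=> //.
  exists (fun _ => true), r; split=> //.
  by rewrite (_ : 2 * n * b = s * n) // /s; lia.
apply: isotopic_trans Ev _; apply: exchangeable_plat.
apply: exchangeable_trans (exchangeable_catl vP Er).
rewrite catA -[X in exchangeable _ _ X _]cat0s; apply: exchangeable_catr => //.
by apply: exchangeable_sym; exact: cancel_winv.
Qed.

End Checkerboard.

Theorem theorem2p3 (R : realType) (K : set (space3 R)) (b : nat)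
    (knotK : knot K) (bridgeK : has_bridge_number K b) :
  exists n : nat, (0 < n)%N /\ has_checkerboard_diagram K b (2 * n * b)%N.
Proof.
case: bridgeK => b0 [w vw Kw] _.
have cw : one_component b (idx w).
  by move=> S S1 S2 Sb; apply: (connected_strands vw knotK Kw S1 S2 _ Sb); lia.
have [n [v [n0 cv Ev]]] := plat_equiv_checkerboard R b0 (proj1 (braid_wordP _ _) vw) cw.
by exists n; split=> //; exists v => //; apply: isotopic_trans Kw Ev.
Qed.
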